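(* Let $\omega$ be a smooth, closed, positive $(1,1)$-form on $\mathbb{R}^n$ (in the sense of super forms) and let $\varphi$ be a smooth real-valued function on $\mathbb{R}^n$. If $\alpha$ is a smooth and compactly supported form, then $$\Box_{\varphi}\alpha=\Box_{\varphi}^{\#}\alpha+[dd^{\#}\varphi,\Lambda]\alpha .$$
   Context: Super forms: on $\mathbb{R}^n\times\mathbb{R}^n$ with coordinates $(x_1,\dots,x_n,\xi_1,\dots,\xi_n)$, a $(p,q)$-form is $\alpha=\sum_{|I|=p,|J|=q}\alpha_{IJ}(x)\,dx_I\wedge d\xi_J$ with real coefficients depending only on $x$. It is smooth (compactly supported) if its coefficients are smooth (compactly supported) functions on $\mathbb{R}^n$. Set $d\alpha=\sum_i dx_i\wedge\partial_{x_i}\alpha$ and $d^{\#}\alpha=\sum_i d\xi_i\wedge\partial_{x_i}\alpha$, where $\partial_{x_i}$ acts on coefficients. $J$ is the linear map with $J(\alpha_{IJ}dx_I\wedge d\xi_J)=\alpha_{IJ}d\xi_I\wedge dx_J$. A form $\alpha$ is closed if $d\alpha=0$. A smooth $(1,1)$-form $\omega=\sum\omega_{ij}dx_i\wedge d\xi_j$ is positive if the matrix $(\omega_{ij}(x))$ is (symmetric) positive definite for each $x$. Metric: $\omega$ induces at each $x$ the inner product on $(1,0)$-forms $(\sum a_idx_i,\sum b_jdx_j)=\sum\omega^{ij}(x)a_ib_j$, $(\omega^{ij})=(\omega_{ij})^{-1}$. If $e_1,\dots,e_n$ is an orthonormal basis of $(1,0)$-forms at $x$ and $\epsilon_i=J(e_i)$,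 the inner product $(\cdot,\cdot)$ on $(p,q)$-forms at $x$ is the one for which the forms $e_I\wedge\epsilon_J$ are orthonormal (independent of choices); forms of different bidegree are orthogonal; $|\alpha|^2=(\alpha,\alpha)$. $L\alpha=\omega\wedge\alpha$ and $\Lambda$ is its pointwise adjoint: $(L\alpha,\beta)=(\alpha,\Lambda\beta)$. Integration: $\int_{\mathbb{R}^n\times\mathbb{R}^n}\alpha_0(x)\,dx_1\wedge d\xi_1\wedge\dots\wedge dx_n\wedge d\xi_n=\int_{\mathbb{R}^n}\alpha_0(x)\,dx$; $\omega_n=\omega^n/n!$. Put $\langle\alpha,\beta\rangle_\varphi=\int_{\mathbb{R}^n\times\mathbb{R}^n}(\alpha,\beta)e^{-\varphi}\omega_n$. Operators: $d^{\#}_\varphi=e^{\varphi}d^{\#}e^{-\varphi}$, i.e. $d^{\#}_\varphi\alpha=e^{\varphi}d^{\#}(e^{-\varphi}\alpha)$; $d^*$ and $(d^{\#}_\varphi)^*$ denote the adjoints of $d$ and $d^{\#}_\varphi$ with respect to $\langle\cdot,\cdot\rangle_\varphi$. Define $\Box_\varphi\alpha=dd^*\alpha+d^*d\alpha$ and $\Box^{\#}_\varphi\alpha=d^{\#}_\varphi(d^{\#}_\varphi)^*\alpha+(d^{\#}_\varphi)^*d^{\#}_\varphi\alpha$. In the commutator, $dd^{\#}\varphi$ denotes the operator $\alpha\mapsto dd^{\#}\varphi\wedge\alpha$, so $[dd^{\#}\varphi,\Lambda]\alpha=dd^{\#}\varphi\wedge\Lambda\alpha-\Lambda(dd^{\#}\varphi\wedge\alpha)$.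 *)

(* Defs.v *)
From HB Require Import structures.
From mathcomp Require Import all_boot all_order all_algebra.
From mathcomp Require Import all_classical all_reals all_analysis.

Set Implicit Arguments.
Unset Strict Implicit.
Unset Printing Implicit Defensive.

Import Order.TTheory GRing.Theory Num.Theory.
Import numFieldNormedType.Exports.

Local Open Scope classical_set_scope.
Local Open Scope ring_scope.

(** * Lebesgue measure on R^n

  [tuple_measure mu n] is the n-fold product of [mu], on the product
  sigma-algebra of [n.-tuple T]: the (n+1)-fold product is the image of
  [mu \x tuple_measure mu n] under (x, t) |-> x :: t. *)

(* The library's sigma-finite instance for [\x] is not found by unification:
   the instance for subprobabilities shadows it. *)
Lemma sigma_finite_product d1 d2 (T1 : measurableType d1)
    (T2 : measurableType d2) (R : realType)
    (m1 : {sigma_finite_measure set T1 -> \bar R})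
    (m2 : {sigma_finite_measure set T2 -> \bar R}) :
  sigma_finite setT (m1 \x m2)%E.
Proof.
have /sigma_finiteP[F [TF ndF Foo]] := sigma_finiteT m1.
have /sigma_finiteP[G [TG ndG Goo]] := sigma_finiteT m2.
exists (fun n => F n `*` G n).
  rewrite -setXTT TF TG predeqE => -[x y]; split.
    move=> [/= [n _ Fnx] [k _ Gky]]; exists (maxn n k) => //; split.
    - by move: x Fnx; exact/subsetPset/ndF/leq_maxl.
    - by move: y Gky; exact/subsetPset/ndG/leq_maxr.
  by move=> [n _ []/= ? ?]; split; exists n.
move=> k; have [? ?] := Foo k; have [? ?] := Goo k.
split; first exact: measurableX.
by rewrite product_measure1E// lte_mul_pinfty// ge0_fin_numE.
Qed.

Section TupleMeasure.
Context d (T : measurableType d) (R : realType).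
Variable mu : {sigma_finite_measure set T -> \bar R}.

Definition tuple_cons (n : nat) (p : T * n.-tuple T) : n.+1.-tuple T :=
  [tuple of p.1 :: p.2].

Lemma measurable_tuple_cons n : measurable_fun setT (@tuple_cons n).
Proof.
exact: (measurable_cons (f := fst) (g := snd) measurable_fst measurable_snd).
Qed.

Section Step.
Context (n : nat) (m : {sigma_finite_measure set (n.-tuple T) -> \bar R}).

Definition cons_measure : set (n.+1.-tuple T) -> \bar R :=
  pushforward (mu \x m)%E (@tuple_cons n).

Let cm0 : cons_measure set0 = 0%E.
Proof. by rewrite /cons_measure /pushforward preimage_set0 measure0. Qed.

Let cm_ge0 A : (0 <= cons_measure A)%E.
Proof. by rewrite /cons_measure /pushforward measure_ge0. Qed.

Let cm_sigma_additive : semi_sigma_additive cons_measure.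
Proof.
move=> F mF tF mUF; rewrite /cons_measure /pushforward preimage_bigcup.
have mpre A : measurable A -> measurable (@tuple_cons n @^-1` A).
  move=> mA; rewrite -[X in measurable X]setTI.
  exact: measurable_tuple_cons.
apply: measure_semi_sigma_additive.
- by move=> i; exact: mpre.
- apply/trivIsetP => i j _ _ ij; rewrite -preimage_setI.
  by move/trivIsetP : tF => -> //; rewrite preimage_set0.
- by rewrite -preimage_bigcup; exact: mpre.
Qed.

HB.instance Definition _ :=
  isMeasure.Build _ _ _ cons_measure cm0 cm_ge0 cm_sigma_additive.

Let cm_sigma_finite : sigma_finite setT cons_measure.
Proof.
have [F FT Ffin] : sigma_finite setT (mu \x m)%E by exact: sigma_finite_product.
pose uncons (t : n.+1.-tuple T) : T * n.-tuple T :=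
  (thead t, [tuple of behead t]).
have muncons : measurable_fun setT uncons.
  apply/measurable_fun_pairP; split; first exact: measurable_tnth.
  exact: measurable_behead.
have consK p : uncons (tuple_cons p) = p.
  by case: p => x t; rewrite /uncons/=; congr pair; exact: val_inj.
exists (fun i => uncons @^-1` F i).
  by rewrite -preimage_bigcup -FT preimage_setT.
move=> i; have [mF Foo] := Ffin i; split.
  by rewrite -[X in measurable X]setTI; exact: muncons.
rewrite /cons_measure /pushforward -comp_preimage.
rewrite (_ : uncons \o @tuple_cons n = id) ?preimage_id//.
by apply/funext => p; exact: consK.
Qed.

HB.instance Definition _ :=
  Measure_isSigmaFinite.Build _ _ _ cons_measure cm_sigma_finite.

End Step.

Fixpoint tuple_measure (n : nat)
    : {sigma_finite_measure set (n.-tuple T) -> \bar R} :=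
  match n with
  | 0 => \d_([tuple] : 0.-tuple T)
  | k.+1 => cons_measure (tuple_measure k)
  end.

End TupleMeasure.

Definition integral_rV (R : realType) (n : nat) (f : 'rV[R]_n -> R) : R :=
  \int[tuple_measure (@lebesgue_measure R) n]_(t in setT) f (\row_i tnth t i).

(** * Smooth functions *)

Section Smooth.
Context (R : realType) (n : nat).

Fixpoint Ck (k : nat) (f : 'rV[R]_n -> R) : Prop :=
  continuous f /\
  match k with
  | 0 => True
  | k'.+1 => forall i : 'I_n, (forall x, derivable f x (delta_mx 0 i)) /\
                              Ck k' ('D_(delta_mx 0 i) f)
  end.

Definition smooth (f : 'rV[R]_n -> R) : Prop := forall k, Ck k f.

End Smooth.

(** * The exterior algebra on dx_1, ..., dx_n, dxi_1, ..., dxi_n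

  The generators are indexed by ['I_(n + n)]: [lshift n i] stands for dx_i and
  [rshift n i] for dxi_i. An element [a] is given by its coefficients on the
  monomials indexed by the subsets of ['I_(n + n)], each monomial being the
  wedge product of its generators in increasing order. The coefficient of
  dx_I /\ dxi_J is therefore [a (ord_pair I J)]. *)

Section Exterior.
Context (R : realType) (n : nat).

Definition ext := {ffun {set 'I_(n + n)} -> R^o}.

Implicit Types (S T U : {set 'I_(n + n)}) (I J K L : {set 'I_n}) (a b w : ext).

Definition mono S : ext := [ffun T => (T == S)%:R].
Definition ext1 : ext := mono finset.set0.
Definition dx (i : 'I_n) : ext := mono [set lshift n i]%SET.
Definition dxi (i : 'I_n) : ext := mono [set rshift n i]%SET.

Definition ord_pair I J : {set 'I_(n + n)} :=
  (@lshift n n @: I :|: @rshift n n @: J)%SET.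

(* mono S /\ mono T = wedge_sign S T * mono (S :|: T) for disjoint S and T:
   the exponent counts the inversions between S and T. *)
Definition wedge_sign S T : R :=
  (-1) ^+ #|[set p in finset.setX S T | (p.2 < p.1)%N]%SET|.

Definition wedge a b : ext :=
  [ffun U : {set 'I_(n + n)} =>
    \sum_(S in powerset U) wedge_sign S (U :\: S)%SET * a S * b (U :\: S)%SET].

Local Notation "\wedge_ ( i 'in' I ) F" := (\big[wedge/ext1]_(i in I) F)
  (at level 36, i at level 50, I at level 50, F at level 36).

(* The map J of super forms: dx_I /\ dxi_J |-> dxi_I /\ dx_J. *)
Definition Jmap a : ext :=
  \sum_(I : {set 'I_n}) \sum_(J : {set 'I_n})
    a (ord_pair I J) *: wedge (\wedge_(i in I) dxi i) (\wedge_(j in J) dx j).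

Definition volume : ext := \big[wedge/ext1]_(i < n) wedge (dx i) (dxi i).

Definition one_zero_form (v : 'rV[R]_n) : ext := \sum_i v 0 i *: dx i.

Definition omega_mx w : 'M[R]_n :=
  \matrix_(i, j) w (ord_pair [set i]%SET [set j]%SET).

Definition posdef (M : 'M[R]_n) : Prop :=
  M^T = M /\ forall v : 'rV[R]_n, v != 0 -> 0 < (v *m M *m v^T) 0 0.

(** ** The inner product induced by a positive (1,1)-vector [w] *)

Definition covector_dot w (u v : 'rV[R]_n) : R :=
  (u *m invmx (omega_mx w) *m v^T) 0 0.

(* n orthonormal covectors automatically form a basis. *)
Definition orthonormal_basis w (e : 'I_n -> 'rV[R]_n) : Prop :=
  forall i j, covector_dot w (e i) (e j) = (i == j)%:R.

(* e_I /\ epsilon_J, where epsilon_j = J(e_j). *)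
Definition frame_mono (e : 'I_n -> 'rV[R]_n) I J : ext :=
  wedge (\wedge_(i in I) one_zero_form (e i))
        (\wedge_(j in J) Jmap (one_zero_form (e j))).

Definition is_form_dot w (ip : ext -> ext -> R) : Prop :=
  [/\ forall a, scalar (ip a), forall b, scalar (ip ^~ b) &
      forall e, orthonormal_basis w e -> forall I J K L,
        ip (frame_mono e I J) (frame_mono e K L) = ((I == K) && (J == L))%:R].

(* For [omega_mx w] positive definite, [is_form_dot w] has exactly one
   element. *)
Definition form_dot w : ext -> ext -> R :=
  xget (fun _ _ => 0) [set ip | is_form_dot w ip].

End Exterior.

(** * Adjoints

  [adjoint dom ip T v] is the unique w in [dom] such that
  ip (T u) v = ip u w for all u in [dom], whenever it exists and is unique. *)

Definition adjoint (R : realType) (V : zmodType) (dom : set V)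
    (ip : V -> V -> R) (T : V -> V) (v : V) : V :=
  xget 0 [set w | dom w /\ forall u, dom u -> ip (T u) v = ip u w].

(** * Super forms *)

Section SuperForms.
Context (R : realType) (n : nat).

(* Inhomogeneous super forms: sums of (p, q)-forms for all p, q. *)
Definition superform := 'rV[R]_n -> ext R n.

Implicit Types (alpha beta omega : superform) (phi : 'rV[R]_n -> R).

Definition bidegree (p q : nat) alpha : Prop :=
  forall x (I J : {set 'I_n}),
    alpha x (ord_pair I J) != 0 -> #|I| = p /\ #|J| = q.

Definition smooth_form alpha : Prop :=
  forall S, smooth (fun x => alpha x S : R).

Definition compactly_supported alpha : Prop :=
  compact (closure [set x | alpha x != 0]).

Definition test_form : set superform :=
  [set alpha | smooth_form alpha /\ compactly_supported alpha].

Definition zero_form phi : superform := fun x => phi x *: ext1 R n.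

Definition partial (i : 'I_n) alpha : superform :=
  fun x => [ffun S => 'D_(delta_mx 0 i) (fun y => alpha y S : R) x].

Definition dform alpha : superform :=
  fun x => \sum_i wedge (dx R i) (partial i alpha x).

Definition dsharp alpha : superform :=
  fun x => \sum_i wedge (dxi R i) (partial i alpha x).

Definition closed_form alpha : Prop := forall x, dform alpha x = 0.

Definition positive_11 omega : Prop :=
  bidegree 1 1 omega /\ forall x, posdef (omega_mx (omega x)).

(* The integral of a form is that of the coefficient of its (n, n)-part on
   [volume]. The latter is +-1 times the monomial indexed by [setT]. *)
Definition form_integral alpha : R :=
  integral_rV (fun x => alpha x [set: 'I_(n + n)]%SET
                        / volume R n [set: 'I_(n + n)]%SET).

(* omega_n = omega^n / n! *)
Definition omega_n omega : superform :=
  fun x => (n`!%:R)^-1 *: iter n (wedge (omega x)) (ext1 R n).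

Section Operators.
Context (omega : superform) (phi : 'rV[R]_n -> R).

Definition L2dot alpha beta : R :=
  form_integral (fun x =>
    (form_dot (omega x) (alpha x) (beta x) * expR (- phi x))
      *: omega_n omega x).

Definition Lambda alpha : superform :=
  fun x => adjoint setT (form_dot (omega x)) (wedge (omega x)) (alpha x).

Definition dsharp_phi alpha : superform :=
  fun x => expR (phi x) *: dsharp (fun y => expR (- phi y) *: alpha y) x.

Definition dstar : superform -> superform := adjoint test_form L2dot dform.

Definition dsharp_phi_star : superform -> superform :=
  adjoint test_form L2dot dsharp_phi.

Definition Box alpha : superform :=
  fun x => dform (dstar alpha) x + dstar (dform alpha) x.

Definition Box_sharp alpha : superform :=
  fun x => dsharp_phi (dsharp_phi_star alpha) x
         + dsharp_phi_star (dsharp_phi alpha) x.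

Definition ddsharp_comm alpha : superform :=
  fun x => wedge (dform (dsharp (zero_form phi)) x) (Lambda alpha x)
    - Lambda (fun y => wedge (dform (dsharp (zero_form phi)) y) (alpha y)) x.

End Operators.

End SuperForms.

(* Main.v *)
Require Import Defs.
From HB Require Import structures.
From mathcomp Require Import all_boot all_order all_algebra.
From mathcomp Require Import all_classical all_reals all_analysis.
From mathcomp Require Import measurable_realfun.
From mathcomp Require Import ring lra.

(** The identity is a formal consequence of two Kahler identities. Write B for
[d#_phi]. If the adjoints with respect to the weighted product are

  d^* = [Lambda, B]    and    B^* = [d, Lambda],

then expanding both Laplacians leaves
Box - Box# = Lambda {d, B} - {d, B} Lambda, where {d, B} = d B + B d, and
{d, B} is wedging with - dd#phi because second partial derivatives commute.

All the algebra takes place in the Fock space picture of the exterior algebra: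
[emul k] is left multiplication by the k-th generator, [contr k] is the
contraction against it, and they satisfy the canonical anticommutation
relations. The inner product of forms induced by the metric is the
bilinear form, normalized on 1, for which [emul k] is adjoint to a metric
contraction; it is built in this way, identified with [form_dot] by means of an
orthonormal frame ([form_dotE]), and its derivative along x_k is governed by the
derivation extending - G d_k(omega) on covectors, where G is the inverse matrix
of omega ([dot_smooth_pd]). In the same picture [Lambda] becomes
sum_ij G_ij contr(xi_j) contr(x_i) ([dotH_lef]), and omega^n / n! has a nowhere
vanishing density with logarithmic derivative tr (G d_k(omega))
([lefn_volume_neq0], [lef_lefn_top]).

Integrating by parts, by Fubini and the fundamental theorem of calculus
([integral_rV_divergence]), gives explicit first order formulas for the two
adjoints ([L2dot_codiff]). Compared with the commutators, they contain the same
terms in the derivatives of the form, plus terms of order zero that are linear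
in d_k(omega_ij). These coincide because d omega = 0 makes d_k(omega_ij)
symmetric in all three indices ([kahler_core]), while contractions
anticommute. Adjoints are unique since the weighted product is definite up to
the sign of the density ([L2dot_nondegenerate]). *)

Set Implicit Arguments.
Unset Strict Implicit.
Unset Printing Implicit Defensive.
Import Order.TTheory GRing.Theory Num.Theory.
Import numFieldNormedType.Exports.
Local Open Scope ring_scope.

(** * Creation and annihilation operators on the exterior algebra *)

Section ExteriorOperators.
Context (R : realType) (n : nat).
Implicit Types (S T U : {set 'I_(n + n)}) (a b c : ext R n) (k l : 'I_(n + n)).

Lemma extD a b S : (a + b) S = a S + b S. Proof. by rewrite ffunE. Qed.
Lemma extZ (r : R) a S : (r *: a) S = r * a S. Proof. by rewrite ffunE. Qed.
Lemma extN a S : (- a) S = - a S. Proof. by rewrite ffunE. Qed.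
Lemma ext_sum I (r : seq I) (P : pred I) (F : I -> ext R n) S :
  (\sum_(i <- r | P i) F i) S = \sum_(i <- r | P i) F i S.
Proof. by elim/big_rec2: _ => [|i x y _ <-]; rewrite ffunE. Qed.

Lemma ext_mono a : a = \sum_S a S *: mono R S.
Proof.
apply/ffunP => T; rewrite ext_sum (bigD1 T)//= extZ ffunE eqxx mulr1.
by rewrite big1 ?addr0// => S ST; rewrite extZ ffunE eq_sym (negbTE ST) mulr0.
Qed.

Lemma wedge_linl b : linear (@wedge R n ^~ b).
Proof.
move=> r a a'; apply/ffunP => U; rewrite extD extZ !ffunE mulr_sumr -big_split/=.
apply: eq_bigr => S _; rewrite extD extZ /=; ring.
Qed.

Lemma wedge_linr a : linear (wedge a).
Proof.
move=> r b b'; apply/ffunP => U; rewrite extD extZ !ffunE mulr_sumr -big_split/=.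
apply: eq_bigr => S _; rewrite extD extZ /=; ring.
Qed.

HB.instance Definition _ a :=
  GRing.isLinear.Build R (ext R n) (ext R n) _ (wedge a) (wedge_linr a).

Definition wedger b a := wedge a b.
HB.instance Definition _ b :=
  GRing.isLinear.Build R (ext R n) (ext R n) _ (wedger b) (wedge_linl b).

Lemma wedgePl (r : R) a a' b :
  wedge (r *: a + a') b = r *: wedge a b + wedge a' b.
Proof. exact: wedge_linl. Qed.

Lemma wedge0l b : wedge 0 b = 0.
Proof. exact: (linear0 (wedger b)). Qed.

Lemma wedgeZl (r : R) a b : wedge (r *: a) b = r *: wedge a b.
Proof. by have := linearZZ (wedger b) r a. Qed.

Lemma wedge_suml I (r : seq I) (P : pred I) (F : I -> ext R n) b :
  wedge (\sum_(i <- r | P i) F i) b = \sum_(i <- r | P i) wedge (F i) b.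
Proof. exact: (linear_sum (wedger b)). Qed.

(** The sign of moving the k-th generator past those generators of the monomial
[S] that precede it. *)
Definition inv_sign k S : R := (-1) ^+ #|[set s in S | (s < k)%N]%SET|.

Definition emul k a : ext R n := wedge (mono R [set k]%SET) a.
HB.instance Definition _ k :=
  GRing.isLinear.Build R (ext R n) (ext R n) _ (emul k) (wedge_linr _).

(** Interior product with the vector dual to the k-th generator. *)
Definition contr k a : ext R n :=
  [ffun S : {set 'I_(n + n)} =>
     if k \in S then 0 else inv_sign k S * a (k |: S)%SET].

Lemma contrE k a S :
  contr k a S = if k \in S then 0 else inv_sign k S * a (k |: S)%SET.
Proof. by rewrite ffunE. Qed.

Lemma contr_lin k : linear (contr k).
Proof.
move=> r b b'; apply/ffunP => U; rewrite extD extZ !ffunE.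
by case: ifP => _; rewrite ?mulr0 ?addr0// mulrDr mulrCA.
Qed.
HB.instance Definition _ k :=
  GRing.isLinear.Build R (ext R n) (ext R n) _ (contr k) (contr_lin k).

Lemma emul0 k : emul k 0 = 0. Proof. exact: linear0. Qed.
Lemma emulD k a b : emul k (a + b) = emul k a + emul k b.
Proof. exact: linearD. Qed.
Lemma emulN k a : emul k (- a) = - emul k a. Proof. exact: linearN. Qed.
Lemma emulB k a b : emul k (a - b) = emul k a - emul k b.
Proof. exact: linearB. Qed.
Lemma emulZ k (r : R) a : emul k (r *: a) = r *: emul k a.
Proof. exact: (linearZZ (emul k)). Qed.
Lemma emul_sum k I (r : seq I) (P : pred I) (F : I -> ext R n) :
  emul k (\sum_(i <- r | P i) F i) = \sum_(i <- r | P i) emul k (F i).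
Proof. exact: linear_sum. Qed.

Lemma contr0 k : contr k 0 = 0. Proof. exact: linear0. Qed.
Lemma contrD k a b : contr k (a + b) = contr k a + contr k b.
Proof. exact: linearD. Qed.
Lemma contrN k a : contr k (- a) = - contr k a. Proof. exact: linearN. Qed.
Lemma contrB k a b : contr k (a - b) = contr k a - contr k b.
Proof. exact: linearB. Qed.
Lemma contrZ k (r : R) a : contr k (r *: a) = r *: contr k a.
Proof. exact: (linearZZ (contr k)). Qed.
Lemma contr_sum k I (r : seq I) (P : pred I) (F : I -> ext R n) :
  contr k (\sum_(i <- r | P i) F i) = \sum_(i <- r | P i) contr k (F i).
Proof. exact: linear_sum. Qed.

Lemma wedge0r c : wedge c 0 = 0. Proof. exact: linear0. Qed.
Lemma wedgeBr c a b : wedge c (a - b) = wedge c a - wedge c b.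
Proof. exact: linearB. Qed.
Lemma wedgeZr c (r : R) a : wedge c (r *: a) = r *: wedge c a.
Proof. exact: (linearZZ (wedge c)). Qed.
Lemma wedge_sumr c I (r : seq I) (P : pred I) (F : I -> ext R n) :
  wedge c (\sum_(i <- r | P i) F i) = \sum_(i <- r | P i) wedge c (F i).
Proof. exact: linear_sum. Qed.

Lemma wedge_sign1 k T : wedge_sign R [set k]%SET T = inv_sign k T.
Proof.
rewrite /wedge_sign /inv_sign; congr (_ ^+ _).
rewrite -(card_imset [set s in T | (s < k)%N]%SET (f := pair k)); last first.
  by move=> x y [].
apply: eq_card => -[i j]; apply/idP/imsetP.
  by rewrite !inE/= => /andP[/andP[/eqP -> jT] jk]; exists j => //; rewrite inE jT.
by case=> x; rewrite !inE => /andP[xT xk] [-> ->]; rewrite eqxx xT.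
Qed.

Lemma emulE k a U :
  emul k a U = if k \in U then inv_sign k (U :\ k)%SET * a (U :\ k)%SET else 0.
Proof.
rewrite ffunE; case: ifP => kU; last first.
  rewrite big1// => S; rewrite powersetE => SU; rewrite ffunE.
  case: eqP => [Sk|]; last by rewrite mulr0 mul0r.
  by move: SU; rewrite Sk finset.sub1set kU.
rewrite (bigD1 [set k]%SET)/=; last by rewrite powersetE finset.sub1set.
rewrite ffunE eqxx mulr1 wedge_sign1 big1 ?addr0// => S /andP[_ /negbTE Sk].
by rewrite ffunE Sk mulr0 mul0r.
Qed.

Lemma inv_signK k S : inv_sign k S * inv_sign k S = 1.
Proof. by rewrite /inv_sign -expr2 sqrr_sign. Qed.

Lemma inv_signU1 k l S : k != l -> l \notin S ->
  inv_sign k (l |: S)%SET = (-1) ^+ (l < k)%N * inv_sign k S.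
Proof.
move=> kl lS; rewrite /inv_sign -exprD; congr (_ ^+ _).
case: (boolP (l < k)%N) => lk.
  rewrite (_ : [set _ in _ | _]%SET = l |: [set s in S | (s < k)%N])%SET.
    by rewrite cardsU1 inE (negbTE lS).
  by apply/setP => x; rewrite !inE; case: eqP => [->|].
apply: eq_card => x; rewrite !inE.
by case: eqP => [->|]//; rewrite (negbTE lk) !andbF.
Qed.

Lemma inv_signC k l : k != l ->
  (-1) ^+ (l < k)%N = - (-1) ^+ (k < l)%N :> R.
Proof. by move=> kl; have : nat_of_ord k != l by []; case: ltngtP;
  rewrite ?opprK. Qed.

Lemma emulC k l a : emul k (emul l a) = - emul l (emul k a).
Proof.
apply/ffunP => U; rewrite extN !emulE.
have [->|kl] := eqVneq k l; first by rewrite setD11 !mulr0 !if_same oppr0.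
rewrite !inE [l == k]eq_sym kl/=.
case: (boolP (k \in U)) => kU; case: (boolP (l \in U)) => lU//=;
  rewrite ?mulr0 ?oppr0//.
have -> : (U :\ k :\ l = U :\ l :\ k)%SET by apply/setP => x; rewrite !inE andbCA.
set V := (U :\ l :\ k)%SET.
have -> : (U :\ k = l |: V)%SET by apply/setP => x; rewrite /V !inE;
  case: (eqVneq x l) => [->|]; rewrite ?lU ?(eq_sym l) ?kl.
have -> : (U :\ l = k |: V)%SET by rewrite /V finset.setD1K// !inE kU kl.
rewrite !inv_signU1// ?(eq_sym l)// ?inE ?eqxx//= ?andbF//.
rewrite (inv_signC kl); ring.
Qed.

Lemma contrC k l a : contr k (contr l a) = - contr l (contr k a).
Proof.
apply/ffunP => U; rewrite extN !ffunE.
have [->|kl] := eqVneq k l; first by rewrite setU11 mulr0 if_same oppr0.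
rewrite !inE (negbTE kl) [l == k]eq_sym (negbTE kl)/=.
case: (boolP (k \in U)) => kU; case: (boolP (l \in U)) => lU//=;
  rewrite ?mulr0 ?oppr0//.
have lk : l != k by rewrite eq_sym.
rewrite (inv_signU1 kl lU) (inv_signU1 lk kU) (inv_signC kl) finset.setUCA; ring.
Qed.

(** The canonical anticommutation relation, on which all later commutators rest. *)
Lemma contr_emul k l a :
  contr k (emul l a) = (k == l)%:R *: a - emul l (contr k a).
Proof.
apply/ffunP => U; rewrite extD extN extZ contrE !emulE contrE.
have [->|kl] := eqVneq k l.
  rewrite mul1r; case: (boolP (l \in U)) => lU.
    by rewrite finset.setD1K// !inE eqxx/= mulrA inv_signK mul1r subrr.
  by rewrite setU11 subr0 mulrA finset.setU1K// inv_signK mul1r.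
rewrite mul0r add0r !inE [l == k]eq_sym (negbTE kl)/=.
case: (boolP (k \in U)) => kU; case: (boolP (l \in U)) => lU//=;
  rewrite ?mulr0 ?oppr0//.
set V := (U :\ l)%SET.
have -> : ((k |: U) :\ l = k |: V)%SET.
  by apply/setP => x; rewrite /V !inE; case: (eqVneq x k) => [->|]; rewrite ?kl.
have {1}-> : (U = l |: V)%SET by rewrite /V finset.setD1K.
have lk : l != k by rewrite eq_sym.
have lV : l \notin V by rewrite !inE eqxx.
have kV : k \notin V by rewrite !inE (negbTE kU) andbF.
rewrite (inv_signU1 kl lV) (inv_signU1 lk kV) (inv_signC kl).
set e := (-1) ^+ (k < l)%N; have ee : e * e = 1 by rewrite -expr2 sqrr_sign.
transitivity (- (e * e * (inv_sign l V * (inv_sign k V * a (k |: V)%SET)))).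
  ring.
by rewrite ee mul1r.
Qed.

Lemma contr_ext1 k : contr k (ext1 R n) = 0.
Proof.
apply/ffunP => S; rewrite !ffunE; case: ifP => // _.
case: eqP => [/setP/(_ k)|]; last by rewrite mulr0.
by rewrite !inE eqxx.
Qed.

Lemma emul_set0 k a : emul k a finset.set0 = 0.
Proof. by rewrite emulE inE. Qed.

Lemma emul_mono k S : k \notin S ->
  emul k (mono R S) = inv_sign k S *: mono R (k |: S)%SET.
Proof.
move=> kS; apply/ffunP => U; rewrite emulE extZ !ffunE.
case: (boolP (k \in U)) => kU; last first.
  by case: eqP kU => [->|]; rewrite ?setU11 ?mulr0.
case: (eqVneq U (k |: S)%SET) => [->|US]; first by rewrite finset.setU1K// eqxx.
case: eqP => [US'|]; last by rewrite !mulr0.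
by move: US; rewrite -US' finset.setD1K// eqxx.
Qed.

Lemma emul_mono_in k S : k \in S -> emul k (mono R S) = 0.
Proof.
move=> kS; apply/ffunP => T; rewrite emulE !ffunE; case: ifP => // kT.
case: eqP => [Tk|]; last by rewrite mulr0.
by move: kS; rewrite -Tk !inE eqxx.
Qed.

(** Monomials arise from 1 by successive multiplications, so linear statements
about the exterior algebra can be proved by following generators. *)
Lemma ext_ind (P : ext R n -> Prop) :
  P (ext1 R n) -> (forall r a b, P a -> P b -> P (r *: a + b)) ->
  (forall k a, P a -> P (emul k a)) -> forall a, P a.
Proof.
move=> P1 Plin Pemul.
have P0 : P 0 by rewrite -[0](subrr (ext1 R n)) addrC -scaleN1r; exact: Plin.
have Pmono S : P (mono R S).
  have [m] := ubnP #|S|; elim: m S => // m IH S Sm.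
  have [->//|/finset.set0Pn[k kS]] := eqVneq S finset.set0.
  have -> : mono R S = inv_sign k (S :\ k)%SET *: emul k (mono R (S :\ k)%SET) + 0.
    by rewrite addr0 emul_mono ?inE ?eqxx// scalerA inv_signK scale1r finset.setD1K.
  apply: Plin => //; apply: Pemul; apply: IH.
  by move: Sm; rewrite (cardsD1 k) kS.
move=> a; rewrite [a]ext_mono; elim/big_rec: _ => // S b _ Pb; exact: Plin.
Qed.

Lemma wedge_sign0 S : wedge_sign R finset.set0 S = 1.
Proof.
rewrite /wedge_sign (_ : [set _ in _ | _]%SET = finset.set0) ?cards0//.
by apply/setP => -[i j]; rewrite !inE.
Qed.

Lemma wedge1l a : wedge (ext1 R n) a = a.
Proof.
apply/ffunP => U; rewrite ffunE (bigD1 finset.set0)/=; last first.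
  by rewrite powersetE finset.sub0set.
rewrite ffunE eqxx mulr1 wedge_sign0 mul1r finset.setD0 big1 ?addr0// =>
  S /andP[_ /negbTE S0].
by rewrite ffunE S0 mulr0 mul0r.
Qed.

Lemma wedge_monoE S a U :
  wedge (mono R S) a U =
    if S \subset U then wedge_sign R S (U :\: S)%SET * a (U :\: S)%SET else 0.
Proof.
rewrite ffunE; case: ifP => SU; last first.
  rewrite big1// => T; rewrite powersetE => TU; rewrite ffunE.
  by case: eqP TU => [->|]; rewrite ?SU// mulr0 mul0r.
rewrite (bigD1 S)/=; last by rewrite powersetE.
rewrite ffunE eqxx mulr1 big1 ?addr0// => T /andP[_ /negbTE Sk].
by rewrite ffunE Sk mulr0 mul0r.
Qed.

Lemma wedge_signU1 k S T : k \notin S ->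
  wedge_sign R (k |: S)%SET T = inv_sign k T * wedge_sign R S T.
Proof.
move=> kS; rewrite -wedge_sign1 /wedge_sign -exprD; congr (_ ^+ _).
rewrite -cardsUI (_ : _ :&: _ = finset.set0)%SET ?cards0 ?addn0.
  by apply: eq_card => -[i j]; rewrite !inE/=; case: (i == k); case: (i \in S);
    rewrite /= ?orbF ?orbb.
apply/setP => -[i j]; rewrite !inE/=;
  apply/negP => /andP[/andP[/andP[/eqP -> _] _]].
by rewrite (negbTE kS).
Qed.

Lemma inv_signUI k S T : [disjoint S & T] ->
  inv_sign k (S :|: T)%SET = inv_sign k S * inv_sign k T.
Proof.
move=> ST; rewrite /inv_sign -exprD; congr (_ ^+ _); rewrite -cardsUI.
rewrite (_ : _ :&: _ = finset.set0)%SET ?cards0 ?addn0.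
  by apply: eq_card => x; rewrite !inE andb_orl.
apply/setP => x; rewrite !inE; apply/negP => /andP[/andP[xS _] /andP[xT _]].
by move/pred0P: ST => /(_ x); rewrite /= xS xT.
Qed.

(** Associativity when the left factor is a generator. Checked on monomials, it is
the additivity of inversion counts; full associativity follows by
induction on the left factor. *)
Lemma wedge_emul k a b : wedge (emul k a) b = emul k (wedge a b).
Proof.
pose P a := wedge (emul k a) b = emul k (wedge a b).
have Plin r a1 a2 : P a1 -> P a2 -> P (r *: a1 + a2).
  by rewrite /P => P1 P2;
    rewrite (linearP (emul k)) !wedgePl P1 P2 (linearP (emul k)).
suff Pm S : P (mono R S).
  rewrite -/(P a) [a]ext_mono; elim/big_rec: _ => [|S c _ Pc]; last exact: Plin.
  by rewrite /P (linear0 (emul k)) !wedge0l (linear0 (emul k)).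
rewrite /P; apply/ffunP => U; rewrite emulE.
have [kS|kS] := boolP (k \in S).
  rewrite emul_mono_in// wedge0l ffunE wedge_monoE; case: ifP => // kU.
  case: ifP => [/fintype.subsetP/(_ _ kS)|_]; first by rewrite !inE eqxx.
  by rewrite mulr0.
rewrite emul_mono// wedgeZl extZ !wedge_monoE.
rewrite finset.subUset finset.sub1set finset.subsetD1 kS andbT.
case: (boolP (k \in U)) => kU /=; last by rewrite mulr0.
case: ifP => SU; last by rewrite !mulr0.
have -> : (U :\: (k |: S) = U :\ k :\: S)%SET by apply/setP => x;
  rewrite !inE negb_or -!andbA andbCA.
set V := (U :\ k :\: S)%SET.
have -> : (U :\ k = S :|: V)%SET.
  apply/setP => x; rewrite !inE; case: (boolP (x \in S)) => xS //=; last first.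
  by rewrite (fintype.subsetP SU)//= andbT; apply: contraNneq kS => <-.
rewrite wedge_signU1// inv_signUI; last first.
  by rewrite disjoint_sym finset.disjoints_subset; apply/fintype.subsetP => x;
    rewrite !inE => /andP[].
ring.
Qed.

Lemma wedgeA : associative (@wedge R n).
Proof.
move=> a b c; pose P a := wedge a (wedge b c) = wedge (wedge a b) c.
apply: (ext_ind (P := P)) => [|r x y Px Py|k x Px]; rewrite /P.
- by rewrite !wedge1l.
- by rewrite !wedgePl Px Py.
- by rewrite !wedge_emul Px.
Qed.

Lemma wedge1r : right_id (ext1 R n) (@wedge R n).
Proof.
move=> a; pose P a := wedge a (ext1 R n) = a.
apply: (ext_ind (P := P)) => [|r x y Px Py|k x Px]; rewrite /P.
- by rewrite wedge1l.
- by rewrite wedgePl Px Py.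
- by rewrite wedge_emul Px.
Qed.

HB.instance Definition _ :=
  Monoid.isLaw.Build (ext R n) (ext1 R n) (@wedge R n) wedgeA wedge1l wedge1r.

End ExteriorOperators.

(** * Products of anticommuting elements *)

Section OddProducts.
Context (R : realType) (n : nat).
Implicit Types (S T : {set 'I_(n + n)}) (a b c : ext R n) (k l : 'I_(n + n)).
Variable v : 'I_(n + n) -> ext R n.
Hypothesis vC : forall k l, wedge (v k) (v l) = - wedge (v l) (v k).
Hypothesis v2 : forall k, wedge (v k) (v k) = 0.

Local Notation "\wedge_ ( i <- r | P ) F" :=
  (\big[@wedge R n/ext1 R n]_(i <- r | P%B) F)
  (at level 36, i, r at level 50, F at level 36).

(** Sorting a new factor into an ordered product costs one sign for each smaller
factor. This is what makes a product over a set of anticommuting elements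
behave like a monomial. *)
Lemma wedge_insert_seq (r : seq 'I_(n + n)) S k :
    sorted (relpre val ltn) r -> k \in r ->
  wedge (v k) (\wedge_(j <- r | j \in S) v j) =
  if k \in S then 0 else
  (-1) ^+ count (fun j =>
    (j \in S) && (j < k)%N) r *: \wedge_(j <- r | j \in k |: S) v j.
Proof.
have tr : transitive (relpre (@nat_of_ord (n + n)) ltn) by move=> x y z;
  exact: ltn_trans.
elim: r => // j r IH;
  rewrite [sorted _ _]/= (path_sortedE tr) => /andP[/allP jr srt].
rewrite inE; have [-> _|kj /= kr] := eqVneq k j.
  have jr' : j \notin r by apply/negP => /jr; rewrite /= ltnn.
  rewrite !big_cons setU11 /= ltnn andbF add0n.
  have -> : count (fun i => (i \in S) && (i < j)%N) r = 0%N.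
    apply/eqP; rewrite -leqn0 leqNgt -has_count; apply/hasPn => i /jr /= ji.
    by rewrite negb_and -leqNgt (ltnW ji) orbT.
  rewrite scale1r; case: ifP => jS; first by rewrite wedgeA v2 wedge0l.
  congr wedge; rewrite big_seq_cond [RHS]big_seq_cond; apply: eq_bigl => i.
  by rewrite !inE; case: eqP => // ->; rewrite (negbTE jr').
have jk : (j < k)%N by exact: jr.
rewrite !big_cons !inE [j == k]eq_sym (negbTE kj) /= jk andbT.
case: (boolP (j \in S)) => jS; last by rewrite add0n IH.
rewrite wedgeA vC -scaleN1r wedgeZl -wedgeA IH//.
case: ifP => _; first by rewrite wedge0r scaler0.
by rewrite wedgeZr scalerA exprD.
Qed.

Lemma wedge_insert S k :
  wedge (v k) (\big[@wedge R n/ext1 R n]_(j in S) v j) =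
  if k \in S then 0 else
  inv_sign R k S *: \big[@wedge R n/ext1 R n]_(j in k |: S) v j.
Proof.
have bigE (U : {set 'I_(n + n)}) : \big[@wedge R n/ext1 R n]_(j in U) v j =
    \wedge_(j <- enum 'I_(n + n) | j \in U) v j.
  by rewrite [index_enum _]unlock enumT.
rewrite !bigE wedge_insert_seq ?mem_enum//; last first.
  by have := iota_ltn_sorted 0 (n + n); rewrite -val_enum_ord sorted_map.
case: ifP => // _; congr (_ ^+ _ *: _).
rewrite cardE {2}/enum_mem size_filter -enumT; apply: eq_count => j.
by rewrite !inE.
Qed.

End OddProducts.

(** * The inner product induced by a symmetric matrix *)

Section InducedDot.
Context (R : realType) (n : nat).
Implicit Types (S T : {set 'I_(n + n)}) (a b c : ext R n) (k l : 'I_(n + n)).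
Implicit Types (u v : 'rV[R]_(n + n)).

Definition covec v : ext R n := \sum_k v 0 k *: mono R [set k]%SET.

Definition contrv u a : ext R n := \sum_k u 0 k *: contr k a.

Lemma contrv_lin u : linear (contrv u).
Proof.
move=> r a b; rewrite /contrv scaler_sumr -big_split/=; apply: eq_bigr => k _.
by rewrite contrD contrZ scalerDr !scalerA mulrC.
Qed.
HB.instance Definition _ u :=
  GRing.isLinear.Build R (ext R n) (ext R n) _ (contrv u) (contrv_lin u).

Lemma contrvD u a b : contrv u (a + b) = contrv u a + contrv u b.
Proof. exact: linearD. Qed.
Lemma contrvZ u (r : R) a : contrv u (r *: a) = r *: contrv u a.
Proof. exact: (linearZZ (contrv u)). Qed.
Lemma wedge_covec v a : wedge (covec v) a = \sum_k v 0 k *: emul k a.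
Proof. by rewrite wedge_suml; apply: eq_bigr => k _; rewrite wedgeZl. Qed.

Lemma covecC u v a : wedge (covec u) (wedge (covec v) a) =
  - wedge (covec v) (wedge (covec u) a).
Proof.
rewrite !wedge_covec -sumrN.
under eq_bigr do rewrite emul_sum scaler_sumr/=.
under [RHS]eq_bigr do rewrite emul_sum scaler_sumr -sumrN/=.
rewrite exchange_big/=; apply: eq_bigr => k _; apply: eq_bigr => l _.
by rewrite !emulZ emulC !scalerN !scalerA mulrC.
Qed.

Lemma covec2 u a : wedge (covec u) (wedge (covec u) a) = 0.
Proof.
have /eqP := covecC u u a; rewrite -addr_eq0 -mulr2n -scaler_nat scaler_eq0.
by rewrite pnatr_eq0/= => /eqP.
Qed.

(** A vector contracts against the wedge with a covector by the antiderivation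
rule, hence the anticommutator is the pairing of the two. *)
Lemma contrv_covec u v a :
  contrv u (wedge (covec v) a) = (u *m v^T) 0 0 *: a - wedge (covec v) (contrv u a).
Proof.
rewrite !wedge_covec /contrv mxE scaler_suml.
under eq_bigr do rewrite contr_sum scaler_sumr/=.
under [in X in _ - X]eq_bigr do rewrite emul_sum scaler_sumr/=.
rewrite [in X in _ - X]exchange_big/= -sumrB; apply: eq_bigr => k _.
under eq_bigr do rewrite contrZ contr_emul !scalerBr.
rewrite sumrB; congr (_ - _); last first.
  by apply: eq_bigr => l _; rewrite emulZ !scalerA mulrC.
rewrite (bigD1 k)//= big1 ?addr0 => [|l lk]; last first.
  by rewrite eq_sym (negbTE lk) scale0r !scaler0.
by rewrite eqxx scale1r mxE scalerA.
Qed.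

Lemma contrv_ext1 u : contrv u (ext1 R n) = 0.
Proof. by rewrite /contrv big1// => k _; rewrite contr_ext1 scaler0. Qed.

Variable H : 'M[R]_(n + n).

(** The algebra morphism extending the linear map with matrix [H] on covectors. *)
Definition raise a : ext R n :=
  \sum_S a S *: \big[@wedge R n/ext1 R n]_(k in S) covec (row k H).

Lemma raise_lin : linear raise.
Proof.
move=> r a b; rewrite /raise scaler_sumr -big_split/=; apply: eq_bigr => S _.
by rewrite extD extZ scalerDl scalerA.
Qed.
HB.instance Definition _ :=
  GRing.isLinear.Build R (ext R n) (ext R n) _ raise raise_lin.

Lemma raise0 : raise 0 = 0. Proof. exact: linear0. Qed.
Lemma raiseZ (r : R) a : raise (r *: a) = r *: raise a.
Proof. exact: (linearZZ (raise)). Qed.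
Lemma raise_sum I (r : seq I) (P : pred I) (F : I -> ext R n) :
  raise (\sum_(i <- r | P i) F i) = \sum_(i <- r | P i) raise (F i).
Proof. exact: linear_sum. Qed.

Lemma raise_mono S :
  raise (mono R S) = \big[@wedge R n/ext1 R n]_(k in S) covec (row k H).
Proof.
rewrite /raise (bigD1 S)//= ffunE eqxx scale1r [X in _ + X]big1 ?addr0// => T TS.
by rewrite ffunE (negbTE TS) scale0r.
Qed.

Lemma raise_emul k a : raise (emul k a) = wedge (covec (row k H)) (raise a).
Proof.
rewrite [a]ext_mono emul_sum !raise_sum wedge_sumr; apply: eq_bigr => S _.
rewrite emulZ !raiseZ wedgeZr; congr (_ *: _).
rewrite raise_mono wedge_insert => [|i j|i].
- case: ifPn => kS; first by rewrite emul_mono_in// raise0.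
  by rewrite emul_mono// raiseZ raise_mono.
- by have := covecC (row i H) (row j H) (ext1 R n); rewrite !wedge1r.
- by have := covec2 (row i H) (ext1 R n); rewrite !wedge1r.
Qed.

Lemma raise1 : raise (ext1 R n) = ext1 R n.
Proof. by rewrite raise_mono big_set0. Qed.

Definition flat a b : R := \sum_S a S * b S.

Lemma flat_linl b : scalar (flat ^~ b).
Proof.
move=> r x y; rewrite /flat mulr_sumr -big_split/=; apply: eq_bigr => S _.
by rewrite extD extZ mulrDl mulrA.
Qed.

Lemma flat_linr a : scalar (flat a).
Proof.
move=> r x y; rewrite /flat mulr_sumr -big_split/=; apply: eq_bigr => S _.
by rewrite extD extZ mulrDr mulrCA.
Qed.

Lemma flat_monol S b : flat (mono R S) b = b S.
Proof.
rewrite /flat (bigD1 S)//= ffunE eqxx mul1r big1 ?addr0// => T TS.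
by rewrite ffunE (negbTE TS) mul0r.
Qed.

(** The inner product induced by [H] is the standard one after [H] has been applied
to one argument; this avoids Gram determinants. *)
Definition dotH a b : R := flat (raise a) b.

Lemma dotH_linl b : scalar (dotH ^~ b).
Proof. by move=> r x y; rewrite /dotH linearP flat_linl. Qed.
Lemma dotH_linr a : scalar (dotH a).
Proof. by move=> r x y; rewrite /dotH flat_linr. Qed.

HB.instance Definition _ a :=
  GRing.isLinear.Build R (ext R n) R _ (dotH a) (dotH_linr a).
Definition dotHr b a := dotH a b.
HB.instance Definition _ b :=
  GRing.isLinear.Build R (ext R n) R _ (dotHr b) (dotH_linl b).
HB.instance Definition _ a :=
  GRing.isLinear.Build R (ext R n) R _ (flat a) (flat_linr a).
Definition flatr b a := flat a b.
HB.instance Definition _ b :=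
  GRing.isLinear.Build R (ext R n) R _ (flatr b) (flat_linl b).

Lemma flat0l b : flat 0 b = 0. Proof. exact: (linear0 (flatr b)). Qed.
Lemma flatZl (r : R) a b : flat (r *: a) b = r * flat a b.
Proof. exact: (linearZ_LR (flatr b)). Qed.
Lemma flat_suml I (r : seq I) (P : pred I) (F : I -> ext R n) b :
  flat (\sum_(i <- r | P i) F i) b = \sum_(i <- r | P i) flat (F i) b.
Proof. exact: (linear_sum (flatr b)). Qed.
Lemma flatZr (r : R) a b : flat a (r *: b) = r * flat a b.
Proof. exact: (linearZ_LR (flat a)). Qed.
Lemma flat_sumr I (r : seq I) (P : pred I) (F : I -> ext R n) a :
  flat a (\sum_(i <- r | P i) F i) = \sum_(i <- r | P i) flat a (F i).
Proof. exact: linear_sum. Qed.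

Lemma dotH0l b : dotH 0 b = 0. Proof. exact: (linear0 (dotHr b)). Qed.
Lemma dotHDl a a' b : dotH (a + a') b = dotH a b + dotH a' b.
Proof. exact: (linearD (dotHr b)). Qed.
Lemma dotHBl a a' b : dotH (a - a') b = dotH a b - dotH a' b.
Proof. exact: (linearB (dotHr b)). Qed.
Lemma dotHBr a b b' : dotH a (b - b') = dotH a b - dotH a b'.
Proof. exact: linearB. Qed.
Lemma dotHNr a b : dotH a (- b) = - dotH a b.
Proof. exact: linearN. Qed.
Lemma dotHZl (r : R) a b : dotH (r *: a) b = r * dotH a b.
Proof. exact: (linearZ_LR (dotHr b)). Qed.
Lemma dotH_suml I (r : seq I) (P : pred I) (F : I -> ext R n) b :
  dotH (\sum_(i <- r | P i) F i) b = \sum_(i <- r | P i) dotH (F i) b.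
Proof. exact: (linear_sum (dotHr b)). Qed.
Lemma dotH0r a : dotH a 0 = 0. Proof. exact: linear0. Qed.
Lemma dotHDr a b b' : dotH a (b + b') = dotH a b + dotH a b'.
Proof. exact: linearD. Qed.
Lemma dotHZr (r : R) a b : dotH a (r *: b) = r * dotH a b.
Proof. exact: (linearZ_LR (dotH a)). Qed.
Lemma dotH_sumr I (r : seq I) (P : pred I) (F : I -> ext R n) a :
  dotH a (\sum_(i <- r | P i) F i) = \sum_(i <- r | P i) dotH a (F i).
Proof. exact: linear_sum. Qed.

Lemma flat_emul k a b : flat (emul k a) b = flat a (contr k b).
Proof.
rewrite [a]ext_mono emul_sum !flat_suml; apply: eq_bigr => S _.
rewrite emulZ !flatZl flat_monol contrE; congr (_ * _).
case: ifPn => kS; first by rewrite emul_mono_in// flat0l.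
by rewrite emul_mono// flatZl flat_monol.
Qed.

Lemma flat_covec v a b : flat (wedge (covec v) a) b = flat a (contrv v b).
Proof.
rewrite wedge_covec /contrv flat_suml flat_sumr.
by apply: eq_bigr => k _; rewrite flatZl flatZr flat_emul.
Qed.

Lemma dotH1l b : dotH (ext1 R n) b = b finset.set0.
Proof. by rewrite /dotH raise1 flat_monol. Qed.

(** Multiplication by a generator is adjoint to the contraction against the
[H]-dual vector. With [dotH1l] this determines [dotH]. *)
Lemma dotH_emul k a b : dotH (emul k a) b = dotH a (contrv (row k H) b).
Proof. by rewrite /dotH raise_emul flat_covec. Qed.

End InducedDot.

(** * Orthonormal frames and positivity *)

(** Diagonalization of a positive definite matrix by completing the square in the
first coordinate, then recursively in the Schur complement. *)
Lemma posdef_congr1 (R : realType) n (M : 'M[R]_n) :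
  posdef M -> exists P : 'M[R]_n, P *m M *m P^T = 1%:M.
Proof.
elim: n M => [|n IH] M [MT Mpos]; first by exists 1%:M; apply/matrixP => -[].
pose M' : 'M[R]_(1 + n) := M.
pose a := M 0 0; pose b : 'rV[R]_n := ursubmx M'; pose D : 'M[R]_n := drsubmx M'.
have a_gt0 : 0 < a.
  have := Mpos (delta_mx 0 0); rewrite -rowE trmx_delta -colE !mxE; apply.
  by apply/eqP => /matrixP/(_ 0 0)/eqP; rewrite !mxE !eqxx oner_eq0.
have M'E : M' = block_mx a%:M b b^T D.
  rewrite -[M']submxK; congr block_mx.
    by rewrite [LHS]mx11_scalar !mxE; congr (M _ _)%:M; apply: val_inj.
  by rewrite /b trmx_ursub [M'^T]MT.
pose D' := D - a^-1 *: (b^T *m b).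
pose L : 'M[R]_(1 + n) := block_mx 1%:M 0 (- (a^-1 *: b^T)) 1%:M.
have LML : L *m M' *m L^T = block_mx a%:M 0 0 D'.
  rewrite M'E /L tr_block_mx !mulmx_block !trmx1 !trmx0.
  rewrite !mul1mx !mul0mx !mulmx0 !mulmx1 !addr0 linearN/= linearZ/= trmxK.
  rewrite mul_mx_scalar scalerN scalerA mulfV ?gt_eqF// scale1r.
  rewrite mulmxN -scalemxAr mul_scalar_mx scalerA mulVf ?gt_eqF// scale1r.
  rewrite !addNr mul0mx add0r mulNmx -scalemxAl; congr block_mx.
  by rewrite addrC.
have D'pos : posdef D'.
  split.
    rewrite /D' linearB linearZ/= trmx_mul trmxK; congr (_ - _).
    by rewrite /D trmx_drsub [M'^T]MT.
  move=> v v0; pose w : 'rV[R]_(1 + n) := row_mx 0 v *m L.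
  have -> : v *m D' *m v^T = w *m M' *m w^T.
    have -> : w *m M' *m w^T = row_mx 0 v *m (L *m M' *m L^T) *m (row_mx 0 v)^T.
      by rewrite /w trmx_mul !mulmxA.
    rewrite LML mul_row_block !mul0mx !mulmx0 !addr0 add0r tr_row_mx mul_row_col.
    by rewrite mul0mx add0r.
  apply: Mpos; apply: contra_neq v0 => w0.
  have : w *m invmx L = row_mx 0 v.
    by rewrite /w mulmxK// unitmxE det_lblock !det1 mulr1 unitr1.
  by rewrite w0 mul0mx -row_mx0 => /eq_row_mx[].
have [P' P'1] := IH _ D'pos.
(* Normalize the pivot, and diagonalize the Schur complement. *)
pose Q : 'M[R]_(1 + n) := block_mx (Num.sqrt a)^-1%:M 0 0 P'.
exists (Q *m L).
have -> : (Q *m L) *m M *m (Q *m L)^T = Q *m (L *m M' *m L^T) *m Q^T.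
  by rewrite trmx_mul !mulmxA.
rewrite LML /Q tr_block_mx !mulmx_block !trmx0 !mul0mx !mulmx0 !addr0 !mul0mx
  !add0r.
rewrite P'1 tr_scalar_mx -!scalar_mxM mulrAC -invfM -expr2 sqr_sqrtr ?(ltW
  a_gt0)// mulVf ?gt_eqF//.
by rewrite -scalar_mx_block.
Qed.

Section InducedDotTheory.
Context (R : realType) (n : nat).
Implicit Types (S T : {set 'I_(n + n)}) (a b c : ext R n) (k l : 'I_(n + n)).
Implicit Types (u v : 'rV[R]_(n + n)).
Variable H : 'M[R]_(n + n).
Hypothesis H_sym : H^T = H.

Lemma dotH_covec v a b :
  dotH H (wedge (covec v) a) b = dotH H a (contrv (v *m H) b).
Proof.
rewrite wedge_covec dotH_suml.
have -> : contrv (v *m H) b = \sum_k v 0 k *: contrv (row k H) b.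
  rewrite /contrv; under [RHS]eq_bigr do rewrite scaler_sumr.
  rewrite exchange_big/=; apply: eq_bigr => l _; rewrite mxE scaler_suml.
  by apply: eq_bigr => k _; rewrite mxE scalerA.
rewrite dotH_sumr; apply: eq_bigr => k _.
by rewrite dotHZl dotHZr dotH_emul.
Qed.

Lemma gen_covec k : mono R [set k]%SET = covec (delta_mx 0 k).
Proof.
rewrite /covec (bigD1 k)//= mxE !eqxx scale1r big1 ?addr0// => l lk.
by rewrite mxE (negbTE lk) andbF scale0r.
Qed.

Lemma emul_covec k a : emul k a = wedge (covec (delta_mx 0 k)) a.
Proof. by rewrite -gen_covec. Qed.

Lemma contrv_emul u k a :
  contrv u (emul k a) = u 0 k *: a - emul k (contrv u a).
Proof. by rewrite !emul_covec contrv_covec trmx_delta -colE mxE. Qed.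

Lemma gram_entryC k l : H k l = H l k.
Proof. by rewrite -[in LHS]H_sym mxE. Qed.

(** The adjunction of [dotH_emul] with the arguments exchanged, from which symmetry
follows by induction. *)
Lemma dotH_contrv k a b : dotH H (contrv (row k H) a) b = dotH H a (emul k b).
Proof.
elim/ext_ind: a k b => [|r a a' IHa IHa'|l a IH] k b.
- by rewrite contrv_ext1 dotH0l dotH1l emul_set0.
- by rewrite contrvD contrvZ !dotHDl !dotHZl IHa IHa'.
- rewrite contrv_emul dotHBl dotHZl !dotH_emul IH contrv_emul.
  by rewrite dotHBr dotHZr !mxE gram_entryC.
Qed.

Lemma dotHC a b : dotH H a b = dotH H b a.
Proof.
elim/ext_ind: a b => [|r a a' IHa IHa'|l a IH] b.
- rewrite dotH1l; elim/ext_ind: b => [|r a a' IHa IHa'|l a IH].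
  + by rewrite dotH1l.
  + by rewrite dotHDl dotHZl extD extZ IHa IHa'.
  + by rewrite emul_set0 dotH_emul contrv_ext1 dotH0r.
- by rewrite !dotHDl !dotHDr !dotHZl !dotHZr IHa IHa'.
- by rewrite dotH_emul IH dotH_contrv.
Qed.

Section Frame.
Variable V : 'M[R]_(n + n).
Hypothesis V_ortho : V *m H *m V^T = 1%:M.

Let frame_seq (r : seq 'I_(n + n)) S :=
  \big[@wedge R n/ext1 R n]_(k <- r | k \in S) covec (row k V).

Definition frame S := \big[@wedge R n/ext1 R n]_(k in S) covec (row k V).

Let V_dot k l : ((row k V *m H) *m (row l V)^T) 0 0 = (k == l)%:R.
Proof.
have /matrixP/(_ k l) := V_ortho; rewrite !mxE => <-.
rewrite -row_mul; apply: eq_bigr => j _; by rewrite !mxE.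
Qed.

Lemma contrv_frame_seq r S k : k \notin r ->
  contrv (row k V *m H) (frame_seq r S) = 0.
Proof.
rewrite /frame_seq; elim: r => [|l r IH]; first by rewrite big_nil contrv_ext1.
rewrite inE negb_or => /andP[kl kr]; rewrite big_cons; case: ifP => lS;
  last exact: IH.
by rewrite contrv_covec V_dot (negbTE kl) scale0r IH// wedge0r subr0.
Qed.

(** Peeling off the first frame covector: if it divides both products, the
anticommutation relation removes it; if it divides only one, its adjoint
contraction kills the other. *)
Lemma dotH_frame_seq r S T : uniq r ->
  dotH H (frame_seq r S) (frame_seq r T) =
  (all (fun k => (k \in S) == (k \in T)) r)%:R.
Proof.
elim: r => [_|k r IH /= /andP[kr ur]].
  by rewrite /frame_seq !big_nil dotH1l ffunE eqxx.
have fE U : frame_seq (k :: r) U =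
    if k \in U then wedge (covec (row k V)) (frame_seq r U) else frame_seq r U.
  by rewrite /frame_seq big_cons.
rewrite !fE; case: ifP => kS; case: ifP => kT /=.
- rewrite dotH_covec contrv_covec V_dot eqxx scale1r contrv_frame_seq//.
  by rewrite wedge0r subr0 IH.
- by rewrite dotH_covec contrv_frame_seq// dotH0r.
- by rewrite dotHC dotH_covec contrv_frame_seq// dotH0r.
- by rewrite IH.
Qed.

Lemma dotH_frame S T : dotH H (frame S) (frame T) = (S == T)%:R.
Proof.
rewrite /frame -/(frame_seq (index_enum _) S) -/(frame_seq (index_enum _) T).
rewrite dotH_frame_seq ?index_enum_uniq//; congr (nat_of_bool _)%:R.
apply/allP/eqP => [ST|-> //]; apply/setP => k.
by apply/eqP/ST; rewrite mem_index_enum.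
Qed.

(** The span of the frame products contains 1 and is stable under multiplication by
frame covectors, hence by all generators. *)
Lemma frame_span a : exists c : {set 'I_(n + n)} -> R, a = \sum_S c S *: frame S.
Proof.
pose P a := exists c : {set 'I_(n + n)} -> R, a = \sum_S c S *: frame S.
have Plin r x y : P x -> P y -> P (r *: x + y).
  move=> [c ->] [d ->]; exists (fun S => r * c S + d S).
  rewrite scaler_sumr -big_split/=; apply: eq_bigr => S _.
  by rewrite scalerDl scalerA.
have P0 : P 0 by exists (fun=> 0); rewrite big1// => S _; rewrite scale0r.
have Pframe S : P (frame S).
  exists (fun T => (T == S)%:R); rewrite (bigD1 S)//= eqxx scale1r.
  by rewrite [X in _ + X]big1 ?addr0// => T /negbTE ->; rewrite scale0r.
have Psum (I : finType) (c : I -> R) (F : I -> ext R n) :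
    (forall i, P (F i)) -> P (\sum_i c i *: F i).
  move=> PF; apply: (big_ind P) => // [x y Px Py|i _].
    by rewrite -[x]scale1r; exact: Plin.
  by rewrite -[_ *: _]addr0; exact: Plin.
elim/ext_ind: a => [|r a b|k a [c ->]].
- by have := Pframe finset.set0; rewrite /frame big_set0.
- exact: Plin.
- rewrite -/(P _) emul_sum.
  under eq_bigr do rewrite emulZ.
  apply: (Psum) => S; rewrite emul_covec.
  have Vu : V \in unitmx by have [] :=
    mulmx1_unit (esym (esym (etrans (mulmxA _ _ _) V_ortho))).
  have -> : delta_mx 0 k = \sum_j (invmx V k j) *: row j V :> 'rV[R]_(n + n).
    by rewrite -[delta_mx 0 k]mulmx1 -(mulVmx Vu) mulmxA -rowE mulmx_sum_row;
      apply: eq_bigr => j _; rewrite mxE.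
  have -> : wedge (covec (\sum_j (invmx V k j) *: row j V)) (frame S) =
     \sum_j invmx V k j *: wedge (covec (row j V)) (frame S).
    rewrite wedge_covec; under [RHS]eq_bigr do rewrite wedge_covec scaler_sumr.
    rewrite exchange_big/=; apply: eq_bigr => l _; rewrite summxE scaler_suml.
    by apply: eq_bigr => j _; rewrite mxE scalerA.
  apply: Psum => j; rewrite /frame wedge_insert => [|i l|i].
  + case: ifP => // _; have := Plin (inv_sign R j S) _ _ (Pframe (j |: S)%SET) P0.
    by rewrite addr0.
  + by have := covecC (row i V) (row l V) (ext1 R n); rewrite !wedge1r.
  + by have := covec2 (row i V) (ext1 R n); rewrite !wedge1r.
Qed.

Lemma dotH_gt0 a : a != 0 -> 0 < dotH H a a.
Proof.
have [c ->] := frame_span a; move=> a0.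
have -> : dotH H (\sum_S c S *: frame S) (\sum_S c S *: frame S) = \sum_S c S ^+ 2.
  rewrite dotH_suml; apply: eq_bigr => S _; rewrite dotHZl dotH_sumr (bigD1 S)//=.
  rewrite dotHZr dotH_frame eqxx mulr1 big1 ?addr0// => T TS.
  by rewrite dotHZr dotH_frame eq_sym (negbTE TS) mulr0.
rewrite lt_def sumr_ge0 ?andbT => [|S _]; last exact: sqr_ge0.
apply: contra_neq a0 => /eqP; rewrite psumr_eq0 => [/allP c0|S _];
  last exact: sqr_ge0.
rewrite big1// => S _; have := c0 S (mem_index_enum _).
by rewrite sqrf_eq0 => /eqP ->; rewrite scale0r.
Qed.

End Frame.
End InducedDotTheory.

(** * Identification of the inner product of forms *)

Section FormDot.
Context (R : realType) (n : nat).
Implicit Types (I J : {set 'I_n}) (S T : {set 'I_(n + n)}) (a b c w : ext R n).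

Lemma mem_ord_pair_l I J i : (lshift n i \in ord_pair I J) = (i \in I).
Proof.
rewrite !inE mem_imset; last exact: lshift_inj.
by case: imsetP => [[j _ /eqP]|]; rewrite ?orbF// eq_lrshift.
Qed.

Lemma mem_ord_pair_r I J j : (rshift n j \in ord_pair I J) = (j \in J).
Proof.
rewrite !inE [X in _ || X]mem_imset; last exact: rshift_inj.
by case: imsetP => [[i _ /eqP]|]//; rewrite eq_rlshift.
Qed.

Lemma ord_pair_inj I J K L :
  (ord_pair I J == ord_pair K L) = (I == K) && (J == L).
Proof.
apply/eqP/andP => [IJKL|[/eqP -> /eqP -> //]]; split; apply/eqP/setP => i.
  by rewrite -(mem_ord_pair_l I J) IJKL mem_ord_pair_l.
by rewrite -(mem_ord_pair_r I J) IJKL mem_ord_pair_r.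
Qed.

Lemma ord_pairK S :
  S = ord_pair (@lshift n n @^-1: S)%SET (@rshift n n @^-1: S)%SET.
Proof.
apply/setP => k; rewrite -[k]splitK; case: (fintype.split k) => i /=.
  by rewrite mem_ord_pair_l inE.
by rewrite mem_ord_pair_r inE.
Qed.

Lemma row_entry m p (A : 'M[R]_(m, p)) i j : row i A 0 j = A i j.
Proof. by rewrite mxE. Qed.

(** The metric on the 2n generators: dx and dxi carry the same metric and are
orthogonal to each other. *)
Definition diag2 (G : 'M[R]_n) : 'M[R]_(n + n) := block_mx G 0 0 G.

Lemma diag2_ll (G : 'M[R]_n) i j : diag2 G (lshift n i) (lshift n j) = G i j.
Proof. exact: block_mxEul. Qed.
Lemma diag2_lr (G : 'M[R]_n) i j : diag2 G (lshift n i) (rshift n j) = 0.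
Proof. by rewrite /diag2 block_mxEur mxE. Qed.
Lemma diag2_rl (G : 'M[R]_n) i j : diag2 G (rshift n i) (lshift n j) = 0.
Proof. by rewrite /diag2 block_mxEdl mxE. Qed.
Lemma diag2_rr (G : 'M[R]_n) i j : diag2 G (rshift n i) (rshift n j) = G i j.
Proof. exact: block_mxEdr. Qed.

Lemma covec_row_diag2l (G : 'M[R]_n) i :
  covec (row (lshift n i) (diag2 G)) = one_zero_form (row i G).
Proof.
rewrite /covec /one_zero_form big_split_ord/= [X in _ + X]big1 ?addr0 => [|j _].
  by apply: eq_bigr => j _; rewrite !row_entry diag2_ll.
by rewrite row_entry diag2_lr scale0r.
Qed.

Lemma covec_row_diag2r (G : 'M[R]_n) i :
  covec (row (rshift n i) (diag2 G)) = \sum_j G i j *: dxi R j.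
Proof.
rewrite /covec big_split_ord/= big1 ?add0r => [|j _].
  by apply: eq_bigr => j _; rewrite row_entry diag2_rr.
by rewrite row_entry diag2_rl scale0r.
Qed.

Lemma Jmap_one_zero_form (v : 'rV[R]_n) :
  Jmap (one_zero_form v) = \sum_j v 0 j *: dxi R j.
Proof.
have coef I J : one_zero_form v (ord_pair I J) =
    if J == finset.set0 then \sum_j v 0 j * (I == [set j]%SET)%:R else 0.
  rewrite /one_zero_form ext_sum.
  have dxE (j : 'I_n) : dx R j (ord_pair I J) =
    ((I == [set j]%SET) && (J == finset.set0))%:R.
    rewrite ffunE -ord_pair_inj; congr (nat_of_bool (_ == _))%:R.
    apply/setP => k; rewrite -[k]splitK; case: (fintype.split k) => i /=.
      by rewrite mem_ord_pair_l !inE eq_lshift.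
    by rewrite mem_ord_pair_r !inE eq_rlshift.
  case: ifPn => J0; [apply: eq_bigr|apply: big1] => j _; rewrite extZ dxE.
    by rewrite J0 andbT.
  by rewrite (negbTE J0) andbF mulr0.
rewrite /Jmap.
transitivity (\sum_(I : {set 'I_n}) \sum_j (v 0 j * (I == [set j]%SET)%:R) *:
    \big[@wedge R n/ext1 R n]_(i in I) dxi R i).
  apply: eq_bigr => I _; rewrite (bigD1 finset.set0)//= [X in _ + X]big1 => [|J J0].
    by rewrite addr0 coef eqxx big_set0 wedge1r scaler_suml.
  by rewrite coef (negbTE J0) scale0r.
rewrite exchange_big/=; apply: eq_bigr => j _.
rewrite (bigD1 [set j]%SET)//= eqxx mulr1 big_set1 [X in _ +
  X]big1 ?addr0// => I Ij.
by rewrite (negbTE Ij) mulr0 scale0r.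
Qed.

Lemma frame_monoE (e : 'I_n -> 'rV[R]_n) I J :
  frame_mono e I J = frame (diag2 (\matrix_i e i)) (ord_pair I J).
Proof.
rewrite /frame_mono /frame big_split_ord; congr wedge; apply: eq_big => i.
- by rewrite mem_ord_pair_l.
- by move=> _; rewrite covec_row_diag2l rowK.
- by rewrite mem_ord_pair_r.
- move=> _; rewrite covec_row_diag2r Jmap_one_zero_form.
  by apply: eq_bigr => j _; rewrite mxE.
Qed.

Lemma diag2_ortho (G E : 'M[R]_n) : E *m G *m E^T = 1%:M ->
  diag2 E *m diag2 G *m (diag2 E)^T = 1%:M.
Proof.
move=> EGE; rewrite /diag2 tr_block_mx !mulmx_block.
rewrite !(trmx0, mul0mx, mulmx0, addr0, add0r) EGE.
by rewrite -scalar_mx_block.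
Qed.

Lemma diag2_sym (G : 'M[R]_n) : G^T = G -> (diag2 G)^T = diag2 G.
Proof. by move=> GG; rewrite /diag2 tr_block_mx GG !trmx0. Qed.

Lemma scalar_sum (I : finType) (f : ext R n -> R) (c : I -> R) (F : I -> ext R n) :
  scalar f -> f (\sum_i c i *: F i) = \sum_i c i * f (F i).
Proof.
move=> fP; elim/big_rec2: _ => [|i y1 y2 _ <-]; last exact: fP.
by have := fP (-1) 0 0; rewrite scaler0 addr0 mulN1r addNr.
Qed.

Section PosDef.
Variable w : ext R n.
Hypothesis w_pos : posdef (omega_mx w).
Local Notation G := (invmx (omega_mx w)).

Lemma posdef_unit : omega_mx w \in unitmx.
Proof. by have [P /mulmx1_unit[]] := posdef_congr1 w_pos;
  rewrite unitmx_mul => /andP[]. Qed.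

Lemma posdef_inv_sym : G^T = G.
Proof. by rewrite trmx_inv (proj1 w_pos). Qed.

Lemma posdef_inv_ortho : exists E : 'M[R]_n, E *m G *m E^T = 1%:M.
Proof.
have [P PP] := posdef_congr1 w_pos.
exists (P *m omega_mx w); rewrite mulmxK ?posdef_unit//.
by rewrite trmx_mul (proj1 w_pos) mulmxA.
Qed.

Lemma is_form_dot_dotH : is_form_dot w (dotH (diag2 G)).
Proof.
split; [exact: dotH_linr|exact: dotH_linl|] => e e_ortho I J K L.
rewrite !frame_monoE dotH_frame ?ord_pair_inj//.
  exact/diag2_sym/posdef_inv_sym.
apply: diag2_ortho; apply/matrixP => i j; rewrite [RHS]mxE -e_ortho /covector_dot.
by rewrite -[in RHS](rowK e i) -[in RHS](rowK e j) -row_mul !mxE;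
  apply: eq_bigr => k _; rewrite !mxE.
Qed.

(** Existence and uniqueness of the inner product of forms: any two bilinear forms
that agree on the products of one orthonormal frame are equal. *)
Lemma form_dotE : form_dot w = dotH (diag2 G).
Proof.
apply: xget_subset1; first exact: is_form_dot_dotH.
have [E EGE] := posdef_inv_ortho.
suff uniq ip : is_form_dot w ip -> ip = dotH (diag2 G).
  by move=> f g /uniq -> /uniq ->.
move=> [ipr ipl ipE]; apply/funext => a; apply/funext => b.
have [c ->] := frame_span (diag2_ortho EGE) a.
have [d ->] := frame_span (diag2_ortho EGE) b.
rewrite (scalar_sum _ _ (ipl _)) (scalar_sum _ _ (dotH_linl _ _)).
apply: eq_bigr => S _; congr (_ * _).
rewrite (scalar_sum _ _ (ipr _)) (scalar_sum _ _ (dotH_linr _ _)).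
apply: eq_bigr => T _; congr (_ * _).
have [_ _ dE] := is_form_dot_dotH.
have EE : E = \matrix_i (row i E) by apply/row_matrixP => i; rewrite rowK.
have ortho : orthonormal_basis w (fun i => row i E).
  move=> i j; have /matrixP/(_ i j) := EGE; rewrite [RHS]mxE => <-.
  by rewrite /covector_dot -row_mul !mxE; apply: eq_bigr => k _; rewrite !mxE.
have frE U : frame (diag2 E) U =
    frame_mono (fun i => row i E) (@lshift n n @^-1: U)%SET (@rshift n n @^-1:
      U)%SET.
  by rewrite frame_monoE -ord_pairK -EE.
by rewrite !frE ipE// dE.
Qed.

End PosDef.
End FormDot.

(** * The Lefschetz operator, its adjoint, and the powers of omega *)

Section Lefschetz.
Context (R : realType) (n : nat).
Implicit Types (I J : {set 'I_n}) (S T : {set 'I_(n + n)}) (a b c w : ext R n).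
Implicit Types (M G B : 'M[R]_n) (s t : 'I_n -> 'I_(n + n)).
Local Notation l := (@lshift n n).
Local Notation r := (@rshift n n).

(** Contraction against the i-th metric dual vector; [s] selects whether dx or dxi
is contracted. *)
Definition iota_up G s i a : ext R n := \sum_m G i m *: contr (s m) a.

Lemma contrv_diag2_l G i a : contrv (row (l i) (diag2 G)) a = iota_up G l i a.
Proof.
rewrite /contrv big_split_ord/= [X in _ + X]big1 ?addr0 => [|j _].
  by apply: eq_bigr => j _; rewrite row_entry diag2_ll.
by rewrite row_entry diag2_lr scale0r.
Qed.

Lemma contrv_diag2_r G i a : contrv (row (r i) (diag2 G)) a = iota_up G r i a.
Proof.
rewrite /contrv big_split_ord/= big1 ?add0r => [|j _].
  by apply: eq_bigr => j _; rewrite row_entry diag2_rr.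
by rewrite row_entry diag2_rl scale0r.
Qed.

(** Multiplication by the (1,1)-vector with matrix [M]. *)
Definition lef M a : ext R n := \sum_i \sum_j M i j *: emul (l i) (emul (r j) a).
(** The adjoint of the Lefschetz operator in coordinates, [G] being the inverse
metric. *)
Definition dlef G a : ext R n := \sum_i \sum_j G i j *: contr (r j) (contr (l i) a).

Lemma iota_up_lin G s i : linear (iota_up G s i).
Proof.
move=> c a b; rewrite /iota_up scaler_sumr -big_split/=; apply: eq_bigr => m _.
by rewrite contrD contrZ scalerDr !scalerA mulrC.
Qed.
Lemma lef_lin M : linear (lef M).
Proof.
move=> c a b; rewrite /lef scaler_sumr -big_split/=; apply: eq_bigr => i _.
rewrite scaler_sumr -big_split/=; apply: eq_bigr => j _.
by rewrite !emulD !emulZ scalerDr !scalerA mulrC.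
Qed.
Lemma dlef_lin M : linear (dlef M).
Proof.
move=> c a b; rewrite /dlef scaler_sumr -big_split/=; apply: eq_bigr => i _.
rewrite scaler_sumr -big_split/=; apply: eq_bigr => j _.
by rewrite !contrD !contrZ scalerDr !scalerA mulrC.
Qed.
HB.instance Definition _ G s i :=
  GRing.isLinear.Build R (ext R n) (ext R n) _ (iota_up G s i) (iota_up_lin G s i).
HB.instance Definition _ M :=
  GRing.isLinear.Build R (ext R n) (ext R n) _ (lef M) (lef_lin M).
HB.instance Definition _ M :=
  GRing.isLinear.Build R (ext R n) (ext R n) _ (dlef M) (dlef_lin M).

Lemma iota_up0 G s i : iota_up G s i 0 = 0. Proof. exact: linear0. Qed.
Lemma iota_upB G s i a b : iota_up G s i (a - b) =
  iota_up G s i a - iota_up G s i b.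
Proof. exact: linearB. Qed.
Lemma iota_upZ G s i (c : R) a : iota_up G s i (c *: a) = c *: iota_up G s i a.
Proof. exact: (linearZZ (iota_up G s i)). Qed.
Lemma lef0 M : lef M 0 = 0. Proof. exact: linear0. Qed.
Lemma lefN M a : lef M (- a) = - lef M a. Proof. exact: linearN. Qed.
Lemma lefZ M (c : R) a : lef M (c *: a) = c *: lef M a.
Proof. exact: (linearZZ (lef M)). Qed.
Lemma lef_sum M (K : Type) (q : seq K) (P : pred K) (F : K -> ext R n) :
  lef M (\sum_(x <- q | P x) F x) = \sum_(x <- q | P x) lef M (F x).
Proof. exact: linear_sum. Qed.
Lemma dlef0 G : dlef G 0 = 0. Proof. exact: linear0. Qed.
Lemma dlefD G a b : dlef G (a + b) = dlef G a + dlef G b.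
Proof. exact: linearD. Qed.
Lemma dlefN G a : dlef G (- a) = - dlef G a. Proof. exact: linearN. Qed.
Lemma dlefB G a b : dlef G (a - b) = dlef G a - dlef G b.
Proof. exact: linearB. Qed.
Lemma dlefZ G (c : R) a : dlef G (c *: a) = c *: dlef G a.
Proof. exact: (linearZZ (dlef G)). Qed.
Lemma dlef_sum G (K : Type) (q : seq K) (P : pred K) (F : K -> ext R n) :
  dlef G (\sum_(x <- q | P x) F x) = \sum_(x <- q | P x) dlef G (F x).
Proof. exact: linear_sum. Qed.

Lemma mono_pair i j : mono R (ord_pair [set i]%SET [set j]%SET) =
  wedge (mono R [set l i]%SET) (mono R [set r j]%SET) :> ext R n.
Proof.
rewrite -/(emul (l i) _) emul_mono ?inE ?eq_lrshift//.
have -> : inv_sign R (l i) [set r j]%SET = 1.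
  rewrite /inv_sign (_ : [set _ in _ | _]%SET = finset.set0) ?cards0//.
  apply/setP => k; rewrite !inE; apply/negP => /andP[/eqP ->] /=.
  by rewrite ltnNge (leq_trans (ltnW (ltn_ord i)))// leq_addr.
rewrite scale1r; congr mono; apply/setP => k.
rewrite -[k]splitK; case: (fintype.split k) => i' /=.
  by rewrite mem_ord_pair_l !inE eq_lshift eq_lrshift orbF.
by rewrite mem_ord_pair_r !inE eq_rshift eq_rlshift.
Qed.

Lemma wedge_bidegree11 w a :
    (forall I J, w (ord_pair I J) != 0 -> #|I| = 1%N /\ #|J| = 1%N) ->
  wedge w a = lef (omega_mx w) a.
Proof.
move=> w11.
have wE : w = \sum_i \sum_j omega_mx w i j *: mono R (ord_pair [set i]%SET [set
  j]%SET).
  apply/ffunP => S; rewrite [S]ord_pairK;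
    move: (_ @^-1: S)%SET (_ @^-1: S)%SET => J I.
  rewrite ext_sum; under eq_bigr do rewrite ext_sum.
  under eq_bigr do under eq_bigr do rewrite extZ ffunE ord_pair_inj.
  have [/eqP wIJ|/w11[/eqP/cards1P[i ->] /eqP/cards1P[j ->]]] :=
    boolP (w (ord_pair I J) == 0).
    rewrite wIJ big1// => i _; rewrite big1// => j _; rewrite mxE.
    case: eqP => [IE|]; case: eqP => [JE|]; rewrite ?mulr0// mulr1.
    by rewrite -IE -JE wIJ.
  rewrite (bigD1 i)//= (bigD1 j)//= !eqxx mulr1 mxE !big1 ?addr0//= =>
    [i' ii|j' jj].
    rewrite big1// => j' _; case: eqP => [/set1_inj i'i|]; last by rewrite mulr0.
    by rewrite i'i eqxx in ii.
  case: (eqVneq [set j]%SET) => [/set1_inj j'j|]; last by rewrite ?andbF mulr0.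
  by rewrite j'j eqxx in jj.
rewrite {1}wE wedge_suml; apply: eq_bigr => i _; rewrite wedge_suml.
by apply: eq_bigr => j _; rewrite wedgeZl mono_pair -wedgeA.
Qed.

Lemma dotH_emul_l G i a b :
  dotH (diag2 G) (emul (l i) a) b = dotH (diag2 G) a (iota_up G l i b).
Proof. by rewrite dotH_emul contrv_diag2_l. Qed.

Lemma dotH_emul_r G i a b :
  dotH (diag2 G) (emul (r i) a) b = dotH (diag2 G) a (iota_up G r i b).
Proof. by rewrite dotH_emul contrv_diag2_r. Qed.

Lemma mulmx3E (A B C : 'M[R]_n) i j :
  (A *m B *m C) i j = \sum_p \sum_q A i p * B p q * C q j.
Proof.
rewrite mxE; under eq_bigr do rewrite mxE mulr_suml.
by rewrite exchange_big.
Qed.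

(** Taking adjoints turns both generators into metric contractions, and
G M G = G. *)
Lemma dotH_lef M G a b : M \in unitmx -> G = invmx M -> G^T = G ->
  dotH (diag2 G) (lef M a) b = dotH (diag2 G) a (dlef G b).
Proof.
move=> Mu GM GT.
have Gsym i j : G i j = G j i by rewrite -[in LHS]GT mxE.
have GE p q : G p q = \sum_i \sum_j G p i * M i j * G j q.
  by rewrite -mulmx3E GM mulVmx// mul1mx.
have -> : dlef G b = \sum_i \sum_j M i j *: iota_up G r j (iota_up G l i b).
  rewrite /dlef.
  transitivity (\sum_p \sum_q \sum_i \sum_j (G p i * M i j * G j q) *:
      contr (r q) (contr (l p) b)).
    apply: eq_bigr => p _; apply: eq_bigr => q _; rewrite GE scaler_suml.
    by apply: eq_bigr => i _; rewrite scaler_suml.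
  under eq_bigr do rewrite exchange_big.
  rewrite exchange_big; apply: eq_bigr => i _ /=.
  under eq_bigr do rewrite exchange_big/=.
  rewrite exchange_big; apply: eq_bigr => j _ /=.
  rewrite /iota_up scaler_sumr exchange_big/=; apply: eq_bigr => q _.
  rewrite contr_sum !scaler_sumr; apply: eq_bigr => p _.
  by rewrite contrZ !scalerA (Gsym p i); congr (_ *: _); ring.
rewrite /lef dotH_suml dotH_sumr; apply: eq_bigr => i _.
rewrite dotH_suml dotH_sumr; apply: eq_bigr => j _.
by rewrite dotHZl dotHZr dotH_emul_l dotH_emul_r.
Qed.

Lemma contr_l_lef M k a :
  contr (l k) (lef M a) = lef M (contr (l k) a) + \sum_j M k j *: emul (r j) a.
Proof.
rewrite /lef contr_sum.
have -> : \sum_j M k j *: emul (r j) a =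
    \sum_i \sum_j (M i j * (l k == l i)%:R) *: emul (r j) a.
  rewrite [RHS](bigD1 k)//= [X in _ + X]big1 ?addr0 => [|i ik].
    by apply: eq_bigr => j _; rewrite eqxx mulr1.
  by rewrite big1// => j _; rewrite eq_lshift eq_sym (negbTE ik) mulr0 scale0r.
rewrite -big_split; apply: eq_bigr => i _ /=.
rewrite contr_sum -big_split; apply: eq_bigr => j _ /=.
rewrite contrZ contr_emul contr_emul eq_lrshift scale0r sub0r emulN opprK.
by rewrite scalerDr scalerA addrC.
Qed.

Lemma contr_r_lef M k a :
  contr (r k) (lef M a) = lef M (contr (r k) a) - \sum_i M i k *: emul (l i) a.
Proof.
rewrite /lef contr_sum -sumrB; apply: eq_bigr => i _.
have -> : M i k *: emul (l i) a = \sum_j (M i j * (r k == r j)%:R) *: emul (l i) a.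
  rewrite [RHS](bigD1 k)//= [X in _ + X]big1 ?addr0 => [|j jk].
    by rewrite eqxx mulr1.
  by rewrite eq_rshift eq_sym (negbTE jk) mulr0 scale0r.
rewrite contr_sum -sumrB; apply: eq_bigr => j _ /=.
rewrite contrZ contr_emul contr_emul eq_rlshift scale0r sub0r emulB emulZ.
by rewrite opprB scalerBr scalerA.
Qed.

Lemma emul_lef k M a : emul k (lef M a) = lef M (emul k a).
Proof.
rewrite /lef emul_sum; apply: eq_bigr => i _; rewrite emul_sum;
  apply: eq_bigr => j _.
by rewrite emulZ emulC (emulC k (r j)) emulN opprK.
Qed.

Lemma lefC M B a : lef M (lef B a) = lef B (lef M a).
Proof.
rewrite [in LHS](_ : lef B a = \sum_i \sum_j B i j *: emul (l i) (emul (r j) a))//.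
rewrite lef_sum; apply: eq_bigr => i _; rewrite lef_sum; apply: eq_bigr => j _.
by rewrite lefZ -!emul_lef.
Qed.

Definition lefn M m : ext R n := iter m (lef M) (ext1 R n).

Lemma lefnS M m : lefn M m.+1 = lef M (lefn M m). Proof. by []. Qed.

(** Contraction is a derivation on the even elements, so it acts on a power as on
u^m. *)
Lemma contr_l_lefn M k m :
  contr (l k) (lefn M m.+1) = m.+1%:R *: \sum_j M k j *: emul (r j) (lefn M m).
Proof.
elim: m => [|m IH]; rewrite lefnS contr_l_lef.
  by rewrite contr_ext1 lef0 add0r scale1r.
rewrite IH lefZ lef_sum.
under eq_bigr do rewrite lefZ -emul_lef -lefnS.
by rewrite -[X in _ + X]scale1r -scalerDl natr1.
Qed.

Lemma contr_r_lefn M k m :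
  contr (r k) (lefn M m.+1) = - (m.+1%:R *: \sum_i M i k *: emul (l i) (lefn M m)).
Proof.
elim: m => [|m IH]; rewrite lefnS contr_r_lef.
  by rewrite contr_ext1 lef0 add0r scale1r.
rewrite IH lefN lefZ lef_sum.
under eq_bigr do rewrite lefZ -emul_lef -lefnS.
by rewrite -[X in _ - X]scale1r -opprD -scalerDl natr1.
Qed.

(** The operator sum of emul contr counts the dx factors; the m-th power has m of
them. *)
Lemma count_l_lefn M m :
  \sum_i emul (l i) (contr (l i) (lefn M m)) = m%:R *: lefn M m.
Proof.
case: m => [|m].
  by rewrite scale0r big1// => i _; rewrite contr_ext1 emul0.
rewrite lefnS {2}/lef scaler_sumr; apply: eq_bigr => i _.
rewrite contr_l_lefn emulZ emul_sum; congr (_ *: _).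
by apply: eq_bigr => j _; rewrite emulZ.
Qed.

Lemma count_r_lefn M m :
  \sum_j emul (r j) (contr (r j) (lefn M m)) = m%:R *: lefn M m.
Proof.
case: m => [|m].
  by rewrite scale0r big1// => i _; rewrite contr_ext1 emul0.
rewrite lefnS {2}/lef exchange_big scaler_sumr; apply: eq_bigr => j _ /=.
rewrite contr_r_lefn emulN emulZ emul_sum -scalerN -sumrN; congr (_ *: _).
by apply: eq_bigr => i _; rewrite emulZ emulC scalerN opprK.
Qed.

Lemma emul_contr k a S : emul k (contr k a) S = (k \in S)%:R * a S.
Proof.
rewrite emulE; case: ifPn => kS; last by rewrite mul0r.
by rewrite contrE setD11 mulrA inv_signK !mul1r finset.setD1K.
Qed.

(** The n-th power has n factors dx and n factors dxi, hence all of them. *)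
Lemma lefn_top M S : S != [set: 'I_(n + n)]%SET -> lefn M n S = 0.
Proof.
apply: contra_neq_eq => XS0; apply/setP => k; rewrite inE.
have full (s : 'I_n -> 'I_(n + n)) :
    \sum_i emul (s i) (contr (s i) (lefn M n)) = n%:R *: lefn M n ->
      forall i, s i \in S.
  move=> /ffunP/(_ S); rewrite ext_sum extZ.
  under eq_bigr do rewrite emul_contr.
  rewrite -mulr_suml => /(mulIf XS0)/eqP; rewrite -natr_sum eqr_nat => /eqP sn i.
  apply: contraT => siS; suff : (\sum_(i < n) (s i \in S) < n)%N by rewrite sn ltnn.
  rewrite (bigD1 i)//= (negbTE siS) add0n.
  rewrite -[X in (_ < X)%N]card_ord -sum1_card [X in (_ < X)%N](bigD1 i)//= add1n
    ltnS.
  by apply: leq_sum => j _; case: (_ \in _).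
rewrite -[k]splitK; case: (fintype.split k) => i /=.
  exact/(full l)/count_l_lefn.
exact/(full r)/count_r_lefn.
Qed.

Lemma emul_lefn_top M k : emul k (lefn M n) = 0.
Proof.
apply/ffunP => S; rewrite emulE ffunE; case: ifP => // kS.
rewrite lefn_top ?mulr0//; apply/eqP => /setP/(_ k).
by rewrite !inE eqxx.
Qed.

Lemma sum_invmx M i j : M \in unitmx ->
  \sum_k invmx M i k * M k j = (i == j)%:R.
Proof. by move=> /mulVmx/matrixP/(_ i j); rewrite !mxE. Qed.

(** If the (m+1)-st power vanished, contracting it and inverting [M] would show that
every dxi_j annihilates the m-th power. Contracting once more counts the
missing factors dxi and gives (n - m) times the m-th power, which is nonzero. *)
Lemma lefn_neq0 M m : M \in unitmx -> (m <= n)%N -> lefn M m != 0.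
Proof.
move=> Mu; elim: m => [_|m IH mn].
  by apply/eqP => /ffunP/(_ finset.set0)/eqP; rewrite !ffunE eqxx oner_eq0.
apply: contra_neq (IH (ltnW mn)) => Xm.
have emul0 j : emul (r j) (lefn M m) = 0.
  have sum0 k : \sum_j M k j *: emul (r j) (lefn M m) = 0.
    have /eqP := contr_l_lefn M k m; rewrite Xm contr0 eq_sym scaler_eq0 pnatr_eq0.
    by move=> /eqP.
  transitivity (\sum_k invmx M j k *: \sum_j M k j *: emul (r j) (lefn M m)).
    under eq_bigr do rewrite scaler_sumr.
    rewrite exchange_big/= (bigD1 j)//= [X in _ + X]big1 ?addr0 => [|i ij].
      under eq_bigr do rewrite scalerA.
      by rewrite -scaler_suml sum_invmx// eqxx scale1r.
    under eq_bigr do rewrite scalerA.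
    by rewrite -scaler_suml sum_invmx// eq_sym (negbTE ij) scale0r.
  by rewrite big1// => k _; rewrite sum0 scaler0.
have : \sum_j contr (r j) (emul (r j) (lefn M m)) = (n - m)%:R *: lefn M m.
  under eq_bigr do rewrite contr_emul eqxx scale1r.
  rewrite sumrB count_r_lefn sumr_const card_ord -scaler_nat -scalerBl natrB//.
  exact: ltnW.
rewrite big1 => [|j _]; last by rewrite emul0 contr0.
move/esym/eqP; rewrite scaler_eq0 pnatr_eq0 subn_eq0 leqNgt mn/=.
by move/eqP.
Qed.

Lemma lefn_volume_neq0 M : M \in unitmx -> lefn M n [set: 'I_(n + n)]%SET != 0.
Proof.
move=> Mu; apply: contra_neq (lefn_neq0 Mu (leqnn n)) => X0.
apply/ffunP => S; rewrite ffunE; have [->//|] := eqVneq S [set: 'I_(n + n)]%SET.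
exact: lefn_top.
Qed.

(** The logarithmic derivative of the determinant, without determinants: if
omega has matrix [M], contract the identity dx_i /\ omega^n = 0, which holds for
reasons of degree. *)
Lemma lef_lefn_top M B m : M \in unitmx -> n = m.+1 ->
  n%:R *: lef B (lefn M m) = \tr (invmx M *m B) *: lefn M n.
Proof.
move=> Mu nm; pose X : ext R n := lefn M m.
have XE i k : n%:R *: \sum_j M k j *: emul (l i) (emul (r j) X) =
  (k == i)%:R *: lefn M n.
  have : contr (l k) (emul (l i) (lefn M n)) = 0 by rewrite emul_lefn_top contr0.
  rewrite contr_emul eq_lshift => /eqP; rewrite subr_eq0 => /eqP ->.
  have -> : contr (l k) (lefn M n) = n%:R *: \sum_j M k j *: emul (r j) X.
    have gen p : p = m.+1 ->
      contr (l k) (lefn M p) = p%:R *: \sum_j M k j *: emul (r j) X.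
      by move=> ->; exact: contr_l_lefn.
    exact: gen.
  rewrite emulZ emul_sum; congr (_ *: _).
  by apply: eq_bigr => j _; rewrite emulZ.
have YE i j : n%:R *: emul (l i) (emul (r j) X) = invmx M j i *: lefn M n.
  transitivity (\sum_k invmx M j k *: (n%:R *: \sum_j M k j *: emul (l i) (emul
    (r j) X))).
    under eq_bigr do rewrite !scaler_sumr.
    rewrite exchange_big/= (bigD1 j)//= [X in _ + X]big1 ?addr0 => [|p pj].
      under eq_bigr do rewrite !scalerA mulrCA.
      by rewrite -scaler_suml -mulr_sumr sum_invmx// eqxx mulr1.
    under eq_bigr do rewrite !scalerA mulrCA.
    by rewrite -scaler_suml -mulr_sumr sum_invmx// eq_sym (negbTE pj) mulr0 scale0r.
  under eq_bigr do rewrite XE.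
  rewrite (bigD1 i)//= eqxx scale1r [X in _ + X]big1 ?addr0// => k ki.
  by rewrite (negbTE ki) scale0r scaler0.
rewrite /mxtrace /lef scaler_sumr scaler_suml.
under eq_bigr do rewrite scaler_sumr.
rewrite exchange_big/=; apply: eq_bigr => j _; rewrite mxE scaler_suml.
apply: eq_bigr => i _.
by rewrite -/X [invmx M j i * _]mulrC -scalerA -YE !scalerA mulrC.
Qed.

(** The volume is a signed monomial, as a product of monomials on disjoint sets. *)
Lemma volume_neq0 : volume R n [set: 'I_(n + n)]%SET != 0.
Proof.
have wE (q : seq 'I_n) : uniq q -> exists2 c : R, c != 0 &
    \big[@wedge R n/ext1 R n]_(i <- q) wedge (dx R i) (dxi R i) =
    c *: mono R (ord_pair [set i in q]%SET [set i in q]%SET).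
  elim: q => [_|i q IH /= /andP[iq /IH[c c0 qE]]].
    exists 1; first exact: oner_neq0.
    rewrite big_nil scale1r; congr mono; apply/setP => k; rewrite inE.
    by rewrite -[k]splitK; case: (fintype.split k) => i /=;
      rewrite ?mem_ord_pair_l ?mem_ord_pair_r inE.
  rewrite big_cons qE -wedgeA -!/(emul _ _) !emulZ.
  set S := ord_pair _ _.
  have riS : r i \notin S by rewrite mem_ord_pair_r inE.
  have liS : l i \notin (r i |: S)%SET.
    by rewrite finset.in_setU1 eq_lrshift mem_ord_pair_l inE.
  rewrite emul_mono// emulZ emul_mono// !scalerA.
  exists (c * inv_sign R (r i) S * inv_sign R (l i) (r i |: S)%SET).
    by rewrite !mulf_neq0// /inv_sign signr_eq0.
  congr (_ *: mono R _); apply/setP => k.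
  rewrite -[k]splitK; case: (fintype.split k) => j /=.
    by rewrite mem_ord_pair_l !finset.in_setU1 mem_ord_pair_l !inE eq_lshift
      eq_lrshift.
  by rewrite mem_ord_pair_r !finset.in_setU1 mem_ord_pair_r !inE eq_rshift
    eq_rlshift.
have [c c0] := wE _ (index_enum_uniq 'I_n).
rewrite /volume => ->;
  rewrite extZ ffunE (_ : ord_pair _ _ = [set: 'I_(n + n)]%SET) ?eqxx ?mulr1//.
apply/setP => k; rewrite -[k]splitK; case: (fintype.split k) => j /=.
  by rewrite mem_ord_pair_l !inE mem_index_enum.
by rewrite mem_ord_pair_r !inE mem_index_enum.
Qed.

(** The derivation of the exterior algebra that acts on covectors, in dx and dxi
alike, by the matrix - [B]. *)
Definition mx_derivation B a : ext R n := - \sum_i \sum_j B i j *: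
  (emul (l j) (contr (l i) a) + emul (r j) (contr (r i) a)).

Lemma mx_derivationP B (c : R) a b : mx_derivation B (c *: a + b) =
  c *: mx_derivation B a + mx_derivation B b.
Proof.
rewrite /mx_derivation scalerN -opprD; congr (- _); rewrite scaler_sumr -big_split.
apply: eq_bigr => i _; rewrite scaler_sumr -big_split; apply: eq_bigr => j _ /=.
rewrite !contrD !contrZ !emulD !emulZ !scalerA [c * _]mulrC -scalerA -scalerDr.
by congr (_ *: _); rewrite scalerDr addrACA.
Qed.

Lemma mx_derivation1 B : mx_derivation B (ext1 R n) = 0.
Proof.
rewrite /mx_derivation big1 ?oppr0// => i _; rewrite big1// => j _.
by rewrite !contr_ext1 !emul0 addr0 scaler0.
Qed.

Lemma mx_derivation_emul B k i s : (s = l) \/ (s = r) -> k = s i -> forall a,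
  mx_derivation B (emul k a) =
    emul k (mx_derivation B a) - \sum_j B i j *: emul (s j) a.
Proof.
move=> slr -> a.
have stepE p q : emul p (contr q (emul (s i) a)) =
    emul (s i) (emul p (contr q a)) + (q == s i)%:R *: emul p a.
  by rewrite contr_emul emulB emulZ (emulC p) opprK addrC.
rewrite /mx_derivation emulN -opprD; congr (- _).
have -> : \sum_j B i j *: emul (s j) a =
   \sum_i0 \sum_j B i0 j *: ((l i0 == s i)%:R *: emul (l j) a +
     (r i0 == s i)%:R *: emul (r j) a).
  rewrite [RHS](bigD1 i)//= [X in _ + X]big1 ?addr0 => [|p pi].
    apply: eq_bigr => j _; congr (_ *: _).
    by case: slr => ->; rewrite eqxx scale1r ?eq_lrshift ?eq_rlshift scale0r
      ?addr0 ?add0r.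
  rewrite big1// => j _.
  by case: slr => ->; rewrite ?eq_lshift ?eq_rshift (negbTE pi) ?eq_lrshift
    ?eq_rlshift !scale0r addr0 scaler0.
rewrite emul_sum -big_split; apply: eq_bigr => p _ /=.
rewrite emul_sum -big_split; apply: eq_bigr => j _ /=.
by rewrite !stepE emulZ emulD -scalerDr addrACA.
Qed.

Section KahlerCore.
Variables (G : 'M[R]_n) (F : 'I_n -> 'M[R]_n).
Hypothesis G_sym : G^T = G.
Hypothesis F_sym : forall k, (F k)^T = F k.
Hypothesis F_closed : forall i j k, F k i j = F i k j.

Let Fs i j k : F k i j = F k j i. Proof. by rewrite -[in LHS]F_sym mxE. Qed.

Lemma GFG_sum j i m : \sum_k (G *m F k) i j * G k m = (G *m F j *m G) i m.
Proof.
rewrite mxE; apply: eq_bigr => k _; congr (_ * _); rewrite !mxE.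
by apply: eq_bigr => p _; rewrite Fs F_closed Fs.
Qed.

Lemma GFG_sym j i m : (G *m F j *m G) i m = (G *m F j *m G) m i.
Proof.
have : (G *m F j *m G)^T = G *m F j *m G by rewrite !trmx_mul G_sym F_sym mulmxA.
by move=> /matrixP/(_ m i); rewrite mxE.
Qed.

(** The two contributions of first derivatives of the metric that contract a single
index cancel: this is div G + G grad (log det omega) = 0 for a Hessian metric. *)
Lemma trace_term m :
  \sum_k (- (G *m F k *m G)) k m + \sum_k \tr (G *m F k) * G k m = 0.
Proof.
have -> : \sum_k (- (G *m F k *m G)) k m = - \sum_q \sum_k (G *m F k) k q * G q m.
  by rewrite exchange_big -sumrN; apply: eq_bigr => k _; rewrite mxE [X in - X]mxE.
apply/eqP; rewrite addrC subr_eq0; apply/eqP; apply: eq_bigr => q _.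
rewrite -mulr_suml; congr (_ * _); apply: eq_bigr => k _; rewrite !mxE.
by apply: eq_bigr => p _; rewrite Fs F_closed Fs.
Qed.

Lemma sum_contr_sym s (c : 'I_n -> 'I_n -> R) a : (forall i m, c i m = c m i) ->
  \sum_i \sum_m c i m *: contr (s i) (contr (s m) a) = 0.
Proof.
move=> cs; set X := \sum_i _.
have : X = - X.
  rewrite {1}/X exchange_big -sumrN; apply: eq_bigr => i _ /=.
  by rewrite -sumrN; apply: eq_bigr => m _; rewrite contrC scalerN cs.
by move=> /eqP; rewrite -addr_eq0 -mulr2n -scaler_nat scaler_eq0 pnatr_eq0/= =>
  /eqP.
Qed.

Let GF_iota (s t : 'I_n -> 'I_(n + n)) a :
  \sum_k \sum_i \sum_j (G *m F k) i j *: emul (t j) (contr (t i) (iota_up G s k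
    a)) =
  \sum_j emul (t j) (\sum_i \sum_m (G *m F j *m G) i m *: contr (t i) (contr (s
    m) a)).
Proof.
transitivity (\sum_k \sum_i \sum_j \sum_m ((G *m F k) i j * G k m) *:
    emul (t j) (contr (t i) (contr (s m) a))).
  apply: eq_bigr => k _; apply: eq_bigr => i _; apply: eq_bigr => j _.
  rewrite /iota_up contr_sum emul_sum scaler_sumr; apply: eq_bigr => m _.
  by rewrite contrZ emulZ scalerA.
rewrite exchange_big /=; under eq_bigr do rewrite exchange_big /=.
rewrite exchange_big /=; apply: eq_bigr => j _; rewrite emul_sum.
apply: eq_bigr => i _; rewrite exchange_big emul_sum; apply: eq_bigr => m _ /=.
by rewrite emulZ -GFG_sum scaler_suml.
Qed.

(** The part of order zero of the Kahler identities, for a metric [G] inverse to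
one with first derivatives [F]. The term of the derivation in the generators
[s] contracts a symmetric array with two anticommuting contractions and
vanishes; the term in the generators [t] is the right-hand side. Taking
([s], [t]) to be (dx, dxi) or (dxi, dx) gives the identity for d or for d#. *)
Lemma kahler_core (s t : 'I_n -> 'I_(n + n)) a :
    (s = l /\ t = r) \/ (s = r /\ t = l) ->
  \sum_k (\sum_m (- (G *m F k *m G)) k m *: contr (s m) a +
           mx_derivation (G *m F k) (iota_up G s k a) +
           \tr (G *m F k) *: iota_up G s k a) =
  \sum_k \sum_i \sum_m (- (G *m F k *m G)) i m *: emul (t k) (contr (t i) (contr
    (s m) a)).
Proof.
move=> st.
have mx_derivationE B b : mx_derivation B b =
  - (\sum_i \sum_j B i j *: emul (s j) (contr (s i) b)) -
     \sum_i \sum_j B i j *: emul (t j) (contr (t i) b).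
  rewrite /mx_derivation -opprD -big_split; congr (- _); apply: eq_bigr => i _ /=.
  rewrite -big_split; apply: eq_bigr => j _ /=; rewrite -scalerDr.
  by case: st => -[-> ->] //; rewrite addrC.
under eq_bigr do rewrite mx_derivationE.
rewrite !big_split /= !sumrN !GF_iota.
have -> : \sum_j emul (s j) (\sum_i \sum_m (G *m F j *m G) i m *: contr (s i)
  (contr (s m) a)) = 0.
  by rewrite big1// => j _; rewrite sum_contr_sym ?emul0//; exact: GFG_sym.
rewrite oppr0 add0r.
have E : \sum_k \sum_m (- (G *m F k *m G)) k m *: contr (s m) a +
    \sum_k \tr (G *m F k) *: iota_up G s k a = 0.
  rewrite exchange_big /iota_up /=.
  have -> : \sum_k \tr (G *m F k) *: (\sum_m G k m *: contr (s m) a) =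
     \sum_m \sum_k (\tr (G *m F k) * G k m) *: contr (s m) a.
    rewrite exchange_big; apply: eq_bigr => k _; rewrite scaler_sumr.
    by apply: eq_bigr => m _; rewrite scalerA.
  rewrite -big_split big1// => m _ /=.
  by rewrite -!scaler_suml -scalerDl trace_term scale0r.
rewrite addrAC E add0r -sumrN; apply: eq_bigr => k _.
rewrite emul_sum -sumrN; apply: eq_bigr => i _; rewrite emul_sum -sumrN.
by apply: eq_bigr => m _; rewrite emulZ [in RHS]mxE scaleNr.
Qed.

End KahlerCore.

End Lefschetz.

(** * Directional derivatives *)

Section DirectionalDerivatives.
Local Open Scope classical_set_scope.
Context (R : realType) (V : normedModType R).
Implicit Types (f g : V -> R) (x v w : V).

Lemma is_derive_line f x v (s : R) : derivable f (s *: v + x) v ->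
  is_derive s 1 (fun h : R => f (h *: v + x)) ('D_v f (s *: v + x)).
Proof.
have E : (fun h : R => h^-1 *: (f (h *: v + (s *: v + x)) - f (s *: v + x))) =
    (fun h : R => h^-1 *: (f ((h *: (1 : R) + s) *: v + x) - f (s *: v + x))).
  by apply/funext => h; rewrite [h *: 1]mulr1 scalerDl addrA.
move=> df; apply: DeriveDef; first by move: df; rewrite /derivable /= E.
by rewrite /derive /= E.
Qed.

Lemma is_derive_comp_expR f x v : derivable f x v ->
  is_derive x v (fun y => expR (f y)) (expR (f x) * 'D_v f x).
Proof.
move=> df.
have := is_derive_line (f := f) (x := x) (v := v) (s := 0).
rewrite scale0r add0r => /(_ df) dl.
have de : is_derive ((fun h : R => f (h *: v + x)) 0) 1 (@expR R) (expR (f x)).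
  by rewrite scale0r add0r; exact: is_derive_expR.
have [d1 d2] := is_derive1_comp de dl.
apply: DeriveDef; first exact/derivable1P.
have E : (fun h : R => h^-1 *: (expR (f (h *: v + x)) - expR (f x))) =
    (fun h : R => h^-1 *: (expR (f ((h *: (1 : R) + 0) *: v +
      x)) - expR (f (0 *: v + x)))).
  by apply/funext => h; rewrite addr0 scale0r add0r [h *: 1]mulr1.
by rewrite -d2 /derive /= E.
Qed.

(** The mean value theorem used once in each direction. *)
Lemma second_difference f x v w (s t : R) : 0 < s -> 0 < t ->
    (forall y, derivable f y v) -> (forall y, derivable ('D_v f) y w) ->
  exists s1 t1, [/\ 0 <= s1 <= s, 0 <= t1 <= t &
    f (s *: v + (t *: w + x)) - f (s *: v + x) - f (t *: w + x) + f x
    = s * t * 'D_w ('D_v f) (t1 *: w + (s1 *: v + x))].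
Proof.
move=> s0 t0 dfv dfvw.
pose F h := f (h *: v + (t *: w + x)) - f (h *: v + x).
pose dF h := 'D_v f (h *: v + (t *: w + x)) - 'D_v f (h *: v + x).
have dFP (h : R) : is_derive h 1 F (dF h).
  have h1 := is_derive_line (dfv (h *: v + (t *: w + x))).
  have h2 := is_derive_line (dfv (h *: v + x)).
  exact: is_deriveB.
have cF (G dG : R -> R) (p q : R) : (forall h : R, is_derive h 1 G (dG h)) ->
    {within `[p, q], continuous G}%classic.
  move=> dGP; apply: derivable_within_continuous => h _.
  by have [] := dGP h.
have [s1 s1P E1] := MVT s0 (fun h _ => dFP h) (cF _ _ _ _ dFP).
pose H h := 'D_v f (h *: w + (s1 *: v + x)).
have dHP (h : R) : is_derive h 1 H ('D_w ('D_v f) (h *: w + (s1 *: v + x))).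
  exact: is_derive_line.
have [t1 t1P E2] := MVT t0 (fun h _ => dHP h) (cF _ _ _ _ dHP).
exists s1, t1; split.
- by move: s1P; rewrite in_itv/= => /andP[? ?]; rewrite !ltW.
- by move: t1P; rewrite in_itv/= => /andP[? ?]; rewrite !ltW.
have EF : F s - F 0 = f (s *: v + (t *: w + x)) - f (s *: v + x) - f (t *: w +
  x) + f x.
  by rewrite /F !scale0r !add0r opprB addrA addrAC.
have EH : dF s1 = H t - H 0.
  by rewrite /dF /H scale0r add0r addrCA.
rewrite -EF E1 EH E2 !subr0; ring.
Qed.

Lemma dist_half (p q m e : R) :
  `|p - m| < e / 2 -> `|q - m| < e / 2 -> `|p - q| <= e.
Proof.
rewrite !ltr_norml => /andP[? ?] /andP[? ?].
by rewrite ler_norml; apply/andP; split; lra.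
Qed.

(** Schwarz theorem: both iterated derivatives approximate the same second
difference. *)
Lemma derive_commute f x v w :
    (forall y, derivable f y v) -> (forall y, derivable f y w) ->
    (forall y, derivable ('D_v f) y w) -> (forall y, derivable ('D_w f) y v) ->
    {for x, continuous ('D_w ('D_v f))} -> {for x, continuous ('D_v ('D_w f))} ->
  'D_w ('D_v f) x = 'D_v ('D_w f) x.
Proof.
move=> dv dw dvw dwv cvw cwv; apply/eqP; rewrite -subr_eq0 -normr_le0.
apply/ler_addgt0Pr => e e0; rewrite add0r.
have e2 : 0 < e / 2 by rewrite divr_gt0.
move/cvgrPdist_lt : cvw => /(_ _ e2) /nbhs_ballP[d1 /= d10 c1].
move/cvgrPdist_lt : cwv => /(_ _ e2) /nbhs_ballP[d2 /= d20 c2].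
pose d := Num.min d1 d2; have d0 : 0 < d by rewrite lt_min d10.
pose s := d / (2 * (`|v| + `|w| + 1)).
have N0 : 0 < `|v| + `|w| + 1 by rewrite ltr_wpDl// addr_ge0.
have s0 : 0 < s by rewrite divr_gt0// mulr_gt0.
have close a b : 0 <= a <= s -> 0 <= b <= s -> `|x - (b *: w + (a *: v + x))| < d.
  move=> /andP[a0 as_] /andP[b0 bs].
  rewrite addrA opprD addrCA subrr addr0 normrN.
  apply: (@le_lt_trans _ _ (s * (`|v| + `|w|))).
    apply: (le_trans (ler_normD _ _)); rewrite !normrZ !ger0_norm// mulrDr addrC.
    by apply: lerD; apply: ler_wpM2r.
  rewrite /s -mulrA gtr_pMr//; rewrite mulrC ltr_pdivrMr ?mulr_gt0// mul1r.
  by have := normr_ge0 v; have := normr_ge0 w; lra.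
have [a [b [aP bP E]]] := second_difference x s0 s0 dv dvw.
have [a' [b' [aP' bP' E']]] := second_difference x s0 s0 dw dwv.
have EE : 'D_w ('D_v f) (b *: w + (a *: v + x)) = 'D_v ('D_w f) (b' *: v +
  (a' *: w + x)).
  apply: (mulfI (_ : s * s != 0)); first by rewrite mulf_neq0// gt_eqF.
  apply: etrans (etrans (esym E) _) E'.
  rewrite (addrCA (s *: v)); congr (_ + _); exact: addrAC.
have h1 : `|'D_w ('D_v f) x - 'D_w ('D_v f) (b *: w + (a *: v + x))| < e / 2.
  apply: c1; rewrite -ball_normE /=.
  by apply: (lt_le_trans (close a b aP bP)); rewrite ge_min lexx.
have h2 : `|'D_v ('D_w f) x - 'D_w ('D_v f) (b *: w + (a *: v + x))| < e / 2.
  rewrite EE; apply: c2; rewrite -ball_normE /= addrCA.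
  by apply: (lt_le_trans (close b' a' bP' aP')); rewrite ge_min lexx orbT.
exact: dist_half h1 h2.
Qed.

End DirectionalDerivatives.

(** * Calculus of smooth functions *)

Section SmoothCalculus.
Local Open Scope classical_set_scope.
Context (R : realType) (n : nat).
Implicit Types (f g : 'rV[R]_n -> R) (i j : 'I_n) (x : 'rV[R]_n).

Definition pd i f : 'rV[R]_n -> R := 'D_(delta_mx 0 i) f.

Lemma CkW k f : Ck k.+1 f -> Ck k f.
Proof.
elim: k f => [f [cf _]|k IH f [cf df]]; first by split.
split => // i; have [dfi /IH Dfi] := df i; split=> //.
Qed.

Lemma smooth_continuous f : smooth f -> continuous f.
Proof. by move=> /(_ 0%N) []. Qed.

Lemma smooth_derivable i f : smooth f -> forall x, derivable f x (delta_mx 0 i).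
Proof. by move=> /(_ 1%N) [_ /(_ i)[]]. Qed.

Lemma smooth_pd i f : smooth f -> smooth (pd i f).
Proof. by move=> sf k; have [_ /(_ i)[]] := sf k.+1. Qed.

Lemma Ck_cst k (c : R) : @Ck R n k (fun=> c).
Proof.
elim: k c => [|k IH] c; split => //; do ?exact: cst_continuous.
move=> i; split; first by move=> x; exact: derivable_cst.
rewrite (_ : 'D_ _ _ = (fun=> 0)); first exact: IH.
by apply/funext => x; exact: derive_cst.
Qed.

Lemma CkD k f g : Ck k f -> Ck k g -> Ck k (fun x => f x + g x).
Proof.
elim: k f g => [f g [cf _] [cg _]|k IH f g [cf df] [cg dg]].
  by split => // x; apply: continuousD; [exact: cf|exact: cg].
split; first by move=> x; apply: continuousD; [exact: cf|exact: cg].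
move=> i; have [dfi Cfi] := df i; have [dcometric_mx Cgi] := dg i.
split; first by move=> x; exact: derivableD.
rewrite (_ : 'D_ _ _ = (fun x => 'D_(delta_mx 0 i) f x + 'D_(delta_mx 0 i) g x)).
  exact: IH.
by apply/funext => x; exact: deriveD.
Qed.

Lemma CkM k f g : Ck k f -> Ck k g -> Ck k (fun x => f x * g x).
Proof.
elim: k f g => [f g [cf _] [cg _]|k IH f g Cf Cg].
  by split => // x; apply: continuousM; [exact: cf|exact: cg].
have [cf df] := Cf; have [cg dg] := Cg.
split; first by move=> x; apply: continuousM; [exact: cf|exact: cg].
move=> i; have [dfi Cfi] := df i; have [dcometric_mx Cgi] := dg i.
split; first by move=> x; exact: derivableM.
rewrite (_ : 'D_ _ _ = (fun x => f x * 'D_(delta_mx 0 i) g x +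
  g x * 'D_(delta_mx 0 i) f x)).
  by apply: CkD; apply: IH => //; exact: CkW.
by apply/funext => x; exact: deriveM.
Qed.

Lemma CkV k f : (forall x, f x != 0) -> Ck k f -> Ck k (fun x => (f x)^-1).
Proof.
move=> f0; elim: k => [[cf _]|k IH Cf].
  by split => // x; apply: continuousV => //; exact: cf.
have [cf df] := Cf.
split; first by move=> x; apply: continuousV => //; exact: cf.
move=> i; have [dfi Cfi] := df i.
split; first by move=> x; exact: derivableV.
rewrite (_ : 'D_ _ _ = (fun x =>
  (-1 * ((f x)^-1 * (f x)^-1)) * 'D_(delta_mx 0 i) f x)).
  have Vf := IH (CkW Cf).
  by apply: CkM => //; apply: CkM; [exact: Ck_cst|exact: CkM].
apply/funext => x; rewrite deriveV// mulN1r -invfM -expr2.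
by [].
Qed.

Lemma Ck_expR k f : Ck k f -> Ck k (fun x => expR (f x)).
Proof.
elim: k => [[cf _]|k IH Cf].
  by split => // x; apply: continuous_comp; [exact: cf|exact: continuous_expR].
have [cf df] := Cf.
split; first by move=> x; apply: continuous_comp; [exact: cf|
  exact: continuous_expR].
move=> i; have [dfi Cfi] := df i.
split; first by move=> x; have [] := is_derive_comp_expR (dfi x).
rewrite (_ : 'D_ _ _ = (fun x => expR (f x) * 'D_(delta_mx 0 i) f x)).
  by apply: CkM => //; exact/IH/CkW.
by apply/funext => x; have [_ ->] := is_derive_comp_expR (dfi x).
Qed.

Lemma smooth_cst (c : R) : @smooth R n (fun=> c).
Proof. by move=> k; exact: Ck_cst. Qed.
Lemma smoothD f g : smooth f -> smooth g -> smooth (fun x => f x + g x).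
Proof. by move=> sf sg k; exact: CkD. Qed.
Lemma smoothM f g : smooth f -> smooth g -> smooth (fun x => f x * g x).
Proof. by move=> sf sg k; exact: CkM. Qed.
Lemma smoothV f : (forall x, f x != 0) -> smooth f -> smooth (fun x => (f x)^-1).
Proof. by move=> f0 sf k; exact: CkV. Qed.
Lemma smooth_expR f : smooth f -> smooth (fun x => expR (f x)).
Proof. by move=> sf k; exact: Ck_expR. Qed.
Lemma smoothN f : smooth f -> smooth (fun x => - f x).
Proof.
move=> sf; rewrite (_ : (fun x => _) = (fun x => (fun=> -1) x * f x)).
  exact/smoothM/sf/smooth_cst.
by apply/funext => x; rewrite mulN1r.
Qed.
Lemma smooth_sum (I : Type) (r : seq I) (P : pred I) (F : I -> 'rV[R]_n -> R) :
  (forall k, P k -> smooth (F k)) -> smooth (fun x => \sum_(k <- r | P k) F k x).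
Proof.
move=> sF; elim: r => [|k r IH].
  rewrite (_ : (fun=> _) = (fun=> 0)); first exact: smooth_cst.
  by apply/funext => x; rewrite big_nil.
case: (boolP (P k)) => Pk.
  rewrite (_ : (fun=> _) = (fun x => F k x + \sum_(j <- r | P j) F j x)).
    exact/smoothD/IH/sF.
  by apply/funext => x; rewrite big_cons Pk.
rewrite (_ : (fun=> _) = (fun x => \sum_(j <- r | P j) F j x))//.
by apply/funext => x; rewrite big_cons (negbTE Pk).
Qed.

Lemma pd_cst i (c : R) x : pd i (fun=> c) x = 0.
Proof. exact: derive_cst. Qed.
Lemma pdD i f g x : smooth f -> smooth g ->
  pd i (fun y => f y + g y) x = pd i f x + pd i g x.
Proof. by move=> sf sg; apply: deriveD; exact: smooth_derivable. Qed.
Lemma pdM i f g x : smooth f -> smooth g ->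
  pd i (fun y => f y * g y) x = pd i f x * g x + f x * pd i g x.
Proof.
move=> sf sg; rewrite addrC [pd i f x * _]mulrC.
by apply: deriveM; exact: smooth_derivable.
Qed.
Lemma pdZ i (c : R) f x : smooth f -> pd i (fun y => c * f y) x = c * pd i f x.
Proof. by move=> sf; rewrite pdM ?pd_cst ?mul0r ?add0r//; exact: smooth_cst. Qed.
Lemma pdN i f x : smooth f -> pd i (fun y => - f y) x = - pd i f x.
Proof. by move=> sf; apply: deriveN; exact: smooth_derivable. Qed.
Lemma pd_expR i f x : smooth f ->
  pd i (fun y => expR (f y)) x = expR (f x) * pd i f x.
Proof. by move=> sf; have [_] := is_derive_comp_expR (smooth_derivable (i :=
  i) (x := x) sf). Qed.
Lemma pd_sum i (I : Type) (r : seq I) (P : pred I) (F : I -> 'rV[R]_n -> R) x :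
  (forall k, P k -> smooth (F k)) ->
  pd i (fun y => \sum_(k <- r | P k) F k y) x = \sum_(k <- r | P k) pd i (F k) x.
Proof.
move=> sF; elim: r => [|k r IH].
  rewrite (_ : (fun=> _) = (fun=> 0)) ?pd_cst ?big_nil//.
  by apply/funext => y; rewrite big_nil.
rewrite big_cons -IH; case: (boolP (P k)) => Pk.
  rewrite (_ : (fun=> _) = (fun x => F k x + \sum_(j <- r | P j) F j x)).
    by rewrite pdD//; [exact: sF|exact: smooth_sum].
  by apply/funext => y; rewrite big_cons Pk.
by congr (pd _ _ _); apply/funext => y; rewrite big_cons (negbTE Pk).
Qed.

Lemma pdC i j f x : smooth f -> pd i (pd j f) x = pd j (pd i f) x.
Proof.
move=> sf; apply: derive_commute.
- exact: smooth_derivable.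
- exact: smooth_derivable.
- exact/smooth_derivable/smooth_pd.
- exact/smooth_derivable/smooth_pd.
- exact/smooth_continuous/smooth_pd/smooth_pd.
- exact/smooth_continuous/smooth_pd/smooth_pd.
Qed.

End SmoothCalculus.

(** * Measurability on the product space *)

Section TupleMeasurability.
Local Open Scope classical_set_scope.
Local Open Scope ring_scope.
Context (R : realType).

Definition row_of_tuple n (t : n.-tuple R) : 'rV[R]_n := \row_i tnth t i.

Lemma measurable_norm_coord n (i : 'I_n) (c e : R) :
  measurable [set t : n.-tuple R | `|c - tnth t i| < e].
Proof.
have m1 : measurable_fun setT (fun t : n.-tuple R => `|c - tnth t i|).
  apply: measurableT_comp => //; apply: measurable_funB => //.
  exact: measurable_tnth.
rewrite [X in measurable X](_ : _ = (fun t : n.-tuple R =>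
  `|c - tnth t i|) @^-1` `]-oo, e[%classic).
  by rewrite -[X in measurable X]setTI; exact: m1.
by apply/seteqP; split => t /=; rewrite in_itv.
Qed.

Definition cube n (x : 'rV[R]_n) (e : R) :=
  [set t : n.-tuple R | forall i, `|x 0 i - tnth t i| < e].

Lemma measurable_cube n (x : 'rV[R]_n) (e : R) : measurable (cube x e).
Proof.
rewrite /cube.
rewrite [X in measurable X](_ : _ =
   \bigcap_(i in [set: 'I_n]) [set t : n.-tuple R | `|x 0 i - tnth t i| < e]).
  by apply: fin_bigcap_measurable => // i _; exact: measurable_norm_coord.
by apply/seteqP; split => t /= h i; [move=> _|]; apply: h.
Qed.

Lemma rV_ballE n (x y : 'rV[R]_n) (e : R) : 0 < e ->
  ball x e y <-> forall i, `|x 0 i - y 0 i| < e.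
Proof.
move=> e0; split => [[_ h] i|h]; first exact: (h 0 i).
by split => // i j; rewrite (ord1 i); exact: h.
Qed.

(** Open sets are countable unions of cubes with rational centers, and cubes belong
to the product sigma-algebra. *)
Lemma measurable_row_of_tuple_open n (A : set 'rV[R]_n) :
  open A -> measurable (@row_of_tuple n @^-1` A).
Proof.
move=> oA.
pose B (p : 'rV[rat]_n * nat) := [set t : n.-tuple R |
  (forall i, `|(map_mx ratr p.1 : 'rV[R]_n) 0 i - tnth t i| < p.2.+1%:R^-1) /\
  ball (map_mx ratr p.1 : 'rV[R]_n) p.2.+1%:R^-1 `<=` A].
rewrite [X in measurable X](_ : _ = \bigcup_p B p).
  apply: countable_bigcupT_measurable; first exact: countableP.
  move=> p; rewrite /B.
  have [pA|pA] := pselect (ball (map_mx ratr p.1 : 'rV[R]_n) p.2.+1%:R^-1 `<=` A).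
    rewrite [X in measurable X](_ : _ = [set t : n.-tuple R |
      forall i, `|(map_mx ratr p.1 : 'rV[R]_n) 0 i - tnth t i| < p.2.+1%:R^-1]).
      exact: measurable_cube.
    by apply/seteqP; split => t // [].
  rewrite [X in measurable X](_ : _ = set0)//.
  by apply/seteqP; split => t // [].
apply/seteqP; split => [t /= At|t [p _ [tp pA]]]; last first.
  by apply: pA; apply/rV_ballE => // i; rewrite [row_of_tuple t 0 i]mxE.
have /nbhs_ballP[e /= e0 eA] : nbhs (row_of_tuple t) A by exact: open_nbhs_nbhs.
have [k ke] : exists k : nat, k.+1%:R^-1 < e / 2.
  have := near_infty_natSinv_lt (PosNum (divr_gt0 e0 (ltr0n R 2))).
  by move=> [k _ /(_ k (leqnn _))]; exists k.
have /choice[q qP] : forall i : 'I_n, exists q : rat,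
  `|ratr q - tnth t i| < (k.+1%:R^-1 : R).
  move=> i; have : tnth t i - k.+1%:R^-1 < tnth t i + k.+1%:R^-1.
    by rewrite ltrD2l gtrN.
  move=> /rat_in_itvoo[q]; rewrite in_itv /= => /andP[q1 q2]; exists q.
  by rewrite ltr_distl q1 q2.
exists (\row_i q i, k) => //; split => /=.
  by move=> i; rewrite !mxE; exact: qP.
have ik : 0 < k.+1%:R^-1 :> R by rewrite invr_gt0 ltr0Sn.
move=> y /(rV_ballE _ _ ik) ky; apply: eA; apply/rV_ballE => // i.
have := ky i; have := qP i; rewrite !mxE => h1 h2.
rewrite (splitr e); apply: le_lt_trans (ler_distD (ratr (q i)) _ _) _.
by apply: ltrD; [rewrite distrC; exact: lt_trans ke|exact: lt_trans ke].
Qed.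

Lemma measurable_row_of_tuple_continuous n (f : 'rV[R]_n -> R) : continuous f ->
  measurable_fun setT (f \o @row_of_tuple n).
Proof.
move=> /continuousP cf; apply: (measurability _ (RGenOpens.measurableE R)).
move=> _ [_ [a [b ->] <-]]; rewrite setTI comp_preimage.
apply: measurable_row_of_tuple_open; apply: cf; exact: interval_open.
Qed.

End TupleMeasurability.

(** * Integration by parts on R^n *)

Section CompactSupport.
Local Open Scope classical_set_scope.
Local Open Scope ring_scope.
Context (R : realType).
Local Notation mu := (@lebesgue_measure R).
Local Notation mun := (tuple_measure mu).

(** Continuity and bounded support together give integrability, and both are
inherited by the slices used in Fubini's theorem. *)
Definition cont_bsupp n (f : 'rV[R]_n -> R) := continuous f /\
  exists M : R, forall x : 'rV[R]_n, (exists i, M < `|x 0 i|) -> f x = 0.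

Let tl n (x : 'rV[R]_n.+1) : 'rV[R]_n := \row_i x 0 (lift ord0 i).

Lemma tuple_measure_cubeS n (x : 'rV[R]_n.+1) (e : R) :
  mun n.+1 (cube x e) = (mu (ball (x ord0 ord0) e) * mun n (cube (tl x) e))%E.
Proof.
rewrite -product_measure1E; [|exact: measurable_ball|exact: measurable_cube].
congr (product_measure1 _ _ _).
apply/seteqP; split => [[y t] /= h|[y t] [/= h1 h2] i].
  split; first by have := h ord0; rewrite (tnth_nth y).
  by move=> i; have := h (lift ord0 i); rewrite tnthS mxE.
case: (unliftP ord0 i) => [j ->|->]; last by rewrite (tnth_nth y).
by rewrite tnthS; have := h2 j; rewrite mxE.
Qed.

(** Finiteness gives integrability of bounded functions on cubes; positivity gives
the definiteness of the integral on continuous functions. *)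
Lemma tuple_measure_cube_fin n (x : 'rV[R]_n) (e : R) : 0 < e ->
  (0 < mun n (cube x e) < +oo)%E.
Proof.
move=> e0; elim: n x => [|n IH] x.
  rewrite /= diracE mem_set ?lte01 ?ltry//.
  by case.
rewrite tuple_measure_cubeS lebesgue_measure_ball ?(ltW e0)//.
have /andP[m0 mo] := IH (tl x).
have e2 : 0 < e *+ 2 by rewrite mulrn_wgt0.
by rewrite mule_gt0 ?lte_fin// lte_mul_pinfty// lee_fin ltW.
Qed.

Lemma cont_bsupp_bounded n (f : 'rV[R]_n -> R) : cont_bsupp f ->
  exists M C : R, [/\ 0 < M, 0 <= C & forall t : n.-tuple R,
    `|f (row_of_tuple t)| <= C * \1_(cube 0 M) t].
Proof.
move=> [cf [M fM]].
pose M' := `|M| + 1; have M'0 : 0 < M' by rewrite ltr_wpDl.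
have MM' : M < M' by rewrite /M' (le_lt_trans (ler_norm M))// ltrDl.
have cK : compact [set v : 'rV[R]_n | forall i, v ord0 i \in `[- M', M']].
  apply: (@rV_compact _  _ (fun=> `[- M', M']%classic)).
  by move=> _; apply: segment_compact.
have cn : {within [set v : 'rV[R]_n | forall i, v ord0 i \in `[- M', M']],
    continuous (fun x => `|f x|)}.
  apply: continuous_subspaceT => x; apply: continuous_comp; first exact: cf.
  exact: norm_continuous.
have K0 : [set v : 'rV[R]_n | forall i, v ord0 i \in `[- M', M']] !=set0.
  by exists 0 => i; rewrite mxE in_itv/= oppr_le0 ltW.
have [c _ cP] := EVT_max_rV K0 cK cn.
exists M', `|f c|; split => // t.
rewrite indicE; case: (boolP (t \in cube 0 M')) => [tc|tc].
  rewrite mulr1; apply: cP; rewrite inE in tc; rewrite inE => i.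
  have := tc i; rewrite mxE sub0r normrN !mxE in_itv/= -ler_norml => /ltW.
  by [].
rewrite mulr0 fM ?normr0//.
move: tc; rewrite notin_setE => /existsNP[i]; rewrite mxE sub0r normrN => /negP.
by rewrite -leNgt => tM; exists i; rewrite mxE (lt_le_trans MM').
Qed.

Lemma integrable_cont_bsupp n (f : 'rV[R]_n -> R) : cont_bsupp f ->
  (mun n).-integrable setT (EFin \o (f \o @row_of_tuple R n)).
Proof.
move=> ccf; have [M [C [M0 C0 fC]]] := cont_bsupp_bounded ccf.
have := tuple_measure_cube_fin (0 : 'rV[R]_n) M0; move=> /andP[_ moo].
apply: (@le_integrable _ _ _ (mun n) _ measurableT _ (fun t : n.-tuple R =>
  (C * \1_(cube 0 M) t)%:E)).
- by apply/measurable_EFinP; apply: measurable_row_of_tuple_continuous; case: ccf.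
- by move=> t _; rewrite lee_fin [leRHS]ger0_norm ?fC// mulr_ge0.
under eq_fun do rewrite EFinM; apply: integrableZl => //.
apply/integrableP; split.
  by apply/measurable_EFinP; apply: measurable_indic; exact: measurable_cube.
under eq_integral do rewrite gee0_abs ?lee_fin//.
by rewrite integral_indic ?setIT//; exact: measurable_cube.
Qed.

Definition row_cons n (x : R) (y : 'rV[R]_n) : 'rV[R]_n.+1 :=
  \row_i (if unlift ord0 i is Some j then y 0 j else x).

Lemma row_cons0 n x (y : 'rV[R]_n) : row_cons x y 0 ord0 = x.
Proof. by rewrite mxE unlift_none. Qed.

Lemma row_consS n x (y : 'rV[R]_n) j : row_cons x y 0 (lift ord0 j) = y 0 j.
Proof. by rewrite mxE liftK. Qed.

Lemma row_of_tuple_cons n (p : R * n.-tuple R) :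
  row_of_tuple (tuple_cons p) = row_cons p.1 (row_of_tuple p.2).
Proof.
apply/rowP => i; rewrite [LHS]mxE; case: (unliftP ord0 i) => [j ->|->].
  by rewrite row_consS tnthS [RHS]mxE.
by rewrite row_cons0 (tnth_nth p.1).
Qed.

Lemma row_cons_linel n (s x : R) (y : 'rV[R]_n) :
  s *: delta_mx 0 ord0 + row_cons x y = row_cons (s + x) y.
Proof.
apply/rowP => i; rewrite !mxE; case: (unliftP ord0 i) => [j ->|->].
  by rewrite eqxx/= mulr0 add0r.
by rewrite !eqxx mulr1.
Qed.

Lemma row_cons_liner n (s x : R) (j : 'I_n) (y : 'rV[R]_n) :
  s *: delta_mx 0 (lift ord0 j) + row_cons x y = row_cons x (s *: delta_mx 0 j + y).
Proof.
apply/rowP => i; rewrite !mxE; case: (unliftP ord0 i) => [k ->|->].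
  by rewrite !mxE !eqxx/= (inj_eq lift_inj).
by rewrite !eqxx/= mulr0 add0r.
Qed.

Lemma row_cons_continuousr n x : continuous (@row_cons n x).
Proof.
move=> y A /nbhs_ballP[e /= e0 eA]; apply/nbhs_ballP; exists e => // z.
move=> /(rV_ballE _ _ e0) yz; apply: eA; apply/rV_ballE => // i.
case: (unliftP ord0 i) => [j ->|->]; first by rewrite !row_consS.
by rewrite !row_cons0 subrr normr0.
Qed.

Lemma row_cons_continuousl n (y : 'rV[R]_n) : continuous (fun x : R =>
  row_cons x y).
Proof.
move=> x A /nbhs_ballP[e /= e0 eA]; apply/nbhs_ballP; exists e => // z.
move=> xz; apply: eA; apply/rV_ballE => // i.
case: (unliftP ord0 i) => [j ->|->]; last by rewrite !row_cons0.
by rewrite !row_consS subrr normr0.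
Qed.

Lemma cont_bsupp_row_cons n (f : 'rV[R]_n.+1 -> R) x : cont_bsupp f ->
  cont_bsupp (fun y => f (row_cons x y)).
Proof.
move=> [cf [M fM]]; split.
  by move=> y; apply: continuous_comp; [exact: row_cons_continuousr|exact: cf].
by exists M => y [i iM]; apply: fM; exists (lift ord0 i); rewrite row_consS.
Qed.

(** Both orders of integration are useful: a derivative in the first variable is
integrated along that variable first, any other derivative along the remaining
variables first. *)
Lemma integral_cont_bsupp_cons n (f : 'rV[R]_n.+1 -> R) : cont_bsupp f ->
  (\int[mun n.+1]_t (f (row_of_tuple t))%:E =
     \int[mu]_x \int[mun n]_t (f (row_cons x (row_of_tuple t)))%:E /\
   \int[mun n.+1]_t (f (row_of_tuple t))%:E =
     \int[mun n]_t \int[mu]_x (f (row_cons x (row_of_tuple t)))%:E)%E.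
Proof.
move=> ccf.
pose g (p : R * n.-tuple R) := (f (row_cons p.1 (row_of_tuple p.2)))%:E.
have gE : g = (EFin \o (f \o @row_of_tuple R n.+1)) \o @tuple_cons _
  (measurableTypeR R) n.
  by apply/funext => p; rewrite /g /= row_of_tuple_cons.
have mphi := @measurable_tuple_cons _ (measurableTypeR R) n.
have mf : measurable_fun setT (EFin \o (f \o @row_of_tuple R n.+1)).
  by apply/measurable_EFinP; apply: measurable_row_of_tuple_continuous; case: ccf.
have mg : measurable_fun setT g by rewrite gE; exact: measurableT_comp.
have ig : (mu \x mun n)%E.-integrable setT g.
  have /integrableP[_ foo] := integrable_cont_bsupp ccf.
  apply/integrableP; split => //; apply: le_lt_trans foo.
  have := @ge0_integral_pushforward _ _ _ _ R _ mphi (mu \x mun n)%E setT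
    (abse \o (EFin \o (f \o @row_of_tuple R n.+1))) measurableT (measurableT_comp
      (@abse_measurable _ _) mf) (fun _ _ => abse_ge0 _).
  by rewrite preimage_setT gE => <-.
have E : (\int[mun n.+1]_t (f (row_of_tuple t))%:E = \int[mu \x mun n]_p g p)%E.
  have := @integral_pushforward _ _ _ _ R _ mphi (mu \x mun n)%E setT _ mf.
  by rewrite preimage_setT -gE => /(_ ig measurableT).
by split; rewrite E; [rewrite -integral12_prod_meas1|rewrite
  -integral21_prod_meas1].
Qed.

Lemma integral_deriv0 (G dG : R -> R) (M : R) :
    (forall x : R, is_derive x 1 G (dG x)) -> continuous dG ->
    (forall x, M < `|x| -> G x = 0) -> (forall x, M < `|x| -> dG x = 0) ->
  (\int[mu]_x (dG x)%:E = 0)%E.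
Proof.
move=> GP cdG G0 dG0; pose K := `|M| + 1.
have MK : M < K by rewrite /K (le_lt_trans (ler_norm M))// ltrDl.
have K0 : 0 < K by rewrite ltr_wpDl.
have cG : continuous G.
  by move=> x; apply/differentiable_continuous/derivable1_diffP; have [] := GP x.
have -> : (\int[mu]_x (dG x)%:E = \int[mu]_(x in `[(- K)%R, K]) (dG x)%:E)%E.
  rewrite [RHS]integral_mkcond; apply: eq_integral => x _; rewrite patchE.
  case: ifPn => //; rewrite notin_setE /= in_itv/= -ler_norml => /negP.
  by rewrite -ltNge => xK; rewrite dG0// (lt_trans MK).
rewrite (@continuous_FTC2 _ dG G).
- by rewrite !G0 ?subee// ?normrN gtr0_norm.
- by rewrite gtrN.
- exact: continuous_subspaceT.
- split; [by move=> x _; have [] := GP x|exact/cvg_at_right_filter/cG|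
    exact/cvg_at_left_filter/cG].
- by move=> x _; rewrite derive1E; have [_ ->] := GP x.
Qed.

Lemma derive_row_cons n (f : 'rV[R]_n.+1 -> R) x (y : 'rV[R]_n) (j : 'I_n) :
  'D_(delta_mx 0 (lift ord0 j)) f (row_cons x y) =
    'D_(delta_mx 0 j) (fun y => f (row_cons x y)) y /\
  (derivable f (row_cons x y) (delta_mx 0 (lift ord0 j)) ->
   derivable (fun y => f (row_cons x y)) y (delta_mx 0 j)).
Proof.
have E : (fun h : R => h^-1 *: (f (h *: delta_mx 0 (lift ord0 j) +
  row_cons x y) - f (row_cons x y))) =
   (fun h : R => h^-1 *: (f (row_cons x (h *: delta_mx 0 j +
     y)) - f (row_cons x y))).
  by apply/funext => h; rewrite row_cons_liner.
by split; [rewrite /derive /= E|rewrite /derivable /= E].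
Qed.

(** Induction on the dimension. The derivative in the first variable integrates to
0 on every line by the fundamental theorem of calculus; any other derivative is
a derivative of the slices at fixed first coordinate. *)
Lemma integral_pd0 n (i : 'I_n) (f : 'rV[R]_n -> R) :
    cont_bsupp f -> cont_bsupp (pd i f) ->
      (forall x, derivable f x (delta_mx 0 i)) ->
  (\int[mun n]_t (pd i f (row_of_tuple t))%:E = 0)%E.
Proof.
elim: n i f => [[]//|n IH] i f ccf ccdf df.
have [E1 E2] := integral_cont_bsupp_cons ccdf.
case: (unliftP ord0 i) => [j ij|i0].
  rewrite E1 -[RHS](integral0 mu setT); apply: eq_integral => x _.
  have dE : (fun y => pd i f (row_cons x y)) = pd j (fun y => f (row_cons x y)).
    by apply/funext => y; rewrite /pd ij; have [->] := derive_row_cons f x y j.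
  rewrite -(IH j (fun y => f (row_cons x y))).
  - by apply: eq_integral => t _; rewrite -dE.
  - exact: cont_bsupp_row_cons.
  - by rewrite -dE; exact: cont_bsupp_row_cons.
  - by move=> y; have [_] := derive_row_cons f x y j; apply; rewrite -ij; exact: df.
subst i; rewrite E2 -[RHS](integral0 (mun n) setT); apply: eq_integral => t _.
have [cf [M fM]] := ccf; have [cdf [M' dfM]] := ccdf.
apply: (@integral_deriv0 (fun x =>
  f (row_cons x (row_of_tuple t))) _ (Num.max M M')).
- move=> x; have := @is_derive_line R _ f (row_cons 0 (row_of_tuple t)) (delta_mx
    0 ord0) x.
  rewrite row_cons_linel addr0 => /(_ (df _)).
  by under eq_fun do rewrite row_cons_linel addr0.
- by move=> x; apply: continuous_comp; [exact: row_cons_continuousl|exact: cdf].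
- by move=> x; rewrite gt_max => /andP[Mx _]; apply: fM; exists ord0;
    rewrite row_cons0.
- by move=> x; rewrite gt_max => /andP[_ Mx]; apply: dfM; exists ord0;
    rewrite row_cons0.
Qed.

(** A continuous function that is positive at a point is bounded below on a cube
around it. *)
Lemma cont_bsupp_ge0_eq0 n (f : 'rV[R]_n -> R) : cont_bsupp f ->
  (forall x, 0 <= f x) ->
  (\int[mun n]_t (f (row_of_tuple t))%:E = 0)%E -> forall x, f x = 0.
Proof.
move=> ccf f0 intf x; apply/eqP; apply: contraT => fx0.
have fx : 0 < f x / 2 by rewrite divr_gt0// lt_def fx0 f0.
have [cf _] := ccf.
have /cvgrPdist_lt/(_ _ fx)/nbhs_ballP[e /= e0 eP] := cf x.
have /andP[m0 moo] := tuple_measure_cube_fin x e0.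
suff : (0 < \int[mun n]_t (f (row_of_tuple t))%:E)%E by rewrite intf ltxx.
have fC t : cube x e t -> f x / 2 <= f (row_of_tuple t).
  move=> tc; have : ball x e (row_of_tuple t).
    by apply/rV_ballE => // i; rewrite [row_of_tuple t 0 i]mxE.
  by move=> /eP; rewrite ltr_distl => /andP[_]; lra.
apply: (@lt_le_trans _ _ ((f x / 2)%:E * mun n (cube x e))%E).
  by rewrite mule_gt0 ?lte_fin.
have mf : measurable_fun setT (EFin \o (f \o @row_of_tuple R n)).
  by apply/measurable_EFinP; apply: measurable_row_of_tuple_continuous.
apply: (@le_trans _ _ (\int[mun n]_(t in cube x e) (f (row_of_tuple t))%:E)%E).
  rewrite -integral_cst; last exact: measurable_cube.
  apply: ge0_le_integral => //=; first exact: measurable_cube.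
  - by move=> t _; rewrite lee_fin ltW.
  - exact: measurable_funTS.
apply: ge0_subset_integral => //; first exact: measurable_cube.
by move=> t _; rewrite lee_fin.
Qed.

Lemma cont_bsupp_add n (f g : 'rV[R]_n -> R) : cont_bsupp f -> cont_bsupp g ->
  cont_bsupp (fun x => f x + g x).
Proof.
move=> [cf [M fM]] [cg [N gN]]; split.
  by move=> x; apply: continuousD; [exact: cf|exact: cg].
exists (Num.max M N) => x [i]; rewrite gt_max => /andP[Mx Nx].
by rewrite fM ?gN ?addr0//; exists i.
Qed.

Lemma integral_rVE n (f : 'rV[R]_n -> R) :
  integral_rV f = fine (\int[mun n]_t (f (row_of_tuple t))%:E)%E.
Proof. by []. Qed.

Lemma integral_rV_ge0_eq0 n (f : 'rV[R]_n -> R) : cont_bsupp f ->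
  (forall x, 0 <= f x) ->
  integral_rV f = 0 -> forall x, f x = 0.
Proof.
move=> ccf f0; rewrite integral_rVE => /eqP; rewrite fine_eq0; last first.
  by apply: integrable_fin_num => //; exact: integrable_cont_bsupp.
by move=> /eqP; exact: cont_bsupp_ge0_eq0.
Qed.

(** The divergence theorem without boundary terms, in the form in which it yields
adjoints. *)
Lemma integral_rV_divergence n (f g : 'rV[R]_n -> R) (F : 'I_n -> 'rV[R]_n -> R) :
    cont_bsupp f -> cont_bsupp g -> (forall i, cont_bsupp (F i)) ->
      (forall i, cont_bsupp (pd i (F i))) ->
    (forall i x, derivable (F i) x (delta_mx 0 i)) ->
    (forall x, f x = g x + \sum_i pd i (F i) x) ->
  integral_rV f = integral_rV g.
Proof.
move=> ccf ccg ccF ccdF dF fg.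
have : forall s : seq 'I_n, cont_bsupp (fun x => g x +
  \sum_(i <- s) pd i (F i) x) /\
    integral_rV (fun x => g x + \sum_(i <- s) pd i (F i) x) = integral_rV g.
  elim=> [|i s [ccs IH]].
    have -> // : (fun x => g x + \sum_(i <- [::]) pd i (F i) x) = g.
    by apply/funext => x; rewrite big_nil addr0.
  have E : (fun x => g x + \sum_(j <- i :: s) pd j (F j) x) =
     (fun x => (g x + \sum_(j <- s) pd j (F j) x) + pd i (F i) x).
    by apply/funext => x; rewrite big_cons addrA addrAC.
  rewrite E; split; first exact: cont_bsupp_add.
  rewrite /integral_rV RintegralD//; [|exact: (integrable_cont_bsupp ccs)|
    exact: (integrable_cont_bsupp (ccdF i))].
  by rewrite [X in _ + X]/Rintegral (integral_pd0 (ccF i))// addr0 -[RHS]IH.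
move=> /(_ (index_enum _))[_ <-].
have -> // : f = (fun x => g x + \sum_i pd i (F i) x).
by apply/funext => x; exact: fg.
Qed.

End CompactSupport.

(** * Smooth families of matrices *)

Section SmoothMatrices.
Context (R : realType) (n : nat).
Implicit Types (f g : 'rV[R]_n -> R) (x : 'rV[R]_n).

Lemma smooth_ext f g : smooth f -> f =1 g -> smooth g.
Proof. by move=> sf /funext <-. Qed.

Lemma smooth_prod (I : Type) (q : seq I) (P : pred I) (F : I -> 'rV[R]_n -> R) :
  (forall k, P k -> smooth (F k)) -> smooth (fun x => \prod_(k <- q | P k) F k x).
Proof.
move=> sF; elim: q => [|k q IH].
  by apply: smooth_ext (smooth_cst _ 1) _ => x; rewrite big_nil.
case: (boolP (P k)) => Pk.
  by apply: smooth_ext (smoothM (sF _ Pk) IH) _ => x; rewrite big_cons Pk.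
by apply: smooth_ext IH _ => x; rewrite big_cons (negbTE Pk).
Qed.

Lemma smooth_det m (A : 'rV[R]_n -> 'M[R]_m) :
  (forall i j, smooth (fun x => A x i j)) -> smooth (fun x => \det (A x)).
Proof.
move=> sA; apply: smooth_sum => s _; apply: smoothM; first exact: smooth_cst.
by apply: smooth_prod => i _; exact: sA.
Qed.

(** Cramer's rule. *)
Lemma smooth_invmx m (A : 'rV[R]_n -> 'M[R]_m) :
    (forall i j, smooth (fun x => A x i j)) -> (forall x, A x \in unitmx) ->
  forall i j, smooth (fun x => invmx (A x) i j).
Proof.
move=> sA uA i j.
apply: (@smooth_ext (fun x => (\det (A x))^-1 *
  ((-1) ^+ (j + i) * \det (row' j (col' i (A x)))))) => [|x]; last first.
  by rewrite /invmx uA !mxE.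
apply: smoothM; first (apply: smoothV; last exact: smooth_det).
  by move=> x; rewrite -unitfE -unitmxE.
apply: smoothM; first exact: smooth_cst.
by apply: smooth_det => p q;
  apply: smooth_ext (sA (lift j p) (lift i q)) _ => x; rewrite !mxE.
Qed.

Definition dmx m k (A : 'rV[R]_n -> 'M[R]_m) x : 'M[R]_m :=
  \matrix_(i, j) pd k (fun y => A y i j) x.

(** Obtained by differentiating inv(A) A = 1. *)
Lemma dmx_invmx m k (A : 'rV[R]_n -> 'M[R]_m) x :
    (forall i j, smooth (fun x => A x i j)) -> (forall x, A x \in unitmx) ->
  dmx k (fun y => invmx (A y)) x = - (invmx (A x) *m dmx k A x *m invmx (A x)).
Proof.
move=> sA uA; have sG := smooth_invmx sA uA.
have E : dmx k (fun y => invmx (A y)) x *m A x + invmx (A x) *m dmx k A x = 0.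
  apply/matrixP => i j; rewrite !mxE -big_split /=.
  transitivity (pd k (fun y => \sum_p invmx (A y) i p * A y p j) x).
    rewrite pd_sum => [|p _]; last exact: smoothM.
    by apply: eq_bigr => p _; rewrite pdM// !mxE.
  have -> : (fun y => \sum_p invmx (A y) i p * A y p j) = (fun=> (i == j)%:R).
    by apply/funext => y; rewrite sum_invmx.
  exact: pd_cst.
rewrite -[LHS](mulmxK (uA x)) -mulNmx; congr (_ *m _).
by apply/eqP; rewrite -addr_eq0 E.
Qed.

End SmoothMatrices.

(** * Calculus of smooth forms *)

Section FormCalculus.
Context (R : realType) (n : nat).
Implicit Types (u v : superform R n) (f g : 'rV[R]_n -> R) (x : 'rV[R]_n).
Local Notation ext := (ext R n).

Lemma partialE i u x S : partial i u x S = pd i (fun y => u y S) x.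
Proof. by rewrite ffunE. Qed.

Lemma smooth_form_partial i u : smooth_form u -> smooth_form (partial i u).
Proof.
move=> su S; by apply: smooth_ext (smooth_pd i (su S)) _ => x; rewrite partialE.
Qed.

Lemma partialC i j u x : smooth_form u ->
  partial i (partial j u) x = partial j (partial i u) x.
Proof.
move=> su; apply/ffunP => S.
have E k p : partial k (partial p u) x S = pd k (pd p (fun y => u y S)) x.
  rewrite partialE; congr (pd k _ x); apply/funext => y; exact: partialE.
exact: etrans (E i j) (etrans (pdC _ _ _ (su S)) (esym (E j i))).
Qed.

Lemma smooth_form_add u v : smooth_form u -> smooth_form v ->
  smooth_form (fun x => u x + v x).
Proof. by move=> su sv S; apply: smooth_ext (smoothD (su S) (sv S)) _ => x;
  rewrite extD. Qed.

Lemma smooth_form_scale f u : smooth f -> smooth_form u ->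
  smooth_form (fun x => f x *: u x).
Proof. by move=> sf su S; apply: smooth_ext (smoothM sf (su S)) _ => x;
  rewrite extZ. Qed.

Lemma smooth_form_opp u : smooth_form u -> smooth_form (fun x => - u x).
Proof. by move=> su S; apply: smooth_ext (smoothN (su S)) _ => x; rewrite extN. Qed.

Lemma smooth_form_sub u v : smooth_form u -> smooth_form v ->
  smooth_form (fun x => u x - v x).
Proof. by move=> su sv; apply: smooth_form_add => //; exact: smooth_form_opp. Qed.

Lemma smooth_form_sum (I : Type) (q : seq I) (P : pred I) (F : I -> superform R n) :
  (forall k, P k -> smooth_form (F k)) ->
  smooth_form (fun x => \sum_(k <- q | P k) F k x).
Proof.
move=> sF S; apply: (@smooth_ext _ _ (fun x =>
  \sum_(k <- q | P k) F k x S)) => [|x].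
  by apply: smooth_sum => k Pk; exact: sF.
by rewrite ext_sum.
Qed.

Lemma smooth_form_cst (a : ext) : smooth_form (fun=> a).
Proof. by move=> S; exact: smooth_cst. Qed.

(** Coordinates of a linear map of exterior algebras, which reduce its smoothness
and its derivatives to those of coefficients. *)
Lemma lin_mono (A : {linear ext -> ext}) (a : ext) S :
  A a S = \sum_T a T * A (mono R T) S.
Proof.
rewrite [in LHS](ext_mono a) linear_sum ext_sum; apply: eq_bigr => T _.
by rewrite linearZZ extZ.
Qed.

Lemma smooth_form_lin (A : {linear ext -> ext}) u : smooth_form u ->
  smooth_form (fun x => A (u x)).
Proof.
move=> su S; apply: (@smooth_ext _ _ (fun x =>
  \sum_T u x T * A (mono R T) S)) => [|x].
  by apply: smooth_sum => T _; apply: smoothM; [exact: su|exact: smooth_cst].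
by rewrite [RHS]lin_mono.
Qed.

Lemma partial_lin (A : {linear ext -> ext}) i u x : smooth_form u ->
  partial i (fun x => A (u x)) x = A (partial i u x).
Proof.
move=> su; apply/ffunP => S; rewrite partialE [RHS]lin_mono.
transitivity (pd i (fun x => \sum_T u x T * A (mono R T) S) x).
  by congr (pd i _ x); apply/funext => y; rewrite [LHS]lin_mono.
rewrite pd_sum => [|T _]; last by apply: smoothM; [exact: su|exact: smooth_cst].
apply: eq_bigr => T _; rewrite pdM; [|exact: su|exact: smooth_cst].
by rewrite pd_cst mulr0 addr0 partialE.
Qed.

Lemma partialD i u v x : smooth_form u -> smooth_form v ->
  partial i (fun x => u x + v x) x = partial i u x + partial i v x.
Proof.
move=> su sv; apply/ffunP => S; rewrite extD !partialE -pdD; [|exact: su|exact: sv].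
by congr (pd i _ x); apply/funext => y; rewrite extD.
Qed.

Lemma partialN i u x : smooth_form u ->
  partial i (fun x => - u x) x = - partial i u x.
Proof.
move=> su; apply/ffunP => S; rewrite extN !partialE -pdN; last exact: su.
by congr (pd i _ x); apply/funext => y; rewrite extN.
Qed.

Lemma partialB i u v x : smooth_form u -> smooth_form v ->
  partial i (fun x => u x - v x) x = partial i u x - partial i v x.
Proof. by move=> su sv; rewrite partialD ?partialN//; exact: smooth_form_opp. Qed.

Lemma partialZ i f u x : smooth f -> smooth_form u ->
  partial i (fun x => f x *: u x) x = pd i f x *: u x + f x *: partial i u x.
Proof.
move=> sf su; apply/ffunP => S; rewrite extD !extZ !partialE -pdM; [|
  exact: sf|exact: su].
by congr (pd i _ x); apply/funext => y; rewrite extZ.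
Qed.

Lemma partial_sum i (I : Type) (q : seq I) (P : pred I) (F : I -> superform R n) x :
  (forall k, P k -> smooth_form (F k)) ->
  partial i (fun x => \sum_(k <- q | P k) F k x) x =
    \sum_(k <- q | P k) partial i (F k) x.
Proof.
move=> sF; apply/ffunP => S; rewrite ext_sum partialE.
transitivity (pd i (fun y => \sum_(k <- q | P k) F k y S) x).
  by congr (pd i _ x); apply/funext => y; rewrite ext_sum.
rewrite pd_sum => [|k Pk]; last exact: sF.
by apply: eq_bigr => k _; rewrite partialE.
Qed.

Lemma partial_cst i (a : ext) x : partial i (fun=> a) x = 0.
Proof. by apply/ffunP => S; rewrite partialE pd_cst ffunE. Qed.

End FormCalculus.

Lemma sub_sub_cancel (V : zmodType) (X Y B : V) : X - Y - (B + X) = - Y - B.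
Proof. by rewrite [B + X]addrC opprD addrA; congr (_ - B);
  rewrite addrAC subrr add0r. Qed.

(** * The metric of a closed positive form and its adjoints *)

Section HessianMetric.
Context (R : realType) (n : nat).
Variables (omega : superform R n) (phi : 'rV[R]_n -> R).
Hypothesis omega_smooth : smooth_form omega.
Hypothesis omega_closed : closed_form omega.
Hypothesis omega_positive : positive_11 omega.
Hypothesis phi_smooth : smooth phi.
Implicit Types (u v : superform R n) (x : 'rV[R]_n) (a b : ext R n).
Local Notation l := (@lshift n n).
Local Notation r := (@rshift n n).

Definition metric_mx x := omega_mx (omega x).
Definition cometric_mx x := invmx (metric_mx x).
Definition dmetric_mx k x := dmx k metric_mx x.
Definition dcometric_mx k x := dmx k cometric_mx x.
(** The matrix by which differentiation along x_k fails to preserve the inner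
product of covectors. *)
Definition conn k x := cometric_mx x *m dmetric_mx k x.
Definition dot x := dotH (diag2 (cometric_mx x)).

Lemma metric_mx_pos x : posdef (metric_mx x).
Proof. exact: (proj2 omega_positive). Qed.

Lemma metric_mx_unit x : metric_mx x \in unitmx.
Proof. exact: posdef_unit (metric_mx_pos x). Qed.

Lemma cometric_mx_tr x : (cometric_mx x)^T = cometric_mx x.
Proof. exact: posdef_inv_sym (metric_mx_pos x). Qed.

Lemma cometric_mx_sym x i j : cometric_mx x i j = cometric_mx x j i.
Proof. by rewrite -[in LHS]cometric_mx_tr mxE. Qed.

Lemma metric_mx_smooth i j : smooth (fun x => metric_mx x i j).
Proof. by apply: smooth_ext (omega_smooth (ord_pair [set i]%SET [set j]%SET)) _
  => x; rewrite mxE. Qed.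

Lemma cometric_mx_smooth i j : smooth (fun x => cometric_mx x i j).
Proof. exact: (smooth_invmx metric_mx_smooth metric_mx_unit). Qed.

Lemma dcometric_mxE k x : dcometric_mx k x =
  - (cometric_mx x *m dmetric_mx k x *m cometric_mx x).
Proof. exact: (dmx_invmx k x metric_mx_smooth metric_mx_unit). Qed.

Lemma dcometric_mx_entry k x i j : dcometric_mx k x i j = pd k (fun y =>
  cometric_mx y i j) x.
Proof. by rewrite mxE. Qed.

Lemma dmetric_mx_entry k x i j : dmetric_mx k x i j = pd k (fun y =>
  metric_mx y i j) x.
Proof. by rewrite mxE. Qed.

Lemma dmetric_mx_tr k x : (dmetric_mx k x)^T = dmetric_mx k x.
Proof.
apply/matrixP => i j; rewrite mxE !dmetric_mx_entry; congr (pd k _ x);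
  apply/funext => y.
by have [GT _] := metric_mx_pos y; rewrite -[in LHS]GT mxE.
Qed.

Lemma wedge_omega x a : wedge (omega x) a = lef (metric_mx x) a.
Proof. by apply: wedge_bidegree11 => I J; exact: (proj1 omega_positive). Qed.

Lemma form_dot_omega x : form_dot (omega x) = dot x.
Proof. exact: form_dotE (metric_mx_pos x). Qed.

Lemma smooth_form_lef (A : 'rV[R]_n -> 'M[R]_n) u :
  (forall i j, smooth (fun x => A x i j)) -> smooth_form u ->
  smooth_form (fun x => lef (A x) (u x)).
Proof.
move=> sA su; apply: smooth_form_sum => i _; apply: smooth_form_sum => j _.
by apply: smooth_form_scale => //; do 2! apply: (smooth_form_lin (emul _)).
Qed.

Lemma partial_lef (A : 'rV[R]_n -> 'M[R]_n) u k x :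
  (forall i j, smooth (fun x => A x i j)) -> smooth_form u ->
  partial k (fun x => lef (A x) (u x)) x =
  lef (dmx k A x) (u x) + lef (A x) (partial k u x).
Proof.
move=> sA su.
have s2 i j : smooth_form (fun x => emul (l i) (emul (r j) (u x))).
  by do 2! apply: (smooth_form_lin (emul _)).
have s1 i j : smooth_form (fun x => A x i j *: emul (l i) (emul (r j) (u x))).
  exact: smooth_form_scale.
rewrite partial_sum => [|i _]; last exact: smooth_form_sum.
rewrite /lef -big_split; apply: eq_bigr => i _ /=.
rewrite partial_sum => [|j _]; last exact: s1.
rewrite -big_split; apply: eq_bigr => j _ /=.
rewrite partialZ; [|exact: sA|exact: s2].
rewrite mxE; congr (_ + _ *: _).
rewrite (partial_lin (emul (l i)) k x (u := fun x => emul (r j) (u x)));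
  last exact: (smooth_form_lin (emul _)).
by rewrite (partial_lin (emul (r j)) k x su).
Qed.

(** The coefficient of dx_i /\ dx_k /\ dxi_j in d omega, extracted by three
contractions. *)
Lemma dmetric_mx_closed x i j k : dmetric_mx k x i j = dmetric_mx i x k j.
Proof.
have oE : omega = (fun y => lef (metric_mx y) (ext1 R n)).
  by apply/funext => y; rewrite -wedge_omega wedge1r.
have pE p : partial p omega x = lef (dmetric_mx p x) (ext1 R n).
  transitivity (partial p (fun y => lef (metric_mx y) (ext1 R n)) x).
    by congr (partial p _ x).
  rewrite partial_lef; [|exact: metric_mx_smooth|exact: smooth_form_cst].
  by rewrite partial_cst lef0 addr0.
have := omega_closed x; rewrite /dform.
under eq_bigr do rewrite pE -/(emul _ _).
move=> /(congr1 (fun a => contr (r j) (contr (l k) (contr (l i) a)) finset.set0)).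
have e0 : (0 : ext R n) finset.set0 = 0 by rewrite ffunE.
rewrite !contr0 e0 !contr_sum ext_sum.
have term p : contr (r j) (contr (l k) (contr (l i) (emul (l p) (lef (dmetric_mx
  p x) (ext1 R n))))) finset.set0
   = (i == p)%:R * dmetric_mx p x k j - (k == p)%:R * dmetric_mx p x i j.
  have c1 (B : 'M[R]_n) q : contr (r j) (contr (l q) (lef B (ext1 R n)))
    finset.set0 = B q j.
    rewrite contr_l_lef contr_ext1 lef0 add0r contr_sum ext_sum (bigD1 j)//= big1
      ?addr0.
      by rewrite contrZ extZ contr_emul eqxx scale1r contr_ext1 emul0 subr0 ffunE
        eqxx mulr1.
    move=> m mj; rewrite contrZ extZ contr_emul eq_rshift eq_sym (negbTE mj)
      scale0r.
    by rewrite contr_ext1 emul0 subr0 ffunE mulr0.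
  rewrite contr_emul eq_lshift contrB contrZ contrB contrZ extD extN extZ c1.
  rewrite contr_emul eq_lshift contrB contrZ extD extN extZ c1.
  by rewrite contr_emul eq_rlshift scale0r sub0r extN emul_set0 !oppr0 addr0.
under eq_bigr do rewrite term.
rewrite sumrB (bigD1 i)//= eqxx mul1r big1 ?addr0 => [|p pi]; last first.
  by rewrite eq_sym (negbTE pi) mul0r.
rewrite (bigD1 k)//= eqxx mul1r big1 ?addr0 => [|p pk]; last first.
  by rewrite eq_sym (negbTE pk) mul0r.
by move=> /eqP; rewrite subr_eq0 => /eqP <-.
Qed.

Lemma smooth_form_iota s k u : smooth_form u ->
  smooth_form (fun x => iota_up (cometric_mx x) s k (u x)).
Proof.
move=> su; apply: smooth_form_sum => m _; apply: smooth_form_scale;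
  first exact: cometric_mx_smooth.
exact: (smooth_form_lin (contr _)).
Qed.

Lemma partial_iota s k p u x : smooth_form u ->
  partial p (fun x => iota_up (cometric_mx x) s k (u x)) x =
  iota_up (dcometric_mx p x) s k (u x) +
    iota_up (cometric_mx x) s k (partial p u x).
Proof.
move=> su.
have s1 m : smooth_form (fun x =>
  contr (s m) (u x)) by exact: (smooth_form_lin (contr _)).
rewrite partial_sum => [|m _]; last by apply: smooth_form_scale;
  [exact: cometric_mx_smooth|exact: s1].
rewrite /iota_up -big_split; apply: eq_bigr => m _ /=.
rewrite partialZ; [|exact: cometric_mx_smooth|exact: s1].
by rewrite dcometric_mx_entry (partial_lin (contr (s m)) p x su).
Qed.

Lemma smooth_form_dlef u : smooth_form u ->
  smooth_form (fun x => dlef (cometric_mx x) (u x)).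
Proof.
move=> su; apply: smooth_form_sum => i _; apply: smooth_form_sum => j _.
by apply: smooth_form_scale;
  [exact: cometric_mx_smooth|do 2! apply: (smooth_form_lin (contr _))].
Qed.

Lemma partial_dlef k u x : smooth_form u ->
  partial k (fun x => dlef (cometric_mx x) (u x)) x =
  dlef (dcometric_mx k x) (u x) + dlef (cometric_mx x) (partial k u x).
Proof.
move=> su.
have s2 i j : smooth_form (fun x => contr (r j) (contr (l i) (u x))).
  by do 2! apply: (smooth_form_lin (contr _)).
have s1 i j : smooth_form (fun x =>
  cometric_mx x i j *: contr (r j) (contr (l i) (u x))).
  by apply: smooth_form_scale; [exact: cometric_mx_smooth|exact: s2].
rewrite partial_sum => [|i _]; last exact: smooth_form_sum.
rewrite /dlef -big_split; apply: eq_bigr => i _ /=.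
rewrite partial_sum => [|j _]; last exact: s1.
rewrite -big_split; apply: eq_bigr => j _ /=.
rewrite partialZ; [|exact: cometric_mx_smooth|exact: s2].
rewrite dcometric_mx_entry; congr (_ + _ *: _).
rewrite (partial_lin (contr (r j)) k x (u := fun x => contr (l i) (u x)));
  last exact: (smooth_form_lin (contr _)).
by rewrite (partial_lin (contr (l i)) k x su).
Qed.

Lemma dot_emul x s k a b : s = l \/ s = r ->
  dot x (emul (s k) a) b = dot x a (iota_up (cometric_mx x) s k b).
Proof. by case=> ->; [exact: dotH_emul_l|exact: dotH_emul_r]. Qed.

Lemma dotC x a b : dot x a b = dot x b a.
Proof. exact/dotHC/diag2_sym/cometric_mx_tr. Qed.

(** The inner product of constant forms depends on the point only through the
metric. Following generators, each new factor contributes the derivative of a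
metric contraction, which is the commutator of the derivation with that factor. *)
Lemma dot_cst_smooth_pd a : forall b, smooth (fun x => dot x a b) /\
  forall k x, pd k (fun x => dot x a b) x = dot x (mx_derivation (conn k x) a) b.
Proof.
elim/ext_ind: a => [|c a a' IHa IHa'|p a IH] b.
- have E : (fun x => dot x (ext1 R n) b) = (fun=> b finset.set0).
    by apply/funext => x; exact: dotH1l.
  rewrite E; split; first exact: smooth_cst.
  by move=> k x; rewrite pd_cst mx_derivation1 /dot dotH0l.
- have [sa pa] := IHa b; have [sa' pa'] := IHa' b.
  have E : (fun x => dot x (c *: a + a') b) = (fun x => c * dot x a b + dot x a' b).
    by apply/funext => x; rewrite /dot dotHDl dotHZl.
  have s1 : smooth (fun x => c * dot x a b) by apply: smoothM => //;
    exact: smooth_cst.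
  rewrite E; split; first exact: smoothD.
  by move=> k x; rewrite pdD// pdZ// pa pa' mx_derivationP /dot dotHDl dotHZl.
- have [s [i [slr ->]]] : exists s i, (s = l \/ s = r) /\ p = s i.
    rewrite -[p]splitK; case: (fintype.split p) => i /=;
      [exists l, i|exists r, i]; auto.
  have E : (fun x => dot x (emul (s i) a) b) =
      (fun x => \sum_m cometric_mx x i m * dot x a (contr (s m) b)).
    apply/funext => x; rewrite dot_emul// /iota_up /dot dotH_sumr.
    by apply: eq_bigr => m _; rewrite dotHZr.
  have s1 m : smooth (fun x => cometric_mx x i m * dot x a (contr (s m) b)).
    by apply: smoothM; [exact: cometric_mx_smooth|have [] := IH (contr (s m) b)].
  rewrite E; split; first by apply: smooth_sum => m _; exact: s1.
  move=> k x; rewrite pd_sum => [|m _]; last exact: s1.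
  rewrite (mx_derivation_emul _ slr erefl) /dot dotHBl -/(dot x) dot_emul//
    /iota_up.
  rewrite [in RHS]/dot dotH_sumr dotH_suml.
  transitivity (\sum_m (dcometric_mx k x i m * dot x a (contr (s m) b) +
     cometric_mx x i m * dot x (mx_derivation (conn k x) a) (contr (s m) b))).
    apply: eq_bigr => m _; have [sm pm] := IH (contr (s m) b).
    by rewrite pdM; [rewrite pm dcometric_mx_entry|
      exact: cometric_mx_smooth|exact: sm].
  rewrite big_split /= addrC; congr (_ + _).
    by apply: eq_bigr => m _; rewrite /dot dotHZr.
  rewrite -sumrN.
  transitivity (\sum_m \sum_j - (conn k x i j * cometric_mx x j m * dot x a
    (contr (s m) b))).
    apply: eq_bigr => m _; rewrite dcometric_mxE mxE mxE -sumrN mulr_suml.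
    by apply: eq_bigr => j _; rewrite mulNr.
  rewrite exchange_big; apply: eq_bigr => j _ /=.
  rewrite dotHZl -/(dot x) dot_emul// /iota_up /dot dotH_sumr mulr_sumr -sumrN.
  by apply: eq_bigr => m _; rewrite dotHZr mulrA.
Qed.

Lemma dot_smooth_pd u v : smooth_form u -> smooth_form v ->
  smooth (fun x => dot x (u x) (v x)) /\
  forall k x, pd k (fun x => dot x (u x) (v x)) x =
    dot x (partial k u x) (v x) + dot x (u x) (partial k v x) +
    dot x (mx_derivation (conn k x) (u x)) (v x).
Proof.
move=> su sv.
have half b : smooth (fun x => dot x (u x) b) /\
  forall k x, pd k (fun x => dot x (u x) b) x =
    dot x (partial k u x) b + dot x (mx_derivation (conn k x) (u x)) b.
  have E : (fun x => dot x (u x) b) = (fun x => \sum_S u x S * dot x (mono R S) b).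
    apply/funext => x; rewrite [in LHS](ext_mono (u x)) /dot dotH_suml.
    by apply: eq_bigr => S _; rewrite dotHZl.
  have s1 S : smooth (fun x => u x S * dot x (mono R S) b).
    by apply: smoothM; [exact: su|have [] := dot_cst_smooth_pd (mono R S) b].
  rewrite E; split; first by apply: smooth_sum => S _; exact: s1.
  move=> k x; rewrite pd_sum => [|S _]; last exact: s1.
  rewrite [in RHS](ext_mono (partial k u x)) [in RHS](ext_mono (u x)).
  have -> : mx_derivation (conn k x) (\sum_S u x S *: mono R S) =
    \sum_S u x S *: mx_derivation (conn k x) (mono R S).
    elim/big_rec2: _ => [|S y z _ <-]; last by rewrite mx_derivationP.
    have := mx_derivationP (conn k x) (-1) 0 0.
    by rewrite scaler0 addr0 scaleN1r addNr.
  rewrite /dot !dotH_suml -big_split; apply: eq_bigr => S _ /=.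
  have [sS pS] := dot_cst_smooth_pd (mono R S) b.
  by rewrite pdM; [rewrite pS !dotHZl partialE|exact: su|exact: sS].
have E : (fun x => dot x (u x) (v x)) = (fun x =>
  \sum_S v x S * dot x (u x) (mono R S)).
  apply/funext => x; rewrite [in LHS](ext_mono (v x)) /dot dotH_sumr.
  by apply: eq_bigr => S _; rewrite dotHZr.
have s1 S : smooth (fun x => v x S * dot x (u x) (mono R S)).
  by apply: smoothM; [exact: sv|have [] := half (mono R S)].
rewrite E; split; first by apply: smooth_sum => S _; exact: s1.
move=> k x; rewrite pd_sum => [|S _]; last exact: s1.
rewrite [in RHS](ext_mono (partial k v x)) [in RHS](ext_mono (v x)).
rewrite /dot !dotH_sumr -!big_split; apply: eq_bigr => S _ /=.
have [sS pS] := half (mono R S).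
rewrite pdM; [rewrite pS !dotHZr partialE|exact: sv|exact: sS].
rewrite /dot; ring.
Qed.

Lemma mx_derivation_selfadjoint k x a b :
  dot x (mx_derivation (conn k x) a) b = dot x a (mx_derivation (conn k x) b).
Proof.
have [_ <-] := dot_cst_smooth_pd a b; rewrite dotC.
have [_ <-] := dot_cst_smooth_pd b a.
by congr (pd k _ x); apply/funext => y; rewrite dotC.
Qed.

Lemma omega_nE x : omega_n omega x = (n`!%:R)^-1 *: lefn (metric_mx x) n.
Proof.
rewrite /omega_n /lefn (_ : wedge (omega x) = lef (metric_mx x))//.
by apply/funext => a; exact: wedge_omega.
Qed.

(** The derivative of a power, since (1,1)-vectors commute. *)
Lemma lefn_smooth_partial m : smooth_form (fun x => lefn (metric_mx x) m) /\
  forall k x, partial k (fun x => lefn (metric_mx x) m) x =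
    m%:R *: lef (dmetric_mx k x) (lefn (metric_mx x) m.-1).
Proof.
elim: m => [|m [sm pm]].
  split; first exact: smooth_form_cst.
  by move=> k x; rewrite (partial_cst k (ext1 R n)) scale0r.
have sm1 : smooth_form (fun x => lef (metric_mx x) (lefn (metric_mx x) m)).
  by apply: smooth_form_lef => //; exact: metric_mx_smooth.
split=> // k x; rewrite (partial_lef k x metric_mx_smooth sm) pm lefZ lefC.
rewrite -/(dmetric_mx k x); case: m {sm pm sm1} => [|m] /=.
  by rewrite scale0r addr0 scale1r.
by rewrite -lefnS -[X in X + _]scale1r -scalerDl nat1r.
Qed.

(** The density of omega^n / n! with respect to Lebesgue measure. *)
Definition density x : R :=
  omega_n omega x [set: 'I_(n + n)]%SET / volume R n [set: 'I_(n + n)]%SET.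

Definition weight x : R := expR (- phi x) * density x.

(** The derivative of omega^n / n! is d_k(omega) /\ omega^(n-1) / (n-1)!, a top
degree element to which [lef_lefn_top] applies. *)
Lemma density_smooth_pd : smooth density /\
  forall k x, pd k density x = \tr (conn k x) * density x.
Proof.
pose c : R := (n`!%:R)^-1 / volume R n [set: 'I_(n + n)]%SET.
have E : density = (fun x => c * lefn (metric_mx x) n [set: 'I_(n + n)]%SET).
  by apply/funext => x; rewrite /density omega_nE extZ mulrAC.
have [sn pn] := lefn_smooth_partial n.
rewrite E; split; first by apply: smoothM; [exact: smooth_cst|exact: sn].
move=> k x; rewrite pdZ; last exact: sn.
rewrite -partialE pn mulrCA; congr (_ * _).
have n0 : (0 < n)%N by exact: leq_ltn_trans (ltn_ord k).
rewrite (lef_lefn_top _ (metric_mx_unit x)); last by rewrite prednK.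
by rewrite extZ.
Qed.

Lemma density_neq0 x : density x != 0.
Proof.
rewrite /density mulf_neq0 ?invr_eq0 ?volume_neq0// omega_nE extZ.
by rewrite mulf_neq0 ?invr_eq0 ?pnatr_eq0 -?lt0n ?fact_gt0// lefn_volume_neq0//
  metric_mx_unit.
Qed.

Lemma weight_neq0 x : weight x != 0.
Proof. by rewrite mulf_neq0 ?density_neq0// gt_eqF// expR_gt0. Qed.

Lemma weight_smooth : smooth weight.
Proof.
apply: smoothM; last exact: (proj1 density_smooth_pd).
exact/smooth_expR/smoothN.
Qed.

Lemma pd_weight k x : pd k weight x = (\tr (conn k x) - pd k phi x) * weight x.
Proof.
have [sd pd_d] := density_smooth_pd.
have se : smooth (fun x => expR (- phi x)) by exact/smooth_expR/smoothN.
rewrite /weight pdM// pd_d pd_expR; last exact: smoothN.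
by rewrite pdN//; ring.
Qed.

Lemma L2dotE u v : L2dot omega phi u v =
  integral_rV (fun x => dot x (u x) (v x) * weight x).
Proof.
rewrite /L2dot /form_integral; congr integral_rV; apply/funext => x.
by rewrite extZ form_dot_omega /weight /density; ring.
Qed.

Lemma pd_near0 (f : 'rV[R]_n -> R) (M : R) k x :
    (forall y : 'rV[R]_n, (exists i, M < `|y 0 i|) -> f y = 0) ->
  (exists i, M < `|x 0 i|) -> pd k f x = 0.
Proof.
move=> f0 [i Mx]; rewrite -(pd_cst k 0 x); apply: near_eq_derive.
have cn : continuous (fun y : 'rV[R]_n => `|y 0 i|).
  move=> y; apply: continuous_comp; first exact: coord_continuous.
  exact: norm_continuous.
have nM : nbhs x (fun t : 'rV[R]_n => M < `|t 0 i|).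
  exact: (cvgr_gt _ (cn x) _ Mx).
by apply: filterS nM => y My; apply: f0; exists i.
Qed.

(** Bounded support in terms of coordinates, which is stable under differentiation
and easy to restrict to slices. *)
Definition bsupp u := exists M : R, forall x : 'rV[R]_n,
  (exists i, M < `|x 0 i|) -> u x = 0.

Lemma compactly_supportedP u : compactly_supported u <-> bsupp u.
Proof.
split=> [cu|[M uM]].
  have [M [_ MP]] := compact_bounded cu.
  exists (M + 1) => x [i xM]; apply/eqP; apply: contraT => ux.
  have : `|x| <= M + 1 by apply: MP; [rewrite ltrDl|exact: subset_closure].
  rewrite leNgt => /negP; case; apply: lt_le_trans xM _.
  by rewrite [leRHS]/Num.norm /= mx_normrE; apply/bigmax_geP; right; exists (0, i).
have cK : compact [set v : 'rV[R]_n | forall i, v ord0 i \in `[- M, M]%R]%classic.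
  apply: (@rV_compact _  _ (fun=> `[- M, M]%classic)).
  by move=> _; apply: segment_compact.
have clK := compact_closed (@norm_hausdorff _ _) cK.
apply: (subclosed_compact _ cK); first exact: closed_closure.
rewrite closureE => x; apply; split => // y /= uy i.
rewrite in_itv /= -ler_norml leNgt; apply/negP => My.
by move/eqP: uy; apply; apply: uM; exists i.
Qed.

Definition smooth_bsupp u := smooth_form u /\ bsupp u.

Lemma test_formP u : test_form u <-> smooth_bsupp u.
Proof. by rewrite /test_form /smooth_bsupp /= compactly_supportedP. Qed.

(** Supports do not grow under first order differential operators. *)
Lemma bsupp_jet u v : smooth_form u ->
  (forall x, u x = 0 -> (forall k, partial k u x = 0) -> v x = 0) ->
  bsupp u -> bsupp v.
Proof.
move=> su uv [M uM]; exists M => x Mx; apply: uv; first exact: uM.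
move=> k; apply/ffunP => S; rewrite partialE ffunE.
by apply: (pd_near0 (M := M)) => // y My; rewrite uM// ffunE.
Qed.

Lemma smooth_cont_bsupp (f : 'rV[R]_n -> R) u : smooth f -> bsupp u ->
  (forall x, u x = 0 -> f x = 0) -> cont_bsupp f /\ forall k, cont_bsupp (pd k f).
Proof.
move=> sf [M uM] uf; split=> [|k]; split; [exact: smooth_continuous| |
  exact/smooth_continuous/smooth_pd|].
  by exists M => x Mx; exact/uf/uM.
by exists M => x Mx; apply: (pd_near0 (M := M)) => // y My; exact/uf/uM.
Qed.

Lemma dotW_smooth u v : smooth_form u -> smooth_form v ->
  smooth (fun x => dot x (u x) (v x) * weight x).
Proof.
move=> su sv; apply: smoothM; last exact: weight_smooth.
exact: (proj1 (dot_smooth_pd su sv)).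
Qed.

Lemma dotW_cont_bsupp u v : smooth_form u -> smooth_bsupp v ->
  cont_bsupp (fun x => dot x (u x) (v x) * weight x).
Proof.
move=> su [sv bv]; apply: (proj1 (smooth_cont_bsupp (dotW_smooth su sv) bv _)) =>
  x vx.
by rewrite vx /dot dotH0r mul0r.
Qed.

(** Test against the form times the weight: the integrand is then the square of the
weight times a positive definite norm, so that the sign of the density does not
matter. *)
Lemma L2dot_nondegenerate w : smooth_bsupp w ->
  (forall u, smooth_bsupp u -> L2dot omega phi u w = 0) -> forall x, w x = 0.
Proof.
move=> [sw bw] w0 x.
pose u y := weight y *: w y.
have tu : smooth_bsupp u.
  split; first exact/smooth_form_scale/sw/weight_smooth.
  by apply: bsupp_jet bw => // y wy _; rewrite /u wy scaler0.
have := w0 u tu; rewrite L2dotE => /integral_rV_ge0_eq0 h.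
have [//|wx0] := eqVneq (w x) 0.
have pos y a : a != 0 -> 0 < dot y a a.
  have [E' EE] := posdef_inv_ortho (metric_mx_pos y).
  by apply: (dotH_gt0 (diag2_sym (cometric_mx_tr y)) (diag2_ortho EE)).
(* [u] is the weight times [w]. *)
have h1 : forall y, dot y (u y) (w y) * weight y =
  weight y ^+ 2 * dot y (w y) (w y).
  by move=> y; rewrite /u /dot dotHZl; ring.
have := h (dotW_cont_bsupp (proj1 tu) (conj sw bw)).
have ge0 y : 0 <= dot y (u y) (w y) * weight y.
  rewrite h1 mulr_ge0 ?sqr_ge0//; have [->|/pos/ltW//] := eqVneq (w y) 0.
  by rewrite /dot dotH0r.
move=> /(_ ge0 x) /eqP; rewrite h1 mulf_eq0 sqrf_eq0 (negbTE (weight_neq0 x))/=.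
by rewrite gt_eqF// pos.
Qed.

(** Definiteness makes the adjoint unique, so that it equals any test form with the
adjunction property. *)
Lemma adjointE (T : superform R n -> superform R n) v w : smooth_bsupp w ->
    (forall u, smooth_bsupp u -> L2dot omega phi (T u) v = L2dot omega phi u w) ->
  adjoint (@test_form R n) (L2dot omega phi) T v = w.
Proof.
move=> tw Tw; apply: xget_unique; first by split=> [|u /test_formP tu];
  [exact/test_formP|exact: Tw].
move=> w' [/test_formP tw' Tw']; apply/funext => x; apply/eqP;
  rewrite -subr_eq0; apply/eqP.
have [[sw bw] [sw' bw']] := (tw, tw').
have td : smooth_bsupp (fun x => w' x - w x).
  split; first exact: smooth_form_sub.
  have [M wM] := bw; have [M' wM'] := bw'; exists (Num.max M M') => y [i].
  by rewrite gt_max => /andP[My My']; rewrite wM ?wM' ?subr0//; exists i.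
apply: (L2dot_nondegenerate td) => u tu.
have : L2dot omega phi u w' = L2dot omega phi u w.
  by rewrite -Tw// -Tw'//; exact/test_formP.
move=> /eqP; rewrite -subr_eq0 !L2dotE => /eqP <-.
rewrite /integral_rV -RintegralB//.
- apply: eq_Rintegral => t _; by rewrite /dot dotHBr mulrBl.
- exact: (integrable_cont_bsupp (dotW_cont_bsupp (proj1 tu) tw')).
- exact: (integrable_cont_bsupp (dotW_cont_bsupp (proj1 tu) tw)).
Qed.

Lemma LambdaE u x : Lambda omega u x = dlef (cometric_mx x) (u x).
Proof.
apply: xget_unique.
  split=> // a _; rewrite form_dot_omega wedge_omega.
  exact: dotH_lef (metric_mx_unit x) erefl (cometric_mx_tr x).
move=> b [_ ab]; apply/eqP; rewrite -subr_eq0; apply: contraT => d0.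
have [E EE] := posdef_inv_ortho (metric_mx_pos x).
have := dotH_gt0 (diag2_sym (cometric_mx_tr x)) (diag2_ortho EE) d0.
rewrite dotHBr subr_gt0 -/(dot x) => /lt_eqF/eqP; case.
rewrite -form_dot_omega -ab// form_dot_omega wedge_omega.
by rewrite [RHS](dotH_lef _ _ (metric_mx_unit x) erefl (cometric_mx_tr x)).
Qed.

(** The formal adjoint of the sum over k of emul(s k) d_k, read off from integration
by parts: the derivatives fall on the form, on the inner product and on the
weight. *)
Definition codiff (s : 'I_n -> 'I_(n + n)) v x : ext R n :=
  - \sum_k (partial k (fun y => iota_up (cometric_mx y) s k (v y)) x +
            mx_derivation (conn k x) (iota_up (cometric_mx x) s k (v x)) +
            (\tr (conn k x) - pd k phi x) *: iota_up (cometric_mx x) s k (v x)).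

(** The difference of the two integrands is the divergence of the inner products of
u with the metric contractions of v, times the weight. *)
Lemma L2dot_codiff s u v w : (s = l \/ s = r) -> smooth_bsupp u ->
  smooth_bsupp v -> smooth_bsupp w ->
    (forall x, w x = codiff s v x) ->
  L2dot omega phi (fun x => \sum_k emul (s k) (partial k u x)) v =
    L2dot omega phi u w.
Proof.
move=> slr [su bu] tv tw wE; rewrite !L2dotE.
have [sv bv] := tv.
pose F k x := dot x (u x) (iota_up (cometric_mx x) s k (v x)) * weight x.
have sF k : smooth (F k) by apply: dotW_smooth => //; exact: smooth_form_iota.
have F0 k x : u x = 0 -> F k x = 0 by move=> ux; rewrite /F ux /dot dotH0l mul0r.
have FM k := smooth_cont_bsupp (sF k) bu (F0 k).
apply: (integral_rV_divergence (F := F)).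
- apply: dotW_cont_bsupp => //; apply: smooth_form_sum => k _.
  by apply: (smooth_form_lin (emul _)); exact: smooth_form_partial.
- exact: dotW_cont_bsupp.
- by move=> k; exact: (proj1 (FM k)).
- by move=> k; exact: (proj2 (FM k)).
- by move=> k x; exact: smooth_derivable.
move=> x; rewrite wE /codiff.
have pF k : pd k (F k) x =
  (dot x (partial k u x) (iota_up (cometric_mx x) s k (v x)) +
    dot x (u x) (partial k (fun y => iota_up (cometric_mx y) s k (v y)) x +
            mx_derivation (conn k x) (iota_up (cometric_mx x) s k (v x)) +
            (\tr (conn k x) - pd k phi x) *: iota_up (cometric_mx x) s k (v x)))
              * weight x.
  have siv := smooth_form_iota s k sv.
  have [sd pdd] := dot_smooth_pd su siv.
  rewrite /F pdM//; last exact: weight_smooth.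
  rewrite pdd pd_weight mx_derivation_selfadjoint /dot !dotHDr dotHZr; ring.
under [X in _ = _ + X]eq_bigr do rewrite pF.
rewrite -mulr_suml -mulrDl; congr (_ * _).
rewrite /dot dotHNr dotH_sumr big_split /= addrCA addNr addr0 dotH_suml.
by apply: eq_bigr => k _; exact: dot_emul.
Qed.

(** The operator [d#_phi] with the exponentials cancelled. *)
Definition dsharp_formula u x : ext R n :=
  \sum_k emul (r k) (partial k u x - pd k phi x *: u x).
(** The pointwise adjoint of [omega /\ _] in coordinates. *)
Definition Lambda_formula u x : ext R n := dlef (cometric_mx x) (u x).

Lemma smooth_form_dsharp_formula u : smooth_form u ->
  smooth_form (dsharp_formula u).
Proof.
move=> su; apply: smooth_form_sum => k _; apply: (smooth_form_lin (emul _)).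
apply: smooth_form_sub; first exact: smooth_form_partial.
by apply: smooth_form_scale => //; exact: smooth_pd.
Qed.

Lemma smooth_form_dform u : smooth_form u -> smooth_form (dform u).
Proof. by move=> su; apply: smooth_form_sum => k _;
  apply: (smooth_form_lin (emul _)); exact: smooth_form_partial. Qed.

Lemma smooth_form_Lambda_formula u : smooth_form u ->
  smooth_form (Lambda_formula u).
Proof. exact: smooth_form_dlef. Qed.

Lemma smooth_bsupp_dsharp_formula u : smooth_bsupp u ->
  smooth_bsupp (dsharp_formula u).
Proof.
move=> [su bu]; split; first exact: smooth_form_dsharp_formula.
apply: bsupp_jet bu => // x ux dux; rewrite /dsharp_formula big1// => k _.
by rewrite ux dux scaler0 subr0 emul0.
Qed.

Lemma smooth_bsupp_dform u : smooth_bsupp u -> smooth_bsupp (dform u).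
Proof.
move=> [su bu]; split; first exact: smooth_form_dform.
apply: bsupp_jet bu => // x ux dux; rewrite /dform big1// => k _.
by rewrite dux wedge0r.
Qed.

Lemma smooth_bsupp_Lambda_formula u : smooth_bsupp u ->
  smooth_bsupp (Lambda_formula u).
Proof.
move=> [su bu]; split; first exact: smooth_form_Lambda_formula.
by apply: bsupp_jet bu => // x ux _; rewrite /Lambda_formula ux dlef0.
Qed.

Lemma smooth_bsupp_add u v : smooth_bsupp u -> smooth_bsupp v ->
  smooth_bsupp (fun x => u x + v x).
Proof.
move=> [su [M uM]] [sv [N vN]]; split; first exact: smooth_form_add.
exists (Num.max M N) => x [i]; rewrite gt_max => /andP[Mx Nx].
by rewrite uM ?vN ?addr0//; exists i.
Qed.

Lemma smooth_bsupp_opp u : smooth_bsupp u -> smooth_bsupp (fun x => - u x).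
Proof.
by move=> [su [M uM]]; split; [exact: smooth_form_opp|exists M => x /uM ->;
  rewrite oppr0].
Qed.

Lemma smooth_bsupp_sub u v : smooth_bsupp u -> smooth_bsupp v ->
  smooth_bsupp (fun x => u x - v x).
Proof. by move=> tu tv; apply: smooth_bsupp_add => //; exact: smooth_bsupp_opp. Qed.

Lemma dsharp_phiE u : smooth_form u -> dsharp_phi phi u = dsharp_formula u.
Proof.
move=> su; apply/funext => x;
  rewrite /dsharp_phi /dsharp /dsharp_formula scaler_sumr.
have se : smooth (fun x => expR (- phi x)) by exact/smooth_expR/smoothN.
apply: eq_bigr => k _; rewrite -/(emul _ _) -emulZ; congr emul.
rewrite partialZ// pd_expR; last exact: smoothN.
rewrite pdN// -[X in X + _]scalerA -scalerDr scalerA expRxMexpNx_1 scale1r.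
by rewrite scaleNr addrC.
Qed.

(** Commutators with the adjoint of the Lefschetz operator turn multiplications into
metric contractions; here they account for the terms of the Kahler identities
that contain derivatives of the form. *)
Lemma dlef_emul_r x k a :
  dlef (cometric_mx x) (emul (r k) a) =
    emul (r k) (dlef (cometric_mx x) a) - iota_up (cometric_mx x) l k a.
Proof.
have -> : iota_up (cometric_mx x) l k a =
    \sum_i \sum_j (cometric_mx x i j * (r j == r k)%:R) *: contr (l i) a.
  rewrite /iota_up; apply: eq_bigr => i _;
    rewrite (bigD1 k)//= [X in _ + X]big1 ?addr0 => [|j jk].
    by rewrite eqxx mulr1 cometric_mx_sym.
  by rewrite eq_rshift (negbTE jk) mulr0 scale0r.
rewrite /dlef emul_sum -sumrB; apply: eq_bigr => i _.
rewrite emul_sum -sumrB; apply: eq_bigr => j _.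
rewrite contr_emul eq_lrshift scale0r sub0r contrN contr_emul emulZ.
by rewrite opprB scalerBr scalerA.
Qed.

Lemma dlef_emul_l x k a :
  dlef (cometric_mx x) (emul (l k) a) = emul (l k) (dlef (cometric_mx x) a) +
    iota_up (cometric_mx x) r k a.
Proof.
have -> : iota_up (cometric_mx x) r k a =
    \sum_i \sum_j (cometric_mx x i j * (l i == l k)%:R) *: contr (r j) a.
  rewrite [RHS](bigD1 k)//= [X in _ + X]big1 ?addr0 => [|i ik].
    by apply: eq_bigr => j _; rewrite eqxx mulr1.
  by rewrite big1// => j _; rewrite eq_lshift (negbTE ik) mulr0 scale0r.
rewrite /dlef emul_sum -big_split; apply: eq_bigr => i _ /=.
rewrite emul_sum -big_split; apply: eq_bigr => j _ /=.
rewrite contr_emul contrB contrZ contr_emul eq_rlshift scale0r sub0r opprK emulZ.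
by rewrite scalerDr scalerA addrC.
Qed.

(** The terms of order zero rewritten by [kahler_core], which applies since omega is
closed. *)
Lemma codiffE s t v x : (s = l /\ t = r) \/ (s = r /\ t = l) -> smooth_form v ->
  codiff s v x = - \sum_k (iota_up (cometric_mx x) s k (partial k v x) +
    \sum_i \sum_m dcometric_mx k x i m *: emul (t k) (contr (t i) (contr (s m) (v
      x)))) +
    \sum_k pd k phi x *: iota_up (cometric_mx x) s k (v x).
Proof.
move=> st sv.
have /= core := kahler_core (cometric_mx_tr x) (fun k => dmetric_mx_tr k x)
  (fun i j k => dmetric_mx_closed x i j k) (v x) st.
rewrite big_split /=.
under [X in - (_ + X)]eq_bigr do under eq_bigr do under eq_bigr do rewrite
  dcometric_mxE.
rewrite -core -[X in _ + X]opprK -opprD -sumrN -!big_split /codiff; congr (- _).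
apply: eq_bigr => k _ /=.
have -> : \sum_(m < n) (- (cometric_mx x *m dmetric_mx k x *m cometric_mx x)) k m
  *: contr (s m) (v x) =
    iota_up (dcometric_mx k x) s k (v x) by rewrite -dcometric_mxE.
by rewrite partial_iota// scalerBl /conn [X in X + _ + _]addrC -!addrA.
Qed.

(** The Kahler identity d^* = [Lambda, d#_phi]. *)
Lemma kahler_d v x : smooth_form v ->
  codiff l v x = Lambda_formula (dsharp_formula v) x - dsharp_formula
  (Lambda_formula v) x.
Proof.
move=> sv; rewrite (codiffE _ (or_introl (conj erefl erefl)) sv).
rewrite /Lambda_formula {1}/dsharp_formula dlef_sum /dsharp_formula -sumrB -sumrN
  -big_split; apply: eq_bigr => k _ /=.
rewrite dlef_emul_r partial_dlef// dlefB dlefZ iota_upB iota_upZ.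
have -> : \sum_i \sum_m dcometric_mx k x i m *: emul (r k) (contr (r i) (contr (l
  m) (v x))) =
    emul (r k) (dlef (dcometric_mx k x) (v x)).
  rewrite /dlef emul_sum exchange_big; apply: eq_bigr => m _ /=.
  rewrite emul_sum; apply: eq_bigr => i _; rewrite emulZ; congr (_ *: _).
  by rewrite !dcometric_mx_entry; congr (pd k _ x); apply/funext => y;
    exact: cometric_mx_sym.
rewrite !emulB !emulD emulZ -[X in _ - X]addrA.
by rewrite sub_sub_cancel opprB addrC opprD addrA.
Qed.

(** The Kahler identity (d#_phi)^* = [d, Lambda]. The sum
subtracted on the left comes from the zero order term of d#_phi. *)
Lemma kahler_dsharp v x : smooth_form v ->
  codiff r v x - \sum_k pd k phi x *: iota_up (cometric_mx x) r k (v x) =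
  dform (Lambda_formula v) x - Lambda_formula (dform v) x.
Proof.
move=> sv; rewrite (codiffE _ (or_intror (conj erefl erefl)) sv) addrK.
rewrite /Lambda_formula {2}/dform dlef_sum /dform -sumrB -sumrN;
  apply: eq_bigr => k _ /=.
rewrite -!/(emul _ _) dlef_emul_l partial_dlef// emulD.
have -> : \sum_i \sum_m dcometric_mx k x i m *: emul (l k) (contr (l i) (contr (r
  m) (v x))) =
    - emul (l k) (dlef (dcometric_mx k x) (v x)).
  rewrite /dlef emul_sum -sumrN; apply: eq_bigr => i _.
  rewrite emul_sum -sumrN; apply: eq_bigr => m _.
  by rewrite emulZ contrC emulN scalerN.
by rewrite opprD opprK opprD addrA addrK addrC.
Qed.

Lemma dstarE v : smooth_bsupp v ->
  dstar omega phi v = (fun x =>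
  Lambda_formula (dsharp_formula v) x - dsharp_formula (Lambda_formula v) x).
Proof.
move=> tv; have tw : smooth_bsupp (fun x =>
  Lambda_formula (dsharp_formula v) x - dsharp_formula (Lambda_formula v) x).
  by apply: smooth_bsupp_sub;
    [exact/smooth_bsupp_Lambda_formula/smooth_bsupp_dsharp_formula|
    exact/smooth_bsupp_dsharp_formula/smooth_bsupp_Lambda_formula].
apply: adjointE => // u tu.
apply: (L2dot_codiff (s := l)) => //; first by left.
by move=> x; rewrite kahler_d//; exact: (proj1 tv).
Qed.

Lemma L2dot_sub u1 u2 u3 v1 v2 v3 : smooth_form u2 -> smooth_form u3 ->
    smooth_bsupp v2 -> smooth_bsupp v3 ->
    (forall x, dot x (u1 x) (v1 x) = dot x (u2 x) (v2 x) - dot x (u3 x) (v3 x)) ->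
  L2dot omega phi u1 v1 = L2dot omega phi u2 v2 - L2dot omega phi u3 v3.
Proof.
move=> s2 s3 t2 t3 E; rewrite !L2dotE /integral_rV -RintegralB//.
- by apply: eq_Rintegral => t _; rewrite E mulrBl.
- exact: (integrable_cont_bsupp (dotW_cont_bsupp s2 t2)).
- exact: (integrable_cont_bsupp (dotW_cont_bsupp s3 t3)).
Qed.

Lemma dsharp_phi_starE v : smooth_bsupp v ->
  dsharp_phi_star omega phi v = (fun x =>
    dform (Lambda_formula v) x - Lambda_formula (dform v) x).
Proof.
move=> tv; have [sv bv] := tv.
pose w x := dform (Lambda_formula v) x - Lambda_formula (dform v) x.
have tw : smooth_bsupp w.
  by apply: smooth_bsupp_sub;
    [exact/smooth_bsupp_dform/smooth_bsupp_Lambda_formula|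
    exact/smooth_bsupp_Lambda_formula/smooth_bsupp_dform].
pose psi x := \sum_k pd k phi x *: iota_up (cometric_mx x) r k (v x).
have tpsi : smooth_bsupp psi.
  split; first by apply: smooth_form_sum => k _; apply: smooth_form_scale;
    [exact: smooth_pd|exact: smooth_form_iota].
  by apply: bsupp_jet bv => // x vx _; rewrite /psi big1// => k _;
    rewrite vx iota_up0 scaler0.
apply: adjointE => // u tu; have [su bu] := tu.
rewrite dsharp_phiE//.
pose du x := \sum_k emul (r k) (partial k u x).
have sdu : smooth_form du.
  by apply: smooth_form_sum => k _; apply: (smooth_form_lin (emul _));
    exact: smooth_form_partial.
transitivity (L2dot omega phi du v - L2dot omega phi u psi).
  apply: L2dot_sub => // x;
    rewrite /dsharp_formula /du /psi /dot dotH_suml dotH_suml dotH_sumr -sumrB.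
  apply: eq_bigr => k _; rewrite emulB emulZ dotHBl dotHZl dotHZr;
    congr (_ - _ * _).
  by apply: dot_emul; right.
have -> : L2dot omega phi du v = L2dot omega phi u (fun x => w x + psi x).
  apply: (L2dot_codiff (s := r)) => //; first by right.
    exact: smooth_bsupp_add.
  by move=> x; rewrite /w -kahler_dsharp// subrK.
apply/esym; apply: L2dot_sub => //; first exact: smooth_bsupp_add.
by move=> x; rewrite /dot -dotHBr addrK.
Qed.

Lemma dformB u v x : smooth_form u -> smooth_form v ->
  dform (fun x => u x - v x) x = dform u x - dform v x.
Proof.
move=> su sv; rewrite /dform -sumrB; apply: eq_bigr => k _.
by rewrite partialB// wedgeBr.
Qed.

Lemma dsharp_formulaB u v x : smooth_form u -> smooth_form v ->
  dsharp_formula (fun x => u x - v x) x = dsharp_formula u x - dsharp_formula v x.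
Proof.
move=> su sv; rewrite /dsharp_formula -sumrB; apply: eq_bigr => k _.
rewrite partialB// -emulB; congr emul.
by rewrite scalerBr !opprD addrACA.
Qed.

Lemma dform_dsharp_phi a x :
  wedge (dform (dsharp (zero_form phi)) x) a =
  \sum_i \sum_j pd i (pd j phi) x *: emul (l i) (emul (r j) a).
Proof.
have E : dsharp (zero_form phi) =
    (fun y => \sum_j pd j phi y *: emul (r j) (ext1 R n)).
  apply/funext => y; rewrite /dsharp; apply: eq_bigr => j _.
  rewrite -/(emul _ _) partialZ//; last exact: smooth_form_cst.
  by rewrite partial_cst scaler0 addr0 emulZ.
rewrite E /dform wedge_suml; apply: eq_bigr => i _.
have s1 j : smooth_form (fun y => pd j phi y *: emul (r j) (ext1 R n)).
  by apply: smooth_form_scale; [exact: smooth_pd|exact: smooth_form_cst].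
rewrite -/(emul _ _) partial_sum => [|j _]; last exact: s1.
rewrite emul_sum wedge_suml; apply: eq_bigr => j _.
rewrite partialZ; [|exact: smooth_pd|exact: smooth_form_cst].
by rewrite partial_cst scaler0 addr0 emulZ wedgeZl !wedge_emul wedge1l.
Qed.

(** The second derivatives cancel by symmetry, the first derivatives of the form
cancel by anticommutation, and only the second derivatives of phi are left. *)
Lemma anticommutator u x : smooth_form u ->
  dform (dsharp_formula u) x + dsharp_formula (dform u) x =
    - wedge (dform (dsharp (zero_form phi)) x) (u x).
Proof.
move=> su; rewrite dform_dsharp_phi -sumrN.
have sd j : smooth_form (partial j u) by exact: smooth_form_partial.
have sp j : smooth_form (fun x => pd j phi x *: u x).
  by apply: smooth_form_scale => //; exact: smooth_pd.
have s1 j : smooth_form (fun x =>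
  partial j u x - pd j phi x *: u x) by exact: smooth_form_sub.
transitivity (\sum_i \sum_j (emul (l i) (emul (r j)
    (partial i (partial j u) x - (pd i (pd j phi) x *: u x +
      pd j phi x *: partial i u x)))
  + emul (r j) (emul (l i) (partial j (partial i u) x - pd j phi x *: partial i u
      x)))).
  under [RHS]eq_bigr do rewrite big_split.
  rewrite big_split; congr (_ + _).
    apply: eq_bigr => i _;
      rewrite -/(emul _ _) /dsharp_formula partial_sum => [|j _]; last first.
      by apply: (smooth_form_lin (emul _)).
    rewrite emul_sum; apply: eq_bigr => j _.
    rewrite (partial_lin (emul (r j)) i x (s1 j)) partialB// partialZ//.
    exact: smooth_pd.
  rewrite exchange_big; apply: eq_bigr => j _ /=.
  rewrite -emul_sum; congr emul.
  have sl i : smooth_form (fun x =>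
    emul (l i) (partial i u x)) by exact: (smooth_form_lin (emul _)).
  rewrite /dform partial_sum => [|i _]; last exact: sl.
  rewrite scaler_sumr -sumrB; apply: eq_bigr => i _.
  by rewrite (partial_lin (emul (l i)) j x (sd i)) emulB emulZ.
apply: eq_bigr => i _; rewrite -sumrN; apply: eq_bigr => j _.
rewrite (emulC (r j)) -emulN -emulD -emulN -emulD partialC// opprB opprD addrA
  addrA.
rewrite [X in emul _ (emul _ X)](_ : _ = - (pd i (pd j phi) x *: u x)).
  by rewrite !emulN emulZ emulZ.
by rewrite subrK addrAC subrr add0r.
Qed.

Lemma ddsharp_commE u x : ddsharp_comm omega phi u x =
  wedge (dform (dsharp (zero_form phi)) x) (Lambda_formula u x) -
  Lambda_formula (fun y => wedge (dform (dsharp (zero_form phi)) y) (u y)) x.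
Proof. by rewrite /ddsharp_comm !LambdaE. Qed.

(** Jacobi identity for [Lambda], [d] and [d#_phi]: after both adjoints are replaced
by commutators, the mixed terms cancel and the anticommutator of [d] and
[d#_phi] is left, commuted with [Lambda]. *)
Lemma Box_Box_sharp alpha x : smooth_bsupp alpha ->
  Box omega phi alpha x = Box_sharp omega phi alpha x +
    ddsharp_comm omega phi alpha x.
Proof.
move=> ta; have [sa ba] := ta.
rewrite /Box /Box_sharp (dsharp_phiE sa).
rewrite (dstarE ta) (dstarE (smooth_bsupp_dform ta)).
rewrite (dsharp_phi_starE ta) (dsharp_phi_starE (smooth_bsupp_dsharp_formula ta)).
rewrite dsharp_phiE; last first.
  by apply: smooth_form_sub;
    [exact/smooth_form_dform/smooth_form_Lambda_formula|
    exact/smooth_form_Lambda_formula/smooth_form_dform].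
rewrite dformB; [|exact/smooth_form_Lambda_formula/smooth_form_dsharp_formula|
  exact/smooth_form_dsharp_formula/smooth_form_Lambda_formula].
rewrite dsharp_formulaB; [|
  exact/smooth_form_dform/smooth_form_Lambda_formula|
  exact/smooth_form_Lambda_formula/smooth_form_dform].
have A1 := anticommutator x (smooth_form_Lambda_formula sa).
have A2 := anticommutator x sa.
have -> : ddsharp_comm omega phi alpha x =
    - (dform (dsharp_formula (Lambda_formula alpha)) x +
        dsharp_formula (dform (Lambda_formula alpha)) x) +
    (Lambda_formula (dform (dsharp_formula alpha)) x +
      Lambda_formula (dsharp_formula (dform alpha)) x).
  rewrite ddsharp_commE A1 opprK; congr (_ + _).
  by rewrite /Lambda_formula -dlefN -A2 dlefD.
by apply/ffunP => S; rewrite !(extD, extN); ring.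
Qed.

End HessianMetric.

Theorem theorem5p7 (R : realType) (n : nat) (omega : superform R n)
    (phi : 'rV[R]_n -> R) (alpha : superform R n)
    (omega_smooth : smooth_form omega) (omega_closed : closed_form omega)
    (omega_positive : positive_11 omega) (phi_smooth : smooth phi)
    (alpha_smooth : smooth_form alpha)
    (alpha_compact : compactly_supported alpha) :
  forall x : 'rV[R]_n,
    Box omega phi alpha x
    = (Box_sharp omega phi alpha x + ddsharp_comm omega phi alpha x)%R.
Proof.
move=> x; apply: Box_Box_sharp => //.
by split=> //; apply/compactly_supportedP.
Qed.
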